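(* Let $n\ge 2$ and $P_0,P_1\in\mathcal{L}_a$. Let $\varphi$ be the exponentially concave function on $\Delta_n$ (described in the context) whose portfolio map $\boldsymbol{\pi}$ generates the optimal transport map $T^*(s)=s\odot\boldsymbol{\pi}(s^{-1})$ from $\tilde P_1$ to $\tilde P_0$ for the cost $c$. Assume that $\varphi$ is $C^2$ on $\Delta_n$ and that there exist constants $\alpha,\alpha'>0$ such that for all $q,q'\in\Delta_n$ $$\alpha\|q'-q\|^2\le \mathbf{D}[q':q]\le\alpha'\|q'-q\|^2,$$ where $\mathbf{D}[\cdot:\cdot]$ is the $L$-divergence of $\varphi$. Let $R^*$ be the optimal Monge coupling of $(P_0,P_1)$ for the cost $c$. Let $\lambda_N=\frac{4}{\alpha}N^{2/n}$ and let $M_N$ be the random coupling defined in the context with $\lambda=\lambda_N$. Then, $\mathbb{P}$-almost surely, $$\mathcal{W}_2^2(M_N,R^* )=O\left(N^{-1/n}\log N\right)\quad\text{as }N\to\infty.$$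
   Context: Simplex: $\Delta_n=\{p\in(0,1)^n:\sum_i p_i=1\}$. Group operation: $(p\odot q)_i=\frac{p_iq_i}{\sum_j p_jq_j}$; inverse: $(p^{-1})_i=\frac{1/p_i}{\sum_j 1/p_j}$. Cost: $c(p,q)=\log\left(\frac1n\sum_{i}\frac{q_i}{p_i}\right)-\frac1n\sum_{i}\log\frac{q_i}{p_i}$ for $p,q\in\Delta_n$. A coupling is optimal for $(P,Q)$ if it minimizes $\mathbb{E}[c(p,q)]$ among couplings of $P$ and $Q$; a Monge coupling is one of the form $(p,T(p))$, $p\sim P$. $\mathcal{L}_a$: Borel probability measures $P$ on $\Delta_n$ with $\sum_i\int|\log p_i|\,dP(p)<\infty$ that are absolutely continuous with respect to $(n-1)$-dimensional Lebesgue measure on $\Delta_n$. A function $\varphi:\Delta_n\to\mathbb{R}$ is exponentially concave if $e^{\varphi}$ is concave. Its portfolio map is $(\boldsymbol{\pi}(r))_i=r_i(1+\nabla_{e_i-r}\varphi(r))$, where $e_1,\dots,e_n$ is the standard basis of $\mathbb{R}^n$ and $\nabla_v$ is the directional derivative (defined where $\varphi$ is differentiable, i.e. Lebesgue-a.e.). For differentiable $\varphi$, its $L$-divergence is $\mathbf{D}[r:r']=\log(1+\nabla\varphi(r')\cdot(r-r'))-(\varphi(r)-\varphi(r'))$. For $P_0,P_1\in\mathcal{L}_a$, $\tilde P_0,\tilde P_1$ denote the pushforwards of $P_0,P_1$ under $p\mapsto p^{-1}$. Known fact: there is an exponentially concave $\varphi$ on $\Delta_n$ with portfolio map $\boldsymbol{\pi}$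 such that $q^{-1}\mapsto p^{-1}=T^*(q^{-1}):=q^{-1}\odot\boldsymbol{\pi}(q)$ pushes $\tilde P_1$ forward to $\tilde P_0$ and is the (a.e. unique) optimal Monge map for the cost $c(q^{-1},p^{-1})$; this is the $\varphi$ in the claim. Likewise the optimal coupling $R^*$ of $(P_0,P_1)$ for $c(p,q)$ is a.e. unique and Monge. Particle system: on a probability space $(\Omega,\mathcal{F},\mathbb{P})$ let $p(1),p(2),\dots$ be i.i.d. from $P_0$ and, independently, $q(1),q(2),\dots$ i.i.d. from $P_1$. For $\lambda>0$ let $$f_\lambda(q\mid p)=\frac{\Gamma(\lambda)}{\Gamma(\lambda/n)^n}\frac{1}{\prod_i q_i}\prod_{i=1}^n\left(\frac{q_i}{p_i}\right)^{\lambda/n}\left(\sum_{i=1}^n\frac{q_i}{p_i}\right)^{-\lambda}.$$ With $\mathcal{S}_N$ the permutations of $\{1,\dots,N\}$, set $M_N^\sigma=\frac1N\sum_{i=1}^N\delta_{(p(i),q(\sigma(i)))}$, $$\nu_N^\sigma=\frac{\prod_{i=1}^N f_\lambda(q(\sigma(i))\mid p(i))}{\sum_{\rho\in\mathcal{S}_N}\prod_{i=1}^N f_\lambda(q(\rho(i))\mid p(i))},\qquad M_N=\sum_{\sigma\in\mathcal{S}_N}\nu_N^\sigma M_N^\sigma .$$ $\mathcal{W}_2$ is the Wasserstein-2 distance for the Euclidean distance (here for measures on $\Delta_n\times\Delta_n\subset\mathbb{R}^{2n}$). *)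

(* Defs.v *)
From HB Require Import structures.
From mathcomp Require Import all_boot all_order all_algebra all_fingroup.
From mathcomp Require Import all_classical all_reals all_analysis.

Set Implicit Arguments.
Unset Strict Implicit.
Unset Printing Implicit Defensive.

Import Order.TTheory GRing.Theory Num.Theory.
Import numFieldNormedType.Exports.

Local Open Scope classical_set_scope.
Local Open Scope ring_scope.

(* Borel sigma-algebra on matrices, in particular on the row vectors 'rV[R]_n.
   Products 'rV[R]_n * 'rV[R]_n carry the product sigma-algebra, which is
   their Borel sigma-algebra by second countability. *)
HB.instance Definition _ (R : realType) (m n : nat) :=
  isMeasurable.Build (sigma_display (@open 'M[R]_(m, n))) 'M[R]_(m, n)
    (@sigma_algebra0 _ setT (@open 'M[R]_(m, n)))
    (@sigma_algebraC _ (@open 'M[R]_(m, n)))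
    (@sigma_algebra_bigcup _ setT (@open 'M[R]_(m, n))).

Section simplex.
Context {R : realType} {n : nat}.
Implicit Types (p q r s u v : 'rV[R]_n) (phi : 'rV[R]_n -> R).

Definition simplex : set 'rV[R]_n :=
  [set p | (forall i, 0 < p 0 i < 1) /\ \sum_i p 0 i = 1].

Definition sop p q : 'rV[R]_n :=
  \row_i (p 0 i * q 0 i / \sum_j p 0 j * q 0 j).

Definition sinv p : 'rV[R]_n := \row_i ((p 0 i)^-1 / \sum_j (p 0 j)^-1).

(* The library norm `|v| on matrices is the maximum norm. *)
Definition l2norm m (v : 'rV[R]_m) : R := Num.sqrt (\sum_i v 0 i ^+ 2).

Definition cost p q : R :=
  ln (n%:R^-1 * \sum_i q 0 i / p 0 i) - n%:R^-1 * \sum_i ln (q 0 i / p 0 i).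

Definition exp_concave phi :=
  convex_function (simplex : set (convex_lmodType 'rV[R]_n))
    (fun r => - expR (phi r)).

(* phi matters on the simplex only: for a tangent direction v (coordinates
   summing to 0), 'D_v phi r depends only on the values of phi on the simplex
   when r is in the simplex.  The directions e_i - r and r - r' used below are
   tangent. *)
Definition portfolio phi r : 'rV[R]_n :=
  \row_i (r 0 i * (1 + 'D_(delta_mx 0 i - r) phi r)).

Definition Ldiv phi r r' : R :=
  ln (1 + 'D_(r - r') phi r') - (phi r - phi r').

Definition tangent v := \sum_i v 0 i = 0.

(* C^2 regularity on the simplex as an (n-1)-dimensional manifold *)
Definition C2_simplex phi :=
  {within simplex, continuous phi} /\
  forall u, tangent u ->
    [/\ forall r, simplex r -> derivable phi r u,
        {within simplex, continuous ('D_u phi)} &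
        forall v, tangent v ->
          (forall r, simplex r -> derivable ('D_u phi) r v) /\
          {within simplex, continuous ('D_v ('D_u phi))}].

End simplex.

Section lebesgue.
Local Open Scope ereal_scope.
Context {R : realType}.

Fixpoint lebesgue_tuple (m : nat) : set (m.-tuple R) -> \bar R :=
  match m return set (m.-tuple R) -> \bar R with
  | 0 => \d_([tuple])
  | m'.+1 => pushforward (lebesgue_measure \x @lebesgue_tuple m')
               (fun z : R * m'.-tuple R => [tuple of z.1 :: z.2])
  end.

(* affine chart (x_1, ..., x_{n-1}) |-> (x_1, ..., x_{n-1}, 1 - sum_j x_j) *)
Definition simplex_chart n (x : n.-1.-tuple R) : 'rV[R]_n :=
  (\row_(i < n) if (i < n.-1)%N then nth 0 x i else 1 - \sum_(j <- x) j)%R.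

(* (n-1)-dimensional Lebesgue measure on the simplex; the constant factor
   sqrt n relating it to Euclidean surface measure is irrelevant for absolute
   continuity. *)
Definition simplex_lebesgue n : set 'rV[R]_n -> \bar R :=
  fun A => pushforward (@lebesgue_tuple n.-1) (@simplex_chart n)
             (simplex `&` A).

Definition class_La n (P : probability 'rV[R]_n R) :=
  [/\ P simplex = 1,
      \sum_(i < n) \int[P]_(p in simplex) `|ln (p 0%R i)|%:E < +oo &
      P `<< @simplex_lebesgue n].

End lebesgue.

Section couplings.
Local Open Scope ereal_scope.
Context {R : realType}.

Definition coupling d1 d2 (X : measurableType d1) (Y : measurableType d2)
    (mu : set X -> \bar R) (nu : set Y -> \bar R)
    (P : probability (X * Y)%type R) :=
  (forall A, measurable A -> pushforward P fst A = mu A) /\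
  (forall B, measurable B -> pushforward P snd B = nu B).

Context {n : nat}.
Local Notation V := 'rV[R]_n.

Definition optimal_coupling (mu nu : set V -> \bar R)
    (P : probability (V * V)%type R) :=
  coupling mu nu P /\
  forall P' : probability (V * V)%type R, coupling mu nu P' ->
    \int[P]_(z in simplex `*` simplex) (cost z.1 z.2)%:E <=
    \int[P']_(z in simplex `*` simplex) (cost z.1 z.2)%:E.

(* P is the law of (p, T p) with p distributed according to mu, which is
   concentrated on the simplex; T is irrelevant outside the simplex. *)
Definition monge_coupling (mu : set V -> \bar R) (T : V -> V)
    (P : probability (V * V)%type R) :=
  measurable_fun simplex T /\
  forall A, measurable A -> P A = mu (simplex `&` [set p | A (p, T p)]).

Definition optimal_map (mu nu : set V -> \bar R) (T : V -> V) :=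
  exists2 P, monge_coupling mu T P & optimal_coupling mu nu P.

(* Euclidean distance of R^(2n) *)
Definition dist_pair (z w : (V * V)%type) : R :=
  l2norm (row_mx z.1 z.2 - row_mx w.1 w.2)%R.

Definition W2 (mu nu : set (V * V)%type -> \bar R) : \bar R :=
  poweR (ereal_inf
    [set \int[P]_z (dist_pair z.1 z.2 ^+ 2)%:E
      | P in [set P : probability ((V * V) * (V * V))%type R |
               coupling mu nu P]]) 2^-1.

End couplings.

Section particles.
Context {R : realType} {n : nat}.
Local Notation V := 'rV[R]_n.

Definition Gamma (x : R) : R :=
  \int[lebesgue_measure]_(t in `]0%R, +oo[) (t `^ (x - 1) * expR (- t)).

Definition f_density (lambda : R) (q p : V) : R :=
  Gamma lambda / Gamma (lambda / n%:R) ^+ n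
  * (\prod_i q 0 i)^-1
  * (\prod_i (q 0 i / p 0 i) `^ (lambda / n%:R))
  * (\sum_i q 0 i / p 0 i) `^ (- lambda).

(* Particles are indexed from 0. *)
Variables (N : nat) (p q : nat -> V).

Definition M_sigma (s : 'S_N) (A : set (V * V)%type) : \bar R :=
  (N%:R^-1%:E * \sum_(i < N) \d_(p i, q (s i)) A)%E.

Definition nu_sigma (lambda : R) (s : 'S_N) : R :=
  (\prod_(i < N) f_density lambda (q (s i)) (p i)) /
  (\sum_(t : 'S_N) \prod_(i < N) f_density lambda (q (t i)) (p i)).

Definition M_N (lambda : R) (A : set (V * V)%type) : \bar R :=
  (\sum_(s : 'S_N) (nu_sigma lambda s)%:E * M_sigma s A)%E.

End particles.

Section independence.
Context {d d'} {Om : measurableType d} {T : measurableType d'} {R : realType}.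
Variable PP : probability Om R.

Definition has_law (X : {RV PP >-> T}) (mu : probability T R) :=
  forall A, measurable A -> distribution PP X A = mu A.

Definition mutually_independent (I : choiceType) (X : I -> {RV PP >-> T}) :=
  forall (J : seq I) (A : I -> set T), uniq J ->
    (forall i, measurable (A i)) ->
    PP (\bigcap_(i in [set` J]) (X i @^-1` A i)) =
    (\prod_(i <- J) PP (X i @^-1` A i))%E.

Definition join_families (X Y : nat -> {RV PP >-> T}) (k : nat + nat) :
    {RV PP >-> T} :=
  match k with inl i => X i | inr j => Y j end.

End independence.

(* Main.v *)
Require Import Defs.
From HB Require Import structures.
From mathcomp Require Import all_boot all_order all_algebra all_fingroup.
From mathcomp Require Import all_classical all_reals all_analysis.
From mathcomp Require Import measurable_realfun ring lra.

Set Implicit Arguments.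
Unset Strict Implicit.
Unset Printing Implicit Defensive.

Import Order.TTheory GRing.Theory Num.Theory.
Import numFieldNormedType.Exports.

Local Open Scope classical_set_scope.
Local Open Scope ring_scope.

(** Why the particle coupling converges at this rate.

    Suppose that the optimal map carries p to its target t.  The portfolio map
    expresses p up to scale by the first derivatives of phi at t, and this
    turns the cost into an L-divergence up to a function of the endpoint:
      c(p, q) = c(p, t) + D[q : t] + h(q) - h(t),
      h(q) = phi(q) - (1/n) sum_i ln q_i                ([cost_transported]).
    Over a matching s, the sum of the h(q_(s i)) and the product of the
    prefactors of f_lambda do not depend on s.  The weights nu_s are therefore
    proportional to exp(- lambda E(s)) with E(s) = sum_i D[q_(s i) : t_i]
    ([nu_sigma_gibbs]).  The mean energy under such a Gibbs law exceeds the
    energy of any given matching by at most (ln N!) / lambda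
    ([gibbs_energy_le]), and dividing by N leaves ln N / lambda, of order
    N^(-2/n) ln N.  Through the two bounds on D, the mean squared distance
    between q_(s i) and t_i is then controlled by the cost of matching the
    sample q_1, ..., q_N with the targets t_1, ..., t_N in the best way.
    These two samples have the same law P1.  It remains to transport the
    empirical measure of the pairs (p_i, t_i) onto their common law R*;
    [W2_particle_coupling_le] glues both steps.

    Both transport problems are solved on the tree of dyadic cells.  There is
    a matching, or a fractional coupling, for which the mass that leaves its
    cell is bounded by the total variation discrepancy of the cell masses, at
    all levels simultaneously ([exists_treelike_matching],
    [exists_treelike_coupling]).  Points of a common cell of level l are at
    squared distance of order 4^-l, so a discrepancy delta_l costs
    4^-L + sum_(l <= L) 4^-l delta_l up to a constant.  A Chernoff bound and
    the Borel-Cantelli lemma give, almost surely and for all l <= N when N is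
    large, delta_l of order sqrt ((2^(2nl) + ln N) / N), since pairs of points
    of the simplex meet at most 2^(2nl) cells ([empirical_tv_ae]).  The choice
    2^(2nL) ~ N balances the two errors: each of the L ~ ln N levels
    contributes at most about 4^-L ~ N^(-1/n) ([dyadic_rate]).

    Finally the map generated by phi is known to be optimal from the inverted
    P1 to the inverted P0, whereas R* is optimal from P0 to P1, with some
    transport map T.  Both are compared on a target q with law P1, whose source
    is x(q).  The law of (x(q), q) competes with R*, and in the cost identity
    the terms h cancel after integration; optimality of R* thus forces the
    integral of D[T(x(q)) : q] to be at most 0, so T(x(q)) = q almost surely
    ([monge_transported]). *)

(** * Matchings that respect a tree of cells *)

Section matching.
Local Open Scope set_scope.
Variables (Z : Type) (K : nat -> finType) (c : forall l, Z -> K l).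
Hypothesis nested : forall l z z', c l.+1 z = c l.+1 z' -> c l z = c l z'.
Variables (N L : nat) (x y : 'I_N -> Z).

Let dis (s : 'S_N) l := [set i | c l (x i) != c l (y (s i))].
Let cost (s : 'S_N) := (\sum_(l < L.+1) #|dis s l|)%N.

Lemma nested_le l l' z z' : (l <= l')%N -> c l' z = c l' z' -> c l z = c l z'.
Proof.
elim: l' => [|l' IH]; first by rewrite leqn0 => /eqP ->.
by rewrite leq_eqVlt => /orP[/eqP->//|/IH h /nested].
Qed.

(** A matching that minimizes the number of disagreements, summed over all
    levels, does the job.  If two mismatched indices i and j had x_i and
    y_(s j) in a common cell of level l, exchanging their partners would lower
    the number of disagreements at level l and raise it at no other level.
    Hence in each cell either all the points x or all the points y are matched
    inside the cell, and the mismatched x are at most the excess of x over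
    y. *)
Lemma exists_treelike_matching : exists s : 'S_N, forall l, (l <= L)%N ->
  (#|[set i | c l (x i) != c l (y (s i))]| <=
   \sum_(k : K l) (#|[set i | c l (x i) == k]| - #|[set i | c l (y i) == k]|))%N.
Proof.
pose s := [arg min_(s < (1%g : 'S_N)) cost s].
have smin t : (cost s <= cost t)%N.
  by rewrite /s; case: arg_minnP => // u _; apply.
exists s => l lL.
(* improving exchanges are excluded by minimality *)
have noswap i j : c l (x i) != c l (y (s i)) -> c l (x j) != c l (y (s j)) ->
    c l (x i) = c l (y (s j)) -> False.
  move=> ii jj ij.
  have nij : i != j.
    by apply/eqP => e; move: ij ii; rewrite e => -> /eqP.
  pose t : 'S_N := (tperm i j * s)%g.
  have ti : t i = s j by rewrite permM tpermL.
  have tj : t j = s i by rewrite permM tpermR.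
  have tk k : k != i -> k != j -> t k = s k.
    by move=> ki kj; rewrite permM tpermD // eq_sym.
  have := smin t; rewrite leqNgt => /negP; apply.
  have spl (u : 'S_N) l' : #|dis u l'| = ((i \in dis u l') + (j \in dis u l') +
     #|dis u l' :\ i :\ j|)%N.
    by rewrite (cardsD1 i) (cardsD1 j (_ :\ i)) !inE (eq_sym j i) nij addnA.
  have rest l' : dis t l' :\ i :\ j = dis s l' :\ i :\ j.
    apply/setP => k; rewrite !inE.
    by have [//|kj /=] := eqVneq k j; have [//|ki /=] := eqVneq k i; rewrite tk.
  (* Finer levels: i and j already disagree there with their old partners.
     Coarser levels: x_i and y_(s j) agree, so the new pair (j, s i) disagrees
     only if one of the two old pairs does. *)
  have le l' : (#|dis t l'| <= #|dis s l'|)%N.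
    rewrite !spl rest leq_add2r !inE ti tj.
    have [ll'|l'l] := leqP l l'.
      have -> : c l' (x i) != c l' (y (s i)).
        by apply: contraNN ii => /eqP /(nested_le ll') ->.
      have -> : c l' (x j) != c l' (y (s j)).
        by apply: contraNN jj => /eqP /(nested_le ll') ->.
      by case: (_ != _) => //; case: (_ != _).
    have -> : c l' (x i) = c l' (y (s j)) by apply: nested_le ij; exact: ltnW.
    rewrite eqxx add0n.
    by do 3![case: eqP => //=] => e1 e2 e3; case: e3; rewrite -?e2 ?e1.
  apply: (@leq_trans (\sum_(l' < L.+1) (#|dis s l'| - (l' == l :> nat)))%N.+1).
    rewrite ltnS; apply: leq_sum => l' _.
    have [e|_] := eqVneq (l' : nat) l; last by rewrite subn0.
    rewrite e !spl rest !inE ti tj ii jj ij eqxx add0n.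
    by case: (_ != _); rewrite // addnC addnA ?addn1 ?add1n ?addn0 ?subn1 //= addnC.
  pose l0 := Ordinal (lL : (l < L.+1)%N).
  rewrite /cost [in leqRHS](bigD1 l0) // [in leqLHS](bigD1 l0) //= eqxx.
  rewrite -addSn leq_add //; first by rewrite spl !inE ii subSS subn0.
  by apply: leq_sum => l' _; exact: leq_subr.
rewrite -sum1_card (partition_big (fun i => c l (x i)) xpredT) //=.
apply: leq_sum => k _; rewrite sum1_card.
set A := [set i | c l (x i) == k].
set B := [set i | c l (y i) == k].
(* If a point of y in cell k is matched from outside, no point of x in k is
   mismatched; otherwise all the points of y in k are matched inside k. *)
case: (pickP (fun j => (c l (y (s j)) == k) && (c l (x j) != k))) => [j /andP[/eqP yj xj]|no].
  rewrite eq_card0 // => i; rewrite !inE.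
  apply/negbTE/negP => /andP[d /eqP xi]; rewrite inE in d.
  apply: (noswap i j d); last by rewrite xi yj.
  by rewrite yj.
have sB : #|B| = #|[set i | c l (y (s i)) == k]|.
  rewrite -(card_imset _ (@perm_inj _ s)); congr #|pred_of_set _|.
  apply/setP => i; rewrite !inE; apply/idP/imsetP => [h|[j]].
    by exists (s^-1 i)%g; rewrite ?inE permKV.
  by rewrite inE => h ->.
rewrite sB -cardsDS //; last first.
  apply/fintype.subsetP => j; rewrite !inE => h; have := no j; rewrite h /=.
  by move/negbFE.
apply: subset_leq_card; apply/fintype.subsetP => i; rewrite !inE.
rewrite unfold_in => /andP[]; rewrite inE => d /eqP h.
by rewrite h eqxx andbT -{1}h eq_sym.
Qed.
End matching.

(** * Fractional couplings that respect a tree of cells *)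

Section fractional.
Variables (R : realFieldType) (X Y : finType) (K : nat -> finType).
Variables (cx : forall l, X -> K l) (cy : forall l, Y -> K l).
Variables (a : X -> R) (b : Y -> R).
Hypotheses (a_ge0 : forall x, 0 <= a x) (b_ge0 : forall y, 0 <= b y).

Let discrepancy l :=
  \sum_k `|\sum_(x | cx l x == k) a x - \sum_(y | cy l y == k) b y|.

Let subcoupling (g : X -> Y -> R) :=
  [/\ forall x y, 0 <= g x y, forall x, \sum_y g x y <= a x
    & forall y, \sum_x g x y <= b y].

(** In each cell of level l the residual masses r and s are coupled by
    r(x) s(y) / max(A, B), where A and B are their totals in the cell.  This
    exhausts the smaller of the two residues, so that the mass left over is the
    excess A - B.  The part g placed before respects the cells of level l, and
    its contributions to A and B cancel: the excess is the discrepancy of the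
    original masses. *)
Lemma subcoupling_step l g : subcoupling g ->
    (forall x y, cx l x != cy l y -> g x y = 0) ->
  exists g', [/\ subcoupling g', forall x y, g x y <= g' x y,
    forall x y, cx l x != cy l y -> g' x y = 0
    & \sum_x a x - \sum_x \sum_y g' x y <= discrepancy l].
Proof.
move=> [g0 ga gb] gl.
pose r x := a x - \sum_y g x y.
pose s y := b y - \sum_x g x y.
have r0 x : 0 <= r x by rewrite subr_ge0.
have s0 y : 0 <= s y by rewrite subr_ge0.
pose A k := \sum_(x | cx l x == k) r x.
pose B k := \sum_(y | cy l y == k) s y.
have A0 k : 0 <= A k by apply: sumr_ge0.
have B0 k : 0 <= B k by apply: sumr_ge0.
pose m k := Num.max (A k) (B k).
have m0 k : 0 <= m k by rewrite le_max A0.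
pose h x y := if cx l x == cy l y then r x * s y / m (cx l x) else 0.
have h0 x y : 0 <= h x y.
  by rewrite /h; case: ifP => // _; rewrite divr_ge0 // mulr_ge0.
have frac (u v : R) : 0 <= u -> u <= v -> u / v <= 1.
  move=> u0 uv; have [v0|vn0] := eqVneq v 0; first by rewrite v0 invr0 mulr0.
  by rewrite ler_pdivrMr ?mul1r // lt_def vn0 (le_trans u0).
have hx x : \sum_y h x y = r x * (B (cx l x) / m (cx l x)).
  rewrite /h -big_mkcond /= mulrA /B mulr_sumr mulr_suml.
  by apply: eq_bigl => y; rewrite eq_sym.
have hy y : \sum_x h x y = s y * (A (cy l y) / m (cy l y)).
  rewrite /h -big_mkcond /= mulrA /A mulr_sumr mulr_suml.
  by apply: eq_bigr => x /eqP ->; rewrite (mulrC (r x)).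
exists (fun x y => g x y + h x y); split.
- split=> [x y|x|y]; first by rewrite addr_ge0.
  + rewrite big_split /= hx -lerBrDl -/(r x) ler_piMr // frac //.
    by rewrite le_max lexx orbT.
  + rewrite big_split /= hy -lerBrDl -/(s y) ler_piMr // frac //.
    by rewrite le_max lexx.
- by move=> x y; rewrite lerDl.
- by move=> x y xy; rewrite gl // /h (negbTE xy) addr0.
have -> : \sum_x a x - \sum_x \sum_y (g x y + h x y) =
    \sum_k (A k - A k * (B k / m k)).
  rewrite -sumrB (partition_big (cx l) xpredT) //=; apply: eq_bigr => k _.
  rewrite /A mulr_suml -sumrB; apply: eq_bigr => x /eqP xk.
  by rewrite big_split /= hx xk opprD addrA.
apply: ler_sum => k _.
have -> : \sum_(x | cx l x == k) a x - \sum_(y | cy l y == k) b y = A k - B k.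
  rewrite /A /B !sumrB.
  suff -> : \sum_(x | cx l x == k) \sum_y g x y =
    \sum_(y | cy l y == k) \sum_x g x y by ring.
  rewrite (exchange_big_dep xpredT) //= [RHS](big_mkcond (fun y => cy l y == k)).
  apply: eq_bigr => y _; rewrite big_mkcond /=; case: ifP => yk.
    apply: eq_bigr => x _; case: ifP => // /negbT; rewrite andbT => xk.
    by rewrite gl // (eqP yk).
  rewrite big1 // => x _; case: ifP => // /andP[/eqP xk _]; rewrite gl // xk eq_sym.
  by rewrite yk.
rewrite /m; have [AB|BA] := leP (A k) (B k).
  have [B0'|Bn0] := eqVneq (B k) 0.
    by rewrite B0' mul0r mulr0 !subr0 ler_norm.
  by rewrite divff // mulr1 subrr.
have -> : A k - A k * (B k / A k) = A k - B k.
  by field; rewrite gt_eqF // (le_lt_trans _ BA).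
exact: ler_norm.
Qed.

Hypothesis nested : forall l x y, cx l.+1 x = cy l.+1 y -> cx l x = cy l y.
Variable k0 : K 0.
Hypotheses (cx0 : forall x, cx 0 x = k0) (cy0 : forall y, cy 0 y = k0).
Hypothesis ab : \sum_x a x = \sum_y b y.

(** Couple as much mass as possible in the cells of level L, then in those of
    level L - 1, and so on up to the root.  The mass that is still free after
    level l is at most the discrepancy at level l, and only this mass can later
    be sent to another cell of level l.  At the root nothing remains free. *)
Lemma exists_treelike_coupling L : exists g : X -> Y -> R,
  [/\ forall x y, 0 <= g x y, forall x, \sum_y g x y = a x,
      forall y, \sum_x g x y = b y
    & forall l, (l <= L)%N ->
      \sum_x \sum_(y | cx l x != cy l y) g x y <= discrepancy l].
Proof.
have build m : (m <= L)%N -> exists g, [/\ subcoupling g,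
    forall x y, cx (L - m) x != cy (L - m) y -> g x y = 0
  & forall l, (L - m <= l <= L)%N ->
      \sum_x \sum_(y | cx l x != cy l y) g x y
        + (\sum_x a x - \sum_x \sum_y g x y) <= discrepancy l].
  elim: m => [_|m IH mL].
    have [||g [sg _ gl gd]] := @subcoupling_step L (fun _ _ => 0).
    - by split=> // *; rewrite big1.
    - by [].
    exists g; rewrite subn0; split=> // l /andP[Ll lL].
    have {Ll lL} -> : l = L by apply/eqP; rewrite eqn_leq lL.
    rewrite [X in X + _]big1 ?add0r // => x _.
    by rewrite big1 // => y /gl.
  have {IH} [g [sg gl gd]] := IH (ltnW mL).
  have LmE : (L - m = (L - m.+1).+1)%N by rewrite subnS prednK // subn_gt0.
  have gl' x y : cx (L - m.+1) x != cy (L - m.+1) y -> g x y = 0.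
    by move=> xy; apply: gl; apply: contraNN xy => /eqP; rewrite LmE => /nested ->.
  have [g' [sg' gg' g'l g'd]] := subcoupling_step sg gl'.
  exists g'; split=> // l /andP[lel lL].
  have [e|lel'] := eqVneq l (L - m.+1)%N.
    rewrite e [X in X + _]big1 ?add0r // => x _.
    by rewrite big1 // => y /g'l.
  have /gd : (L - m <= l <= L)%N by rewrite lL andbT LmE ltn_neqAle eq_sym lel'.
  apply: le_trans.
  have dd : \sum_x \sum_(y | cx l x != cy l y) (g' x y - g x y) <=
            \sum_x \sum_y (g' x y - g x y).
    apply: ler_sum => x _; rewrite big_mkcond /=; apply: ler_sum => y _.
    by case: ifP => // _; rewrite subr_ge0.
  move: dd; under eq_bigr do rewrite sumrB.
  rewrite sumrB; under [X in _ <= X]eq_bigr do rewrite sumrB.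
  by rewrite sumrB; lra.
have [g [[g0 ga gb] _ gd]] := build L (leqnn L).
have d0 : discrepancy 0 = 0.
  rewrite /discrepancy big1 // => k _; have [->|nk] := eqVneq k k0.
    under eq_bigl do rewrite cx0 eqxx.
    under [X in _ - X]eq_bigl do rewrite cy0 eqxx.
    by rewrite ab subrr normr0.
  rewrite !big1 ?subrr ?normr0 //.
    by move=> y; rewrite cy0 eq_sym (negbTE nk).
  by move=> x; rewrite cx0 eq_sym (negbTE nk).
have dis0 l : 0 <= \sum_x \sum_(y | cx l x != cy l y) g x y.
  by apply: sumr_ge0 => x _; apply: sumr_ge0.
have full : \sum_x a x <= \sum_x \sum_y g x y.
  have := gd 0; rewrite subnn d0 => /(_ isT); have := dis0 0%N; lra.
have eqsum (I : finType) (u v : I -> R) : (forall i, u i <= v i) ->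
    \sum_i v i <= \sum_i u i -> forall i, u i = v i.
  move=> uv vu i; apply/eqP; rewrite eq_le uv /= -subr_le0.
  apply: le_trans (_ : \sum_j (v j - u j) <= 0); last by rewrite sumrB subr_le0.
  by rewrite (bigD1 i) //= lerDl sumr_ge0 // => j _; rewrite subr_ge0.
exists g; split=> //.
- exact: eqsum.
- by apply: eqsum => //; rewrite -ab exchange_big.
move=> l lL; have := gd l; rewrite subnn lL => /(_ isT); apply: le_trans.
by rewrite lerDl subr_ge0 ler_sum.
Qed.
End fractional.

(** * Gibbs measures, and tails of empirical frequencies *)

(** The mean of H under the law nu proportional to exp(-H) is the entropy of
    nu minus ln Z, where Z is the normalizing sum.  The entropy is at most
    ln #|S|, and Z is at least its term at s0. *)
Lemma gibbs_energy_le (R : realType) (S : finType) (H : S -> R) (s0 : S) :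
  \sum_s expR (- H s) / (\sum_t expR (- H t)) * H s <= H s0 + ln #|S|%:R.
Proof.
pose Z := \sum_t expR (- H t); rewrite -/Z.
have Z0 : 0 < Z.
  rewrite /Z (bigD1 s0) //=; apply: ltr_pwDl; rewrite ?expR_gt0 //; apply: sumr_ge0 => t _.
  exact: expR_ge0.
pose nu s := expR (- H s) / Z.
have nu0 s : 0 < nu s by rewrite divr_gt0 ?expR_gt0.
have nu1 : \sum_s nu s = 1 by rewrite -mulr_suml divff ?gt_eqF.
have S0 : 0 < #|S|%:R :> R by rewrite ltr0n; apply/card_gt0P; exists s0.
have Hnu s : H s = - ln (nu s) - ln Z.
  by rewrite lnM ?posrE ?invr_gt0 ?expR_gt0 // expRK lnV ?posrE //; ring.
have lnZ : - ln Z <= H s0.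
  rewrite lerNl -(expRK (- H s0)) ler_ln ?posrE ?expR_gt0 // /Z (bigD1 s0) //=.
  by rewrite lerDl sumr_ge0 // => t _; exact: expR_ge0.
suff : \sum_s nu s * (- ln (nu s) - ln #|S|%:R) <= 0.
  under eq_bigr do rewrite mulrBr; rewrite sumrB -mulr_suml nu1 mul1r => h.
  under eq_bigr do rewrite -/(nu _) Hnu mulrBr.
  by rewrite sumrB -mulr_suml nu1 mul1r; lra.
apply: le_trans (_ : \sum_s (#|S|%:R^-1 - nu s) <= 0); last first.
  by rewrite sumrB nu1 sumr_const -[X in X - _]mulr_natr mulVf ?gt_eqF // subrr.
apply: ler_sum => s _.
have := @le_ln1Dx R ((nu s * #|S|%:R)^-1 - 1).
rewrite ltrBrDl subrr invr_gt0 (mulr_gt0 (nu0 s) S0) => /(_ isT).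
rewrite [1 + _]addrC subrK lnV ?posrE; last exact: mulr_gt0.
rewrite lnM ?posrE // opprD => h.
have /(ler_wpM2l (ltW (nu0 s))) := h.
by rewrite [leRHS]mulrBr invfM mulr1 mulrA divff ?gt_eqF // mul1r.
Qed.

Lemma ln_fact_le (R : realType) N : ln N`!%:R <= N%:R * ln N%:R :> R.
Proof.
elim: N => [|N IH]; first by rewrite fact0 ln1 mul0r.
rewrite factS natrM lnM ?posrE ?ltr0n ?fact_gt0 // -[X in _ <= X * _]natr1 mulrDl mul1r.
rewrite addrC lerD2r (le_trans IH) // ler_wpM2l //.
case: N {IH} => [|N]; first by rewrite ln1 ln0.
by rewrite ler_ln ?posrE ?ltr0n // ler_nat.
Qed.

Lemma expR_le_quad (R : realType) (x : R) : x <= 2^-1 ->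
  expR x <= 1 + x + 2 * x ^+ 2.
Proof.
move=> x2; have := expR_ge1Dx (- x).
rewrite expRN => h; have x1 : 0 < 1 - x by lra.
have : expR x <= (1 - x)^-1.
  by rewrite -[expR x]invrK lef_pV2 ?posrE ?invr_gt0 ?expR_gt0.
move=> /le_trans; apply; rewrite -[_^-1]mul1r ler_pdivrMr //.
have : 0 <= x ^+ 2 * (1 - 2 * x) by rewrite mulr_ge0 ?sqr_ge0 //; lra.
by lra.
Qed.

Section multinomial.
Variables (R : realType) (K : finType) (m : K -> R).
Hypotheses (m_ge0 : forall k, 0 <= m k) (m_sum : \sum_k m k = 1).
Variables (N : nat) (N_gt0 : (0 < N)%N).

Definition freq (c : 'I_N -> K) (k : K) : R := N%:R^-1 * \sum_(i < N) (c i == k)%:R.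

(** The total variation is a maximum over the 2^#|K| sign vectors e of the
    linear statistics sum_i f_e(c_i), where f_e is e centred under m.  As
    |f_e| <= 2, each has moment generating function at most exp(8 u^2) per
    sample; the Chernoff bound with u = t / 16 gives the exponent
    8 u^2 - u t = - t^2 / 32. *)
Lemma multinomial_tv_tail (t : R) : 0 <= t <= 2 ->
  \sum_(c : {ffun 'I_N -> K} | t < \sum_k `|freq c k - m k|) \prod_i m (c i)
  <= 2 ^+ #|K| * expR (- (N%:R * t ^+ 2 / 32)).
Proof.
move=> /andP[t0 t2].
pose sg (b : bool) : R := if b then 1 else -1.
pose f (e : {ffun K -> bool}) k := sg (e k) - \sum_j sg (e j) * m j.
pose u := t / 16.
have N0 : 0 < N%:R :> R by rewrite ltr0n.
have sg1 b : `|sg b| = 1 by case: b; rewrite /sg ?normrN normr1.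
have f2 e k : `|f e k| <= 2.
  rewrite (le_trans (ler_normB _ _)) // sg1 -[2]/(1 + 1) lerD2l -m_sum.
  apply: le_trans (ler_norm_sum _ _ _) _; apply: ler_sum => j _.
  by rewrite normrM sg1 mul1r ger0_norm.
have f0 e : \sum_k m k * f e k = 0.
  under eq_bigr do rewrite mulrBr; rewrite sumrB -mulr_suml m_sum mul1r.
  by apply/eqP; rewrite subr_eq0; apply/eqP/eq_bigr => k _; rewrite mulrC.
(* 1 + x + 2 x^2 dominates exp x for x = u f <= 1/2, and f has mean 0 *)
have mgf e : \sum_k m k * expR (u * f e k) <= expR (8 * u ^+ 2).
  apply: le_trans (expR_ge1Dx _).
  apply: le_trans (_ : _ <= \sum_k m k * (1 + u * f e k + 8 * u ^+ 2)) _.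
    apply: ler_sum => k _; apply: ler_wpM2l => //.
    have fk := f2 e k; have fk' := ler_norm (f e k).
    apply: le_trans (expR_le_quad _) _.
      have : u * f e k <= u * 2 by rewrite ler_wpM2l ?(le_trans fk') // /u; lra.
      by move=> /le_trans; apply; rewrite /u; lra.
    rewrite lerD2l exprMn mulrCA [leRHS]mulrC ler_wpM2l ?sqr_ge0 //.
    have : f e k ^+ 2 <= 2 ^+ 2 by rewrite -real_normK ?num_real // lerXn2r ?nnegrE.
    by lra.
  under eq_bigr do rewrite mulrDr mulrDr mulr1 mulrCA.
  by rewrite big_split big_split /= -mulr_sumr f0 -mulr_suml m_sum mulr0 addr0 mul1r.
have main e : \sum_(c : {ffun 'I_N -> K})
    (\prod_i m (c i)) * expR (u * (\sum_i f e (c i) - N%:R * t)) <=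
    expR (- (N%:R * t ^+ 2 / 32)).
  have -> : \sum_(c : {ffun 'I_N -> K})
    (\prod_i m (c i)) * expR (u * (\sum_i f e (c i) - N%:R * t)) =
    (\prod_(i < N) \sum_k m k * expR (u * f e k)) * expR (- (u * N%:R * t)).
    rewrite bigA_distr_bigA /= mulr_suml; apply: eq_bigr => c _.
    rewrite [in RHS]big_split /= -[RHS]mulrA -expR_sum -expRD; congr (_ * expR _).
    by rewrite mulrBr mulr_sumr mulrA.
  apply: le_trans (_ : _ <= expR (8 * u ^+ 2) ^+ N * expR (- (u * N%:R * t))) _.
    rewrite ler_wpM2r ?expR_ge0 // -[X in _ ^+ X]card_ord -prodr_const.
    apply: ler_prod => i _; rewrite mgf andbT sumr_ge0 // => k _.
    by rewrite mulr_ge0 ?expR_ge0.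
  rewrite -expRM_natl -expRD ler_expR /u le_eqVlt; apply/orP; left; apply/eqP.
  by field.
apply: le_trans (_ : _ <= \sum_(e : {ffun K -> bool}) expR (- (N%:R * t ^+ 2 / 32))) _; last first.
  by rewrite sumr_const card_ffun card_bool -[leLHS]mulr_natl natrX.
apply: le_trans (ler_sum _ (fun e _ => main e)).
rewrite exchange_big /= [leLHS]big_mkcond; apply: ler_sum => c _.
have p0 : 0 <= \prod_i m (c i) by apply: prodr_ge0.
case: ifP => tc; last first.
  by apply: sumr_ge0 => e _; rewrite mulr_ge0 ?expR_ge0.
(* the sign vector that realizes the total variation of c *)
pose e := [ffun k => 0 <= freq c k - m k].
rewrite (bigD1 e) //= -[leLHS]addr0 lerD //; last first.
  by apply: sumr_ge0 => ? _; rewrite mulr_ge0 ?expR_ge0.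
rewrite ler_peMr // -[leLHS]expR0 ler_expR mulr_ge0 //; first by rewrite /u; lra.
rewrite subr_ge0 -ler_pdivlMl // (le_trans (ltW tc)) //.
have -> : \sum_i f e (c i) = \sum_k (\sum_(i < N) (c i == k)%:R) * sg (e k) - N%:R * \sum_j sg (e j) * m j.
  rewrite sumrB sumr_const card_ord mulr_natl; congr (_ - _).
  under [RHS]eq_bigr do rewrite mulr_suml.
  rewrite exchange_big /=; apply: eq_bigr => i _.
  rewrite (bigD1 (c i)) //= eqxx mul1r big1 ?addr0 // => k.
  by rewrite eq_sym => /negbTE ->; rewrite mul0r.
rewrite mulrBr mulKf ?gt_eqF // mulr_sumr -sumrB; apply: ler_sum => k _.
rewrite mulrA -/(freq c k) (mulrC (sg _)) -mulrBl /sg ffunE.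
by case: ifPn => [/ger0_norm ->|]; rewrite ?mulr1 // -ltNge => /ltr0_norm ->; rewrite mulrN1.
Qed.
End multinomial.

(** * Almost sure uniform convergence of empirical cell frequencies *)

Section finite_unions.
Context d (T : measurableType d) (R : realType).
Local Open Scope ereal_scope.

Lemma measure_bigsetU_le (mu : {measure set T -> \bar R}) (I : finType)
    (P : pred I) (F : I -> set T) : (forall i, measurable (F i)) ->
  mu (\big[setU/set0]_(i | P i) F i) <= \sum_(i | P i) mu (F i).
Proof.
move=> mF; elim: (index_enum I) => [|i r IH].
  by rewrite !big_nil measure0.
rewrite !big_cons; case: (P i) => //.
apply: le_trans (measureU2 _ _ _) _ => //; first exact: bigsetU_measurable.
exact: leeD2l.
Qed.

Lemma mem_bigsetU (U : Type) (I : finType) (P : pred I) (F : I -> set U) i x :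
  P i -> F i x -> (\big[setU/set0]_(i | P i) F i) x.
Proof. by move=> Pi Fx; rewrite (bigD1 i) //=; left. Qed.

(** A finite-valued map splits a measure; only its fibres need to be
    measurable, so no measurable structure on the finite type is involved. *)
Lemma measure_fibres (mu : {measure set T -> \bar R}) (K : finType)
    (c : T -> K) (A : set T) :
    measurable A -> (forall k, measurable (c @^-1` [set k])) ->
  mu A = \sum_k mu (A `&` c @^-1` [set k]).
Proof.
move=> mA mc.
have mr (r : seq K) : measurable [set x | c x \in r].
  elim: r => [|k r IH]; first by rewrite (_ : [set _ | _] = set0) //; apply/seteqP; split.
  rewrite (_ : [set _ | _] = c @^-1` [set k] `|` [set x | c x \in r]).
    exact: measurableU.
  apply/seteqP; split=> x /=; rewrite inE; last by case=> [->|->]; rewrite ?eqxx ?orbT.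
  by case/orP => [/eqP|]; [left|right].
have main (r : seq K) : uniq r ->
    mu (A `&` [set x | c x \in r]) = \sum_(k <- r) mu (A `&` c @^-1` [set k]).
  elim: r => [_|k r IH /= /andP[kr ur]].
    rewrite big_nil (_ : _ `&` _ = set0) ?measure0 //.
    by apply/seteqP; split=> x // [].
  rewrite big_cons -IH // -measureU; first last.
  - apply/seteqP; split=> x //= [[_ ->] [_ h]].
    by rewrite h in kr.
  - exact: measurableI.
  - exact: measurableI.
  congr (mu _); rewrite -setIUr; congr (_ `&` _).
  apply/seteqP; split=> x /=; rewrite inE; last by case=> [->|->]; rewrite ?eqxx ?orbT.
  by case/orP => [/eqP|]; [left|right].
rewrite -(main _ (index_enum_uniq _)); congr (mu _).
by apply/seteqP; split=> x /=; rewrite mem_index_enum; [|case].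
Qed.

(** Bounding the partial sums of b replaces a convergence proof in the
    applications, where b telescopes. *)
Lemma borel_cantelli_bounded (mu : {measure set T -> \bar R})
    (F : (set T)^nat) (b : R^nat) (B : R) :
    (forall n, measurable (F n)) -> (forall n, mu (F n) <= (b n)%:E) ->
    (forall m, (\sum_(n < m) b n <= B)%R) ->
  {ae mu, forall w, \forall n \near \oo, ~ F n w}.
Proof.
move=> mF Fb bB.
have sumF : \sum_(n <oo) mu (F n) < +oo.
  apply: (@le_lt_trans _ _ B%:E); last exact: ltry.
  apply: lime_le; first exact: is_cvg_nneseries.
  apply: nearW => m; rewrite big_mkord.
  apply: le_trans (_ : \sum_(n < m) (b n)%:E <= _); first exact: lee_sum.
  by rewrite sumEFin lee_fin.
exists (lim_sup_set F); split.
- apply: bigcap_measurable => // k _.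
  by apply: bigcup_measurable => j /= _; exact: mF.
- exact: lim_sup_set_cvg0.
- move=> w /= nw n _; apply: contrapT => h; apply: nw.
  exists n => // m /= nm Fm; apply: h; by exists m.
Qed.
End finite_unions.

Section empirical.
Context d (Om : measurableType d) d' (T : measurableType d') (R : realType).
Variables (PP : probability Om R) (X : nat -> {RV PP >-> T}).
Variable mu : probability T R.
Hypotheses (X_law : forall k, has_law (X k) mu).
Hypothesis X_indep : mutually_independent X.

Lemma iid_cells_law (K : finType) (c : T -> K) (N : nat) (f : 'I_N -> K) :
    (forall k, measurable (c @^-1` [set k])) ->
  PP (\bigcap_(i in [set: 'I_N]) [set w | c (X i w) = f i]) =
  (\prod_(i < N) fine (mu (c @^-1` [set f i])))%:E.
Proof.
move=> mc.
pose A i := if insub i is Some j then c @^-1` [set f j] else setT.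
have AE (i : 'I_N) : A i = c @^-1` [set f i] by rewrite /A valK.
have mA i : measurable (A i) by rewrite /A; case: insub.
have := X_indep (iota_uniq 0 N) mA.
rewrite -[in RHS](subn0 N) -/(index_iota 0 N) big_mkord => h.
transitivity (PP (\bigcap_(i in [set` iota 0 N]) X i @^-1` A i)).
  congr (PP _); apply/seteqP; split=> w /= h' i /=.
    rewrite mem_iota add0n => /= iN; have := h' (Ordinal iN) I.
    by rewrite /preimage /= -[A i]/(A (Ordinal iN)) AE.
  by move=> _; have := h' (i : nat); rewrite /= AE; apply; rewrite mem_iota add0n /=.
rewrite h -prodEFin; apply: eq_bigr => i _.
have := X_law i (mA i); rewrite /distribution /= /pushforward AE => ->.
by rewrite fineK // fin_num_measure.
Qed.

(** The radius makes the tail bound at most (2/e)^#|K l| N^-3, whatever the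
    number of cells.  A union over the N + 1 levels leaves (N + 1) N^-3, which
    is summable. *)
Lemma empirical_tv_ae (K : nat -> finType) (c : forall l, T -> K l) :
    (forall l k, measurable (c l @^-1` [set k])) ->
  {ae PP, forall w, \forall N \near \oo, forall l, (l <= N)%N ->
    \sum_k `|freq R (fun i : 'I_N => c l (X i w)) k - fine (mu (c l @^-1` [set k]))|
    <= Num.sqrt (32 / N%:R * (#|K l|%:R + 3 * ln N%:R))}.
Proof.
move=> mc.
pose m l k := fine (mu (c l @^-1` [set k])).
have m0 l k : 0 <= m l k by rewrite fine_ge0.
have m1 l : \sum_k m l k = 1.
  apply: EFin_inj; rewrite -sumEFin.
  rewrite -(@probability_setT _ _ _ mu) (measure_fibres mu measurableT (mc l)).
  by apply: eq_bigr => k _; rewrite setTI fineK // fin_num_measure.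
pose t N l := Num.sqrt (32 / N%:R * (#|K l|%:R + 3 * ln N%:R)) : R.
pose tv N l (f : {ffun 'I_N -> K l}) := \sum_k `|freq R f k - m l k|.
pose E N l (f : {ffun 'I_N -> K l}) :=
  \bigcap_(i in [set: 'I_N]) [set w | c l (X i w) = f i].
pose G N l := \big[setU/set0]_(f | t N l < tv N l f) E N l f.
pose F N := \big[setU/set0]_(l < N.+1) G N l.
have mE N l f : measurable (E N l f).
  apply: fin_bigcap_measurable => // i _.
  by have := measurable_funPT (X i) measurableT _ (mc l (f i)); rewrite setTI.
have mG N l : measurable (G N l) by apply: bigsetU_measurable.
have mF N : measurable (F N) by apply: bigsetU_measurable.
have tv2 N l f : (0 < N)%N -> tv N l f <= 2.
  move=> N0; apply: le_trans (_ : \sum_k (freq R f k + m l k) <= _).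
    apply: ler_sum => k _; apply: le_trans (ler_normB _ _) _.
    rewrite !ger0_norm //; rewrite mulr_ge0 ?invr_ge0 // sumr_ge0 //.
  rewrite big_split /= m1 lerD2r -mulr_sumr exchange_big /=.
  have one i : \sum_k (f i == k)%:R = 1 :> R.
    rewrite (bigD1 (f i)) //= eqxx big1 ?addr0 // => k.
    by rewrite eq_sym => /negbTE ->.
  under eq_bigr do rewrite one.
  by rewrite sumr_const card_ord mulVf // pnatr_eq0 -lt0n.
have PG N l : (0 < N)%N -> (PP (G N l) <= ((N%:R^-1) ^+ 3)%:E)%E.
  move=> N0; have NR : 0 < N%:R :> R by rewrite ltr0n.
  have N1 : 1 <= N%:R :> R by rewrite ler1n.
  have lnN : 0 <= ln N%:R :> R by rewrite ln_ge0.
  have [t2|t2] := leP (t N l) 2; last first.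
    rewrite (_ : G N l = set0) ?measure0 ?lee_fin ?exprn_ge0 ?invr_ge0 //.
    rewrite /G big_pred0 // => f; apply/negbTE; rewrite -leNgt.
    exact: le_trans (tv2 _ _ _ N0) (ltW t2).
  apply: le_trans (measure_bigsetU_le PP _ (mE N l)) _.
  have EL (f : {ffun 'I_N -> K l}) :
    PP (E N l f) = (\prod_i m l (f i))%:E := iid_cells_law f (mc l).
  rewrite (eq_bigr _ (fun f _ => EL f)) sumEFin lee_fin.
  have t0 : 0 <= t N l <= 2 by rewrite sqrtr_ge0.
  apply: le_trans (multinomial_tv_tail (m0 l) (m1 l) N0 t0) _.
  have -> : N%:R * t N l ^+ 2 / 32 = #|K l|%:R + 3 * ln N%:R.
    rewrite sqr_sqrtr; last by rewrite mulr_ge0 ?divr_ge0 ?addr_ge0 ?mulr_ge0.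
    by field; rewrite gt_eqF.
  rewrite opprD expRD mulrA (_ : expR (- (3 * _)) = N%:R^-1 ^+ 3); last first.
    by rewrite -mulrN expRM_natl expRN lnK ?posrE.
  rewrite ler_piMl ?exprn_ge0 ?invr_ge0 //.
  rewrite expRN -[X in expR X]mulr1 expRM_natl -exprVn -exprMn exprn_ile1 //.
  rewrite ler_pdivrMr ?expR_gt0 // mul1r.
  by apply: le_trans (expR_ge1Dx 1); rewrite -[2]/(1 + 1).
(* telescoping majorant of (N + 1) N^-3; the value at 0 bounds a probability *)
pose b N : R := if N is N'.+1 then 4 * (N%:R^-1 - N.+1%:R^-1) else 1.
have Fb N : (PP (F N) <= (b N)%:E)%E.
  case: N => [|N]; first exact: probability_le1.
  apply: le_trans (measure_bigsetU_le PP _ (fun l : 'I_N.+2 => mG N.+1 l)) _.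
  apply: le_trans (lee_sum _ (fun (l : 'I_N.+2) _ => PG N.+1 l isT)) _.
  rewrite sumEFin lee_fin sumr_const card_ord -[leLHS]mulr_natl /b.
  rewrite -(natr1 N.+1) -(natr1 N); set x : R := N%:R.
  have x0 : 0 <= x by rewrite /x.
  have -> : 4 * ((x + 1)^-1 - (x + 1 + 1)^-1) = 4 / ((x + 1) * (x + 1 + 1)).
    by field; apply/andP; split; rewrite gt_eqF //; lra.
  rewrite -subr_ge0; set y := x + 1.
  have y1 : 1 <= y by rewrite /y; lra.
  have -> : 4 / (y * (y + 1)) - (y + 1) * y^-1 ^+ 3 =
      ((y - 1) * (3 * y + 1)) / (y ^+ 3 * (y + 1)).
    by field; apply/andP; split; rewrite gt_eqF //; lra.
  by rewrite divr_ge0 ?mulr_ge0 ?exprn_ge0 //; lra.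
have bB n : \sum_(i < n) b i <= 5.
  have : \sum_(i < n) b i <= 5 - 4 * n%:R^-1 \/ n = 0%N.
    elim: n => [|n [IH|->]]; [by right|left..].
      rewrite big_ord_recr /=; case: n IH => [|n] IH; first by rewrite /b big_ord0 invr1; lra.
      have -> : b n.+1 = 4 * (n.+1%:R^-1 - n.+2%:R^-1) by [].
      by move: IH; set u := _.+1%:R^-1; set v := _.+2%:R^-1; lra.
    by rewrite big_ord_recr big_ord0 /b /= invr1; lra.
  case=> [|->]; last by rewrite big_ord0.
  by move=> /le_trans; apply; rewrite gerBl mulr_ge0 ?invr_ge0.
have := borel_cantelli_bounded mF Fb bB.
apply: filterS => w; apply: filterS => N nF l lN.
rewrite leNgt; apply/negP => tl; apply: nF.
apply: (@mem_bigsetU _ _ _ _ (Ordinal (lN : (l < N.+1)%N))) => //.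
pose f := [ffun i : 'I_N => c l (X i w)].
have fE : freq R f = freq R (fun i : 'I_N => c l (X i w)).
  by apply/funext => k; rewrite /freq; under eq_bigr do rewrite ffunE.
apply: (@mem_bigsetU _ _ _ _ f); first by rewrite /tv fE.
by move=> i _ /=; rewrite ffunE.
Qed.
End empirical.

(** * Coupling a finitely supported measure with an arbitrary one *)

Section mass_one.
Context d (T : measurableType d) (R : realType).
Variable m : {measure set T -> \bar R}.

Definition mass_one (m1 : m setT = 1%E) : set T -> \bar R := m.

Variable m1 : m setT = 1%E.
HB.instance Definition _ := Measure.copy (mass_one m1) m.
HB.instance Definition _ := Measure_isProbability.Build _ _ _ (mass_one m1) m1.
End mass_one.

Section image_measure.
Context d1 (X : measurableType d1) d2 (Y : measurableType d2) (R : realType).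
Variables (m : {measure set X -> \bar R}) (f : X -> Y).

Definition image_measure (mf : measurable_fun [set: X] f) : set Y -> \bar R :=
  pushforward m f.

Hypothesis mf : measurable_fun [set: X] f.
Let im0 : image_measure mf set0 = 0%E. Proof. exact: measure0. Qed.
Let im_ge0 A : (0 <= image_measure mf A)%E. Proof. exact: measure_ge0. Qed.
Let im_sigma_additive : semi_sigma_additive (image_measure mf).
Proof. exact: measure_semi_sigma_additive. Qed.
HB.instance Definition _ := isMeasure.Build _ _ _ (image_measure mf)
  im0 im_ge0 im_sigma_additive.
End image_measure.

(** A measure with atoms x_i is coupled with nu by sending from x_i the mass
    g_ij to the part of nu in the cell j, that is, by the sum of
    g_ij / nu(j) times the product of the point mass at x_i and of nu
    restricted to j.  A cell of zero mass is harmless: g_ij <= nu(j), and the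
    inverse of 0 is 0. *)
Section semidiscrete.
Context d1 (X : measurableType d1) d2 (Y : measurableType d2) (R : realType).
Variables (I J : finType) (x : I -> X) (c : Y -> J) (nu : probability Y R).
Hypothesis mc : forall j, measurable (c @^-1` [set j]).
Variable g : I -> J -> R.
Hypotheses (g_ge0 : forall i j, 0 <= g i j).
Hypothesis g_nu : forall j, \sum_i g i j = fine (nu (c @^-1` [set j])).

Let pairx (i : I) (y : Y) : X * Y := (x i, y).
Let mpairx i : measurable_fun [set: Y] (pairx i).
Proof. by apply: measurable_fun_pair. Qed.

Let w_ge0 i j : 0 <= g i j / fine (nu (c @^-1` [set j])).
Proof. by rewrite divr_ge0 // fine_ge0. Qed.

Let piece (t : I * J) : {measure set (X * Y)%type -> \bar R} :=
  mscale (NngNum (w_ge0 t.1 t.2)) (image_measure (mrestr nu (mc t.2)) (mpairx t.1)).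

Let zero : {measure set (X * Y)%type -> \bar R} := mzero.
Let pieces := [seq piece t | t <- index_enum (I * J)%type].
Let total : {measure set (X * Y)%type -> \bar R} :=
  msum (nth zero pieces) (size pieces).

Let big_pieces (F : {measure set (X * Y)%type -> \bar R} -> \bar R) :
  (\sum_(k < size pieces) F (nth zero pieces k) = \sum_i \sum_j F (piece (i, j)))%E.
Proof.
rewrite -(big_mkord xpredT (fun k => F (nth zero pieces k))).
rewrite -(big_nth zero xpredT F).
by rewrite big_map pair_bigA /=; apply: eq_bigr => -[].
Qed.

Let totalE A : total A = (\sum_i \sum_j piece (i, j) A)%E.
Proof. exact: (big_pieces (fun m => m A)). Qed.

Let cell_mass_ge i j : g i j <= fine (nu (c @^-1` [set j])).
Proof. by rewrite -g_nu (bigD1 i) //= lerDl sumr_ge0. Qed.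

Let renormalize i j : g i j / fine (nu (c @^-1` [set j])) * fine (nu (c @^-1` [set j])) = g i j.
Proof.
have [e|?] := eqVneq (fine (nu (c @^-1` [set j]))) 0; last by rewrite divfK.
by rewrite e mulr0; apply/eqP; rewrite eq_le g_ge0 -e cell_mass_ge.
Qed.

Let nu_fin A : measurable A -> (fine (nu A))%:E = nu A.
Proof. by move=> mA; rewrite fineK // fin_num_measure. Qed.

(** The cost bound k_ij only has to hold on a set S of full nu-measure: the
    Wasserstein cost is controlled on the simplex alone. *)
Lemma semidiscrete_coupling : exists P : probability (X * Y)%type R,
  [/\ forall A, measurable A -> P (fst @^-1` A) =
         (\sum_i (\sum_j g i j)%:E * \d_(x i) A)%E,
      forall B, measurable B -> P (snd @^-1` B) = nu B
    & forall (f : X * Y -> R) (S : set Y) (k : I -> J -> R),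
        measurable_fun setT f -> (forall z, 0 <= f z) ->
        measurable S -> nu S = 1%E -> (forall i j, 0 <= k i j) ->
        (forall i y, S y -> f (x i, y) <= k i (c y)) ->
        (\int[P]_z (f z)%:E <= (\sum_i \sum_j g i j * k i j)%:E)%E].
Proof.
have fstE A : measurable A -> total (fst @^-1` A) =
    (\sum_i (\sum_j g i j)%:E * \d_(x i) A)%E.
  move=> mA; rewrite totalE; apply: eq_bigr => i _.
  rewrite -sumEFin ge0_sume_distrl; last by move=> j _; rewrite lee_fin.
  apply: eq_bigr => j _.
  rewrite /piece /= /mscale /= /image_measure /pushforward /mrestr diracE.
  have [xA|xA] := boolP (x i \in A).
    rewrite (_ : _ `&` _ = c @^-1` [set j]); last first.
      apply/seteqP; split=> y /=; first by case.
      by split=> //; exact: set_mem.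
    by rewrite -nu_fin // -EFinM renormalize mule1.
  rewrite (_ : _ `&` _ = set0) ?measure0 ?mule0 //.
  by apply/seteqP; split=> y //= [/mem_set]; rewrite /= (negbTE xA).
have sndE B : measurable B -> total (snd @^-1` B) = nu B.
  move=> mB; rewrite totalE exchange_big /= (measure_fibres nu mB mc).
  apply: eq_bigr => j _.
  transitivity (\sum_i (g i j / fine (nu (c @^-1` [set j])))%:E *
    nu (B `&` c @^-1` [set j]))%E; first by apply: eq_bigr.
  rewrite -ge0_sume_distrl; last by move=> i _; rewrite lee_fin.
  rewrite sumEFin -mulr_suml g_nu.
  have [e|e] := eqVneq (fine (nu (c @^-1` [set j]))) 0.
    rewrite e mul0r mul0e; apply/esym/eqP; rewrite eq_le measure_ge0 andbT.
    rewrite -[leRHS]/(0%:E) -e nu_fin // le_measure ?inE //.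
    exact: measurableI.
  by rewrite divff // mul1e.
have tot1 : total setT = 1%E.
  by rewrite -(@probability_setT _ _ _ nu) -(sndE setT measurableT) preimage_setT.
exists (mass_one tot1); split=> // f S k mf f0 mS nuS k0 fk.
have /measurable_EFinP mfE := mf.
rewrite (_ : (\int[_]_z _)%E = (\int[total]_z (f z)%:E)%E) //.
rewrite /total ge0_integral_measure_sum //; last by move=> z _; rewrite lee_fin.
rewrite (big_pieces (fun m => (\int[m]_z (f z)%:E)%E)).
rewrite -sumEFin; apply: lee_sum => i _.
rewrite -sumEFin; apply: lee_sum => j _.
have -> : (\int[piece (i, j)]_z (f z)%:E = \int[piece (i, j)]_z `|(f z)%:E|)%E.
  by apply: eq_integral => z _; rewrite gee0_abs ?lee_fin.
apply: le_trans (integral_le_bound (k i j)%:E _ _ _ _) _ => //;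
  first by rewrite lee_fin.
  have mbad : measurable (pairx i @^-1` [set z | k i j < f z]).
    rewrite -[X in measurable X]setTI; apply: mpairx => //.
    rewrite -[X in measurable X]setTI; apply: measurable_fun_ltr => //.
  exists [set z | k i j < f z]; split.
  - by rewrite -[X in measurable X]setTI; exact: measurable_fun_ltr.
  - rewrite /piece /= /mscale /= /image_measure /pushforward /mrestr /=.
    have nuS0 : nu (~` S) = 0%E.
      by rewrite probability_setC // nuS subee.
    rewrite [X in (_ * X)%E](_ : _ = 0%E) ?mule0 //.
    apply/eqP; rewrite eq_le measure_ge0 andbT -nuS0 le_measure ?inE //.
    + exact: measurableI.
    + exact: measurableC.
    + move=> y [/= ky cy] Sy; move: ky; rewrite ltNge => /negP; apply.
      by rewrite -cy; exact: fk.
  - move=> z /= /not_implyP [_]; rewrite ger0_norm // lee_fin => /negP.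
    by rewrite -ltNge.
rewrite /piece /= /mscale /= /image_measure /pushforward /mrestr /= preimage_setT setTI.
by rewrite -nu_fin // -!EFinM lee_fin renormalize mulrC.
Qed.
End semidiscrete.

(** * Dyadic cells of the simplex and the Wasserstein distance *)

Section dyadic.
Variable R : realType.

(** The index of the dyadic interval of level l containing x in (0, 1).
    Capping the index and truncating negative numbers to 0 extend the
    partition to the whole line in such a way that the levels stay nested for
    all real numbers, not only for those in (0, 1). *)
Definition dyad (l : nat) (x : R) : nat := minn (Num.truncn (x * 2 ^+ l)) (2 ^ l).-1.

Lemma dyad_lt l x : (dyad l x < (2 ^ l).-1.+1)%N.
Proof. by rewrite ltnS /dyad geq_minr. Qed.

Lemma dyad_half l x : dyad l x = (dyad l.+1 x)./2.
Proof.
have half_min a b : (minn a b)./2 = minn a./2 b./2.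
  have [ab|ba] := leqP a b; first by rewrite (minn_idPl (half_leq ab)).
  by rewrite (minn_idPr (half_leq (ltnW ba))).
rewrite /dyad half_min; congr minn; last first.
  by rewrite expnS mul2n -(prednK (expn_gt0 2 l)) doubleS /= uphalf_double.
have [x0|x0] := leP 0 x; last first.
  have neg k : Num.truncn (x * 2 ^+ k) = 0%N.
    apply/eqP; rewrite -leqn0 truncn_le_nat (lt_trans _ ltr01) //.
    by rewrite pmulr_llt0 ?exprn_gt0.
  by rewrite !neg.
apply/eqP; rewrite truncn_eq ?mulr_ge0 ?exprn_ge0 //.
have /andP[] := truncn_itv (mulr_ge0 x0 (exprn_ge0 l.+1 (ler0n R 2))).
set m := Num.truncn _; rewrite exprS mulrCA => m1 m2.
apply/andP; split.
  have : (m./2 * 2 <= m)%N by rewrite muln2 -geq_half_double.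
  by rewrite -(ler_nat R) natrM; lra.
have : (m.+1 <= m./2.+1 * 2)%N.
  by rewrite muln2 doubleS -{1}(odd_double_half m); case: odd.
by rewrite -(ler_nat R) natrM; lra.
Qed.

Lemma dyad_close l x y : 0 < x < 1 -> 0 < y < 1 -> dyad l x = dyad l y ->
  `|x - y| <= 2^-1 ^+ l.
Proof.
have p0 : 0 < 2 ^+ l :> R by rewrite exprn_gt0.
have dyadE z : 0 < z < 1 -> (dyad l z)%:R <= z * 2 ^+ l < (dyad l z).+1%:R.
  move=> /andP[z0 z1]; rewrite /dyad (minn_idPl _).
    by apply: truncn_itv; rewrite mulr_ge0 // ltW.
  rewrite -ltnS prednK ?expn_gt0 // truncn_lt_nat ?mulr_ge0 ?ltW //.
  by rewrite natrX gtr_pMl.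
move=> /dyadE + /dyadE + e; rewrite e -natr1 => /andP[h1 h2] /andP[h3 h4].
rewrite exprVn -[leRHS]mul1r ler_pdivlMr // -[X in _ * X](ger0_norm (ltW p0)).
by rewrite -normrM mulrBl ler_norml; apply/andP; split; lra.
Qed.

Lemma measurable_dyad l k : measurable [set x : R | dyad l x = k].
Proof.
have mge j : measurable [set x : R | (j <= dyad l x)%N].
  have [jl|jl] := leqP j (2 ^ l).-1; last first.
    rewrite (_ : [set _ | _] = set0) //; apply/seteqP; split=> x //=.
    by rewrite leq_min (leqNgt j (_.-1)) jl andbF.
  case: j jl => [|j] jl; first by rewrite (_ : [set _ | _] = setT) //; apply/seteqP; split.
  rewrite (_ : [set _ | _] = `[j.+1%:R / 2 ^+ l, +oo[%classic).
    exact: measurable_itv.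
  apply/seteqP; split=> x /=; rewrite leq_min jl andbT truncn_gt_nat in_itv /= andbT.
    by rewrite ler_pdivrMr // exprn_gt0.
  by rewrite ler_pdivrMr // exprn_gt0.
rewrite (_ : [set _ | _] = [set x | (k <= dyad l x)%N] `\` [set x | (k.+1 <= dyad l x)%N]).
  exact: measurableD.
apply/seteqP; split=> x /=; first by move=> ->; rewrite leqnn ltnn.
by case=> h /negP; rewrite -leqNgt => h'; apply/eqP; rewrite eqn_leq h h'.
Qed.

End dyadic.

Section borel_vectors.
Variables (R : realType) (n : nat).
Local Notation V := 'rV[R]_n.

Lemma measurable_open_rV (A : set V) : open A -> measurable A.
Proof. exact: sub_sigma_algebra. Qed.

Lemma within_continuous_measurable (D : set V) (f : V -> R) :
  measurable D -> {within D, continuous f} -> measurable_fun D f.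
Proof.
move=> mD /continuousP cf; apply: (measurability _ (RGenOpens.measurableE R)).
move=> _ [_ [a [b ->] <-]].
have oI : open (`]a, b[%classic : set R) by exact: interval_open.
have /open_subspaceP [U oU UD] := cf _ oI.
by rewrite setIC -UD; apply: measurableI => //; exact: measurable_open_rV.
Qed.

Lemma measurable_coord (i : 'I_n) : measurable_fun [set: V] (fun v : V => v 0 i).
Proof.
apply: within_continuous_measurable => //.
by apply: continuous_subspaceT; exact: coord_continuous.
Qed.

Lemma measurable_simplex : measurable (@simplex R n).
Proof.
rewrite (_ : simplex =
    (\bigcap_(i in [set: 'I_n]) ((fun v : V => v 0 i) @^-1` `]0, 1[%classic))
      `&` ((fun v : V => \sum_i v 0 i) @^-1` [set 1])).
  apply: measurableI.
    apply: fin_bigcap_measurable => // i _; rewrite -[X in measurable X]setTI.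
    exact: measurable_coord.
  have msum : measurable_fun [set: V] (fun v : V => \sum_i v 0 i).
    by apply: measurable_sum => i; exact: measurable_coord.
  by rewrite -[X in measurable X]setTI; apply: msum.
apply/seteqP; split=> v /= [h1 h2]; split=> // i; first by rewrite /= in_itv /= h1.
by have := h1 i I; rewrite /= in_itv.
Qed.

Definition cell (l : nat) (v : V) : {ffun 'I_n -> 'I_(2 ^ l).-1.+1} :=
  [ffun i => Ordinal (dyad_lt l (v 0 i))].

Lemma card_cells l : #|{: {ffun 'I_n -> 'I_(2 ^ l).-1.+1}}| = (2 ^ (l * n))%N.
Proof. by rewrite card_ffun !card_ord prednK ?expn_gt0 // expnM. Qed.

Lemma cell_dyad l v w : cell l v = cell l w <-> forall i, dyad l (v 0 i) = dyad l (w 0 i).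
Proof.
split=> [/ffunP e i|e]; first by have /(congr1 val) := e i; rewrite !ffunE.
by apply/ffunP => i; rewrite !ffunE; apply: val_inj; exact: e.
Qed.

Lemma cell_nested l v w : cell l.+1 v = cell l.+1 w -> cell l v = cell l w.
Proof.
by move/cell_dyad => e; apply/cell_dyad => i; rewrite !(dyad_half l) e.
Qed.

Lemma measurable_cell l k : measurable (cell l @^-1` [set k]).
Proof.
rewrite (_ : _ @^-1` _ = \bigcap_(i in [set: 'I_n])
    ((fun v : V => v 0 i) @^-1` [set x | dyad l x = k i])).
  apply: fin_bigcap_measurable => // i _; rewrite -[X in measurable X]setTI.
  by apply: measurable_coord => //; exact: measurable_dyad.
apply/seteqP; split=> v /= => [<- i _ /=|h]; first by rewrite ffunE.
by apply/ffunP => i; rewrite ffunE; apply: val_inj; exact: h.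
Qed.

Lemma cell_close l v w : simplex v -> simplex w -> cell l v = cell l w ->
  \sum_i (v 0 i - w 0 i) ^+ 2 <= n%:R * 4^-1 ^+ l.
Proof.
move=> [v01 _] [w01 _] /cell_dyad e.
rewrite mulr_natl -[in leRHS](card_ord n) -sumr_const; apply: ler_sum => i _.
rewrite -real_normK ?num_real // (_ : 4 = 2 ^+ 2); last by rewrite expr2 -natrM.
rewrite -exprVn exprAC lerXn2r ?nnegrE ?exprn_ge0 ?invr_ge0 //.
exact: dyad_close.
Qed.
End borel_vectors.

Section couplings.
Variables (R : realType) (n : nat).
Local Notation V := 'rV[R]_n.

Lemma l2norm_sqr m (v : 'rV[R]_m) : l2norm v ^+ 2 = \sum_i v 0 i ^+ 2.
Proof. by rewrite sqr_sqrtr // sumr_ge0 // => i _; rewrite sqr_ge0. Qed.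

Lemma dist_pair_sqr (z w : (V * V)%type) : dist_pair z w ^+ 2 =
  \sum_i (z.1 0 i - w.1 0 i) ^+ 2 + \sum_i (z.2 0 i - w.2 0 i) ^+ 2.
Proof.
rewrite l2norm_sqr big_split_ord /=; congr (_ + _); apply: eq_bigr => i _.
  by rewrite !mxE !(unsplitK (inl i)).
by rewrite !mxE !(unsplitK (inr i)).
Qed.

Lemma measurable_dist_pair_sqr : measurable_fun [set: ((V * V) * (V * V))%type]
  (fun z => dist_pair z.1 z.2 ^+ 2).
Proof.
rewrite (_ : (fun z => _) = fun z : (V * V) * (V * V) =>
    \sum_i (z.1.1 0 i - z.2.1 0 i) ^+ 2 + \sum_i (z.1.2 0 i - z.2.2 0 i) ^+ 2); last first.
  by apply/funext => z; rewrite dist_pair_sqr.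
apply: measurable_funD; apply: measurable_sum => i; apply: measurable_funX;
  apply: measurable_funB; apply: (measurableT_comp (measurable_coord i));
  by do 2![apply: measurableT_comp => //].
Qed.

(** Squaring cancels the exponent 1/2 only because the infimum is
    nonnegative; it may be infinite. *)
Lemma W2_sqr_le (mu nu : set (V * V)%type -> \bar R)
    (P : probability ((V * V) * (V * V))%type R) : coupling mu nu P ->
  (W2 mu nu ^+ 2 <= \int[P]_z (dist_pair z.1 z.2 ^+ 2)%:E)%E.
Proof.
move=> cP; rewrite /W2; set S := [set _ | _ in _]; set b := (\int[P]_z _)%E.
have S0 : (0 <= ereal_inf S)%E.
  apply/ereal_infP => _ [Q _ <-]; apply: integral_ge0 => z _.
  by rewrite lee_fin sqr_ge0.
have -> : ((ereal_inf S `^ 2^-1) ^+ 2 = ereal_inf S)%E.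
  case: (ereal_inf S) S0 => [r|_|] //.
    by rewrite lee_fin => r0; rewrite poweR_EFin -EFin_expe -powR_mulrn ?powR_ge0 //
      -powRrM mulVf // powRr1.
  by rewrite poweRyr.
by apply: ereal_inf_lbound; exists P.
Qed.
End couplings.

(** * Summing the errors over the dyadic levels *)

Section rate.
Variable R : realType.

Lemma ler_sum_geometric4 (L : nat) : \sum_(l < L) (4^-1 : R) ^+ l.+1 <= 3^-1.
Proof.
suff -> : \sum_(l < L) (4^-1 : R) ^+ l.+1 = 3^-1 - 3^-1 * 4^-1 ^+ L.
  by rewrite gerBl mulr_ge0 ?exprn_ge0 ?invr_ge0.
elim: L => [|L IH]; first by rewrite big_ord0 expr0 mulr1 subrr.
by rewrite big_ord_recr /= IH !exprS; field.
Qed.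

(** With q = 2^n, level l contributes 4^-l delta_l, of order
    4^-l q^l N^(-1/2) + 4^-l N^(-1/2) ln N.  As q >= 4 the first terms increase
    with l, and the last one, where q^L ~ N^(1/2), is 4^-L ~ N^(-1/n); there
    are L <= ln N of them.  The second terms form a geometric series, and
    N^(-1/2) <= N^(-1/n).  For n = 2, where q = 4, the first terms are
    all equal, hence a factor ln N. *)
Lemma dyadic_rate (n N : nat) (B : R) (delta : nat -> R) : (2 <= n)%N -> (4 <= N)%N ->
    0 <= B ->
    (forall l, (l <= N)%N -> delta l <=
       B * Num.sqrt (32 / N%:R * ((2 ^ (2 * n * l))%:R + 3 * ln N%:R))) ->
  let L := trunc_log (2 ^ (2 * n)) N in
  (L <= N)%N /\
  4^-1 ^+ L + \sum_(l < L) 4 * 4^-1 ^+ l.+1 * delta l.+1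
  <= (4 + 112 * B) * (N%:R `^ (- n%:R^-1) * ln N%:R).
Proof.
move=> n2 N4 B0 hd L.
have n0 : (0 < n)%N by exact: leq_trans n2.
have nR : 0 < n%:R :> R by rewrite ltr0n.
have N0 : 0 < N%:R :> R by rewrite ltr0n (leq_trans _ N4).
have N1 : 1 <= N%:R :> R by rewrite ler1n (leq_trans _ N4).
have ln2 : 2^-1 <= ln 2 :> R.
  have := @le_ln1Dx R (- 2^-1); rewrite (_ : 1 + - 2^-1 = 2^-1); last by field.
  by rewrite lnV ?posrE //; lra.
have lnN1 : 1 <= ln N%:R :> R.
  apply: le_trans (_ : _ <= ln (2 * 2)) _; first by rewrite lnM ?posrE //; lra.
  by rewrite ler_ln ?posrE // -natrM ler_nat.
have base : (1 < 2 ^ (2 * n))%N by rewrite -{1}(expn0 2) ltn_exp2l // muln_gt0.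
have /andP[NL NL1] : ((2 ^ (2 * n)) ^ L <= N < (2 ^ (2 * n)) ^ L.+1)%N.
  by apply: trunc_log_bounds => //; exact: leq_trans N4.
have LN : (L <= N)%N.
  by apply: leq_trans NL; apply/ltnW/ltn_expl.
split=> //.
set y := N%:R `^ _; set s := Num.sqrt N%:R : R.
have s0 : 0 < s by rewrite sqrtr_gt0.
have ss : s ^+ 2 = N%:R by rewrite sqr_sqrtr // (ltW N0).
have y0 : 0 < y by exact: powR_gt0.
have yn : y ^+ n = N%:R^-1.
  rewrite -powR_mulrn ?(ltW y0) // /y -powRrM mulNr mulVf ?gt_eqF //.
  by rewrite powR_inv1 // ltW.
pose b : R := 4^-1.
have four : 4 = 2 ^+ 2 :> R by rewrite expr2 -natrM.
have aL : b ^+ L <= 4 * y.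
  suff : b ^+ L.+1 <= y by rewrite exprS /b; lra.
  rewrite -(@ler_pXn2r _ n) ?nnegrE ?exprn_ge0 ?invr_ge0 ?(ltW y0) //.
  rewrite yn /b !exprVn lef_pV2 ?posrE ?exprn_gt0 //.
  move: NL1; rewrite -(ltr_nat R) !natrX => /ltW /le_trans; apply.
  by rewrite four -!exprM -mulnA (mulnC n).
have yN : s^-1 <= y.
  rewrite /s -powR12_sqrt ?(ltW N0) // -powRN /y ler_powR // lerN2.
  by rewrite lef_pV2 ?posrE // ler_nat.
have Lln : L%:R <= ln N%:R :> R.
  apply: le_trans (_ : _ <= ln ((2 ^ (2 * n)) ^ L)%:R) _; last first.
    by rewrite ler_ln ?posrE ?N0 ?ltr0n ?expn_gt0 ?expn_gt0 //= ler_nat.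
  rewrite -expnM natrX lnXn // -[leRHS]mulr_natl natrM natrM.
  have n2R : 2 <= n%:R :> R by rewrite ler_nat.
  have LR : 0 <= L%:R :> R by [].
  by rewrite mulrAC -[leLHS]mul1r ler_wpM2r //; nra.
pose q : R := 2 ^+ n.
have q4 : 1 <= q * b.
  rewrite ler_pdivlMr // mul1r four.
  by rewrite ler_weXn2l // ler1n.
have qL : q ^+ L <= s.
  rewrite -(@ler_pXn2r _ 2) ?nnegrE ?exprn_ge0 ?(ltW s0) //.
  rewrite ss /q -!exprM; apply: le_trans (_ : _ <= ((2 ^ (2 * n)) ^ L)%:R) _.
    by rewrite -expnM natrX mulnC mulnA.
  by rewrite ler_nat.
have bge0 k : 0 <= b ^+ k by rewrite exprn_ge0 // invr_ge0.
have term l : (l < L)%N -> 4 * b ^+ l.+1 * delta l.+1 <=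
    B * (24 * b ^+ L + 48 * s^-1 * ln N%:R * b ^+ l.+1).
  move=> lL.
  (* sqrt (32 (t^2 + 3 v)) <= 6 (t + 2 v) for t >= 0 and v >= 1 *)
  have dl : delta l.+1 <= B * (6 * s^-1 * (q ^+ l.+1 + 2 * ln N%:R)).
    apply: le_trans (hd _ (leq_trans lL LN)) _; rewrite ler_wpM2l //.
    have r0 : 0 <= 6 * s^-1 * (q ^+ l.+1 + 2 * ln N%:R).
      by rewrite !mulr_ge0 ?invr_ge0 ?(ltW s0) // addr_ge0 ?exprn_ge0 ?mulr_ge0 //; lra.
    rewrite -[leRHS](ger0_norm r0) -sqrtr_sqr ler_sqrt ?sqr_ge0 //.
    have -> : (2 ^ (2 * n * l.+1))%:R = (q ^+ l.+1) ^+ 2 :> R.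
      by rewrite natrX /q -!exprM (mulnC _ 2%N) mulnA (mulnC n 2%N).
    set v := ln _; rewrite -ss; set t := q ^+ _; set si := s^-1.
    have -> : 32 / s ^+ 2 * (t ^+ 2 + 3 * v) = si ^+ 2 * (32 * (t ^+ 2 + 3 * v)).
      by rewrite /si; field; rewrite gt_eqF.
    rewrite [leRHS](_ : _ = si ^+ 2 * (36 * (t + 2 * v) ^+ 2)); last by ring.
    rewrite ler_wpM2l ?sqr_ge0 //.
    have t0 : 0 <= t by rewrite !exprn_ge0.
    rewrite -/v in lnN1.
    have h1 : 0 <= v * (v - 1) by rewrite mulr_ge0; lra.
    have h2 : 0 <= t * v by rewrite mulr_ge0 //; lra.
    have := sqr_ge0 t; lra.
  have bl := bge0 l.+1.
  apply: le_trans (_ : _ <= 4 * b ^+ l.+1 * (B * (6 * s^-1 * (q ^+ l.+1 + 2 * ln N%:R)))) _.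
    by rewrite ler_wpM2l // mulr_ge0.
  have qb : b ^+ l.+1 * q ^+ l.+1 * s^-1 <= b ^+ L.
    rewrite ler_pdivrMr // -exprMn (mulrC b).
    apply: le_trans (_ : _ <= (q * b) ^+ L) _; first by rewrite ler_weXn2l.
    by rewrite exprMn mulrC ler_wpM2l.
  have : B * (24 * (b ^+ l.+1 * q ^+ l.+1 * s^-1)) <= B * (24 * b ^+ L).
    by rewrite ler_wpM2l // ler_wpM2l.
  by set v := ln _; set t := q ^+ _; lra.
apply: le_trans (_ : _ <= b ^+ L + \sum_(l < L) B * (24 * b ^+ L + 48 * s^-1 * ln N%:R * b ^+ l.+1)) _.
  by rewrite lerD2l; apply: ler_sum => l _; exact: term.
rewrite -mulr_sumr big_split /= sumr_const card_ord -mulr_sumr.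
rewrite -[_ *+ L]mulr_natl.
have g := ler_sum_geometric4 L.
have : 48 * s^-1 * ln N%:R * \sum_(l < L) b ^+ l.+1 <= 16 * (y * ln N%:R).
  apply: le_trans (_ : _ <= 48 * s^-1 * ln N%:R * 3^-1) _.
    by rewrite ler_wpM2l // !mulr_ge0 ?invr_ge0 ?(ltW s0) //; lra.
  have : s^-1 * ln N%:R <= y * ln N%:R by rewrite ler_wpM2r //; lra.
  by lra.
have : L%:R * (24 * b ^+ L) <= 96 * (y * ln N%:R).
  apply: le_trans (_ : _ <= ln N%:R * (24 * (4 * y))) _; last by lra.
  by rewrite ler_pM // ?mulr_ge0 // ?ler_wpM2l.
have : b ^+ L <= 4 * (y * ln N%:R) by apply: le_trans aL _; nra.
set u := L%:R * _; set v := _ * \sum_(_ < _) _; set w := y * _.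
move=> h1 h2 h3; have : B * (u + v) <= B * (112 * w) by rewrite ler_wpM2l //; lra.
by lra.
Qed.
End rate.

(** * Positivity of the Gamma function *)

Section gamma.
Variable R : realType.
Local Notation mu := (@lebesgue_measure R).

(** The integral of the kernel t^(x-1) exp(-t) is finite, and not merely
    positive, because it lies below a multiple of
    t^(x-1) / (1 + t^x)^2, which has the bounded primitive
    - 1 / (x (1 + t^x)).  One majorant thus covers the singularity at 0 and
    the tail. *)
Let kernel (x t : R) : R := t `^ (x - 1) * expR (- t).
Let profile (x t : R) : R := t `^ (x - 1) * ((1 + t `^ x)^-1 * (1 + t `^ x)^-1).
Let primitive (x t : R) : R := - x^-1 * (1 + t `^ x)^-1.

Let den_gt0 (x t : R) : 0 < 1 + t `^ x.
Proof. by rewrite ltr_pwDl // powR_ge0. Qed.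

Let is_derive_primitive (x t : R) : 0 < x -> 0 < t ->
  is_derive t 1 (primitive x) (profile x t).
Proof.
move=> x0 t0.
have d1 : is_derive t (1 : R) (cst 1 + (@powR R ^~ x)) (x * t `^ (x - 1)).
  rewrite -[X in is_derive _ _ _ X]add0r; apply: is_deriveD.
  exact: is_derive1_powR.
have dn0 : (cst 1 + (@powR R ^~ x)) t != 0 by rewrite gt_eqF // den_gt0.
have d2 := is_deriveV dn0 d1.
have d3 := is_deriveZ (- x^-1) d2.
have -> : primitive x = - x^-1 *: (fun u => ((cst 1 + (@powR R ^~ x)) u)^-1) by [].
have -> : profile x t = - x^-1 *: (- ((cst 1 + (@powR R ^~ x)) t) ^- 2 *: (x * t `^ (x - 1))).
  rewrite (_ : (cst 1 + (@powR R ^~ x)) t = 1 + t `^ x) // /profile /GRing.scale /=.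
  by field; rewrite !gt_eqF ?den_gt0.
exact: d3.
Qed.

Let cont_profile (x t : R) : 0 < t -> {for t, continuous (profile x)}.
Proof.
move=> t0.
have cp y : {for t, continuous (fun s : R => s `^ y)}.
  apply: differentiable_continuous; apply/derivable1_diffP.
  by apply: derivable_powR; rewrite in_itv /= t0.
have ci : {for t, continuous (fun s : R => (1 + s `^ x)^-1)}.
  apply: cvgV; first by rewrite gt_eqF.
  by apply: cvgD; [exact: cvg_cst|exact: cp].
by apply: cvgM; [exact: cp|apply: cvgM].
Qed.

Let measurable_kernel x : measurable_fun [set: R] (kernel x).
Proof.
apply: measurable_funM; first exact: measurable_powR.
by apply: (measurableT_comp (@measurable_expR R)).
Qed.

Let integral_kernel_bounded (x : R) : 0 < x ->
  exists C : R, forall a b, 0 < a -> a < b ->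
  (\int[mu]_(t in `[a, b]) (kernel x t)%:E <= C%:E)%E.
Proof.
move=> x0; pose m := (Num.truncn (2 * x)).+1.
pose K : R := 4 * (1 + (m.+1)`!%:R).
have K0 : 0 <= K by rewrite /K mulr_ge0 // addr_ge0.
have xm : 2 * x <= m.+1%:R.
  apply: ltW; apply: lt_le_trans (truncnS_gt _) _.
  by rewrite ler_nat leqnSn.
exists (K * x^-1) => a b a0 ab.
have bound t : 0 < t -> kernel x t <= K * profile x t.
  move=> t0; rewrite /kernel /profile mulrCA ler_wpM2l ?powR_ge0 //.
  rewrite -invfM -ler_pdivrMr ?invr_gt0 ?mulr_gt0 ?den_gt0 // invrK -expr2.
  rewrite expRN mulrC ler_pdivrMr ?expR_gt0 //.
  have e1 : 1 <= expR t by rewrite -[leLHS]expR0 ler_expR ltW.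
  have em : t ^+ m.+1 <= (m.+1)`!%:R * expR t.
    have f0 : 0 < (m.+1)`!%:R :> R by rewrite ltr0n fact_gt0.
    rewrite -ler_pdivrMl // mulrC.
    by have := @expR_ge1Dxn R t m (ltW t0); lra.
  have p2 : (t `^ x) ^+ 2 <= 1 + t ^+ m.+1.
    rewrite -powR_mulrn ?powR_ge0 // -powRrM mulrC.
    have [t1|t1] := leP t 1.
      apply: le_trans (_ : 1 <= _); last by rewrite lerDl exprn_ge0 // ltW.
      apply: le_trans (_ : _ <= 1 `^ (2 * x)) _; last by rewrite powR1.
      rewrite ge0_ler_powR ?nnegrE ?(ltW t0) //.
      by rewrite mulr_ge0 // ltW.
    apply: le_trans (_ : _ <= t `^ m.+1%:R) _; first by apply: ler_powR => //; exact: ltW.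
    by rewrite powR_mulrn ?(ltW t0) // lerDr.
  have := sqr_ge0 (t `^ x - 1); have ME0 : 0 <= (m.+1)`!%:R * expR t by rewrite mulr_ge0 ?expR_ge0.
  rewrite /K; lra.
have mprof : measurable_fun `[a, b]%classic (profile x).
  apply: subspace_continuous_measurable_fun => //.
  apply: continuous_in_subspaceT => t /set_mem /=; rewrite in_itv /= => /andP[at0 _].
  exact/cont_profile/(lt_le_trans a0).
have mS : measurable_fun `[a, b]%classic (fun t => (K * profile x t)%:E).
  by apply/measurable_EFinP; apply: measurable_funM.
apply: (@le_trans _ _ (\int[mu]_(t in `[a, b]) (K * profile x t)%:E)%E).
  apply: ge0_le_integral => //.
  - by move=> t _; rewrite lee_fin mulr_ge0 ?powR_ge0 ?expR_ge0.
  - apply/measurable_EFinP; apply: measurable_funTS; exact: measurable_kernel.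
  - move=> t /=; rewrite in_itv /= => /andP[at0 _]; rewrite lee_fin bound //.
    exact: lt_le_trans at0.
under eq_integral do rewrite EFinM.
rewrite ge0_integralZl_EFin //; first last.
- exact/measurable_EFinP.
- by move=> t _; rewrite lee_fin !mulr_ge0 ?powR_ge0 ?invr_ge0 ?(ltW (den_gt0 _ _)).
rewrite (@continuous_FTC2 _ (profile x) (primitive x)) //.
- rewrite -EFinB -EFinM lee_fin ler_wpM2l //.
  have := den_gt0 b x; have := den_gt0 a x; rewrite /primitive => da db.
  have ha : (1 + a `^ x)^-1 <= 1 by rewrite invf_le1 // lerDl powR_ge0.
  have hb : 0 <= (1 + b `^ x)^-1 by rewrite invr_ge0 ltW.
  have xi : 0 <= x^-1 by rewrite invr_ge0 ltW.
  by rewrite !mulNr opprK; nra.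
- apply: continuous_in_subspaceT => t /set_mem /=; rewrite in_itv /= => /andP[at0 _].
  exact/cont_profile/(lt_le_trans a0).
- have dp t : 0 < t -> derivable (primitive x) t 1.
    by move=> t0; have [] := is_derive_primitive x0 t0.
  have cp t : 0 < t -> {for t, continuous (primitive x)}.
    by move=> t0; apply: differentiable_continuous; apply/derivable1_diffP/dp.
  split.
  + move=> t; rewrite in_itv /= => /andP[at0 _]; exact/dp/(lt_trans a0).
  + exact/cvg_at_right_filter/cp.
  + by apply/cvg_at_left_filter/cp; exact: lt_trans ab.
- move=> t; rewrite in_itv /= => /andP[at0 _].
  have t0 := lt_trans a0 at0.
  by rewrite derive1E; have [_ ->] := is_derive_primitive x0 t0.
Qed.

(** Positivity of a real-valued integral includes finiteness, since an
    infinite integral is sent to 0. *)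
Lemma Gamma_gt0 (x : R) : 0 < x -> 0 < Gamma x.
Proof.
move=> x0; rewrite /Gamma /Rintegral -/(kernel x).
set J := (\int[mu]_(t in `]0%R, +oo[) (kernel x t)%:E)%E.
have k0 t : (0 <= (kernel x t)%:E)%E.
  by rewrite lee_fin mulr_ge0 ?powR_ge0 ?expR_ge0.
have mk (D : set R) : measurable_fun D (fun t => (kernel x t)%:E).
  apply/measurable_EFinP; apply: measurable_funTS; exact: measurable_kernel.
apply: fine_gt0; apply/andP; split; last first.
  have [C hC] := integral_kernel_bounded x0.
  (* compact intervals exhausting the half-line, uniformly bounded integrals *)
  pose F (i : nat) : set R := `[i.+2%:R^-1, i.+2%:R]%classic.
  have FE : `]0%R, +oo[%classic = \bigcup_i F i :> set R.
    apply/seteqP; split=> t /=; rewrite in_itv /= andbT.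
      move=> t0; exists (Num.truncn (t + t^-1)) => //; rewrite /F /= in_itv /=.
      have ti : 0 < t^-1 by rewrite invr_gt0.
      have : t + t^-1 < (Num.truncn (t + t^-1)).+2%:R.
        by apply: lt_trans (truncnS_gt _) _; rewrite ltr_nat.
      set k : R := _.+2%:R => tk; apply/andP; split; last lra.
      by rewrite -[leRHS]invrK lef_pV2 ?posrE //; lra.
    by move=> [i _]; rewrite /F /= in_itv /= => /andP[+ _]; apply: lt_le_trans.
  rewrite /J FE; apply: (@le_lt_trans _ _ C%:E); last exact: ltry.
  have cvgF : (\int[mu]_(t in F i) (kernel x t)%:E)%E @[i --> \oo] -->
      (\int[mu]_(t in \bigcup_i F i) (kernel x t)%:E)%E.
    apply: ge0_nondecreasing_set_cvg_integral => //.
    - apply/nondecreasing_seqP => i; apply/subsetPset => t /=.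
      rewrite /F /= !in_itv /= => /andP[h1 h2]; apply/andP; split.
        by apply: le_trans h1; rewrite lef_pV2 ?posrE ?ltr0n // ler_nat.
      by apply: le_trans h2 _; rewrite ler_nat.
    - by move=> i; exact: measurable_itv.
    - by move=> i; exact: mk.
  rewrite -(cvg_lim _ cvgF) //; apply: lime_le; first by apply/cvg_ex; eexists; exact: cvgF.
  apply: nearW => i; apply: hC; first by rewrite invr_gt0 ltr0n.
  by apply: (@lt_trans _ _ 1); rewrite ?invf_lt1 ?ltr0n // ltr1n.
(* a lower bound of the kernel on [1, 2], whatever the sign of x - 1 *)
pose m : R := Num.min 1 (2 `^ (x - 1)) * expR (- 2).
have m0 : 0 < m by rewrite mulr_gt0 ?expR_gt0 // lt_min ltr01 powR_gt0.
apply: (@lt_le_trans _ _ m%:E); first by rewrite lte_fin.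
have J1 : (\int[mu]_(t in `[1%R, 2%R]) (kernel x t)%:E <= J)%E.
  apply: ge0_subset_integral => //; first exact: mk.
  move=> t /=; rewrite !in_itv /= andbT => /andP[t1 _]; exact: lt_le_trans t1.
apply: le_trans J1.
have -> : m%:E = (\int[mu]_(t in `[1%R, 2%R]) (cst m%:E t))%E.
  rewrite integral_cst //= lebesgue_measure_itv /= lte_fin ifT; last by rewrite ltr1n.
  by rewrite -EFinB (_ : 2 - 1 = 1) ?mule1 //; lra.
apply: ge0_le_integral => //; [by move=> t _; rewrite lee_fin ltW|exact: mk|].
move=> t /=; rewrite in_itv /= lee_fin => /andP[t1 t2].
have t0 : 0 <= t by lra.
apply: ler_pM; rewrite ?expR_ge0 //.
  rewrite ge_min; have [x1|x1] := leP 1 x.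
    by apply/orP; left; rewrite -[leLHS](powRr0 t) ler_powR // subr_ge0.
  apply/orP; right; rewrite -[x - 1]opprK !(powRN _ (- _)).
  rewrite lef_pV2 ?posrE ?powR_gt0 //; last lra.
  by rewrite ge0_ler_powR ?nnegrE //; lra.
by rewrite ler_expR lerN2.
Qed.
End gamma.

(** * The particle weights as a Gibbs measure *)

Section simplex_facts.
Variables (R : realType) (n : nat).
Local Notation V := 'rV[R]_n.
Implicit Types p q : V.

Lemma simplex_gt0 p i : simplex p -> 0 < p 0 i.
Proof. by case=> /(_ i) /andP[]. Qed.

Lemma simplex_dim_gt0 p : simplex p -> (0 < n)%N.
Proof.
case=> _; case: (posnP n) p => // -> p; rewrite big_ord0 => /eqP.
by rewrite eq_sym oner_eq0.
Qed.

Lemma sum_ratio_gt0 p q : simplex p -> simplex q -> 0 < \sum_i q 0 i / p 0 i.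
Proof.
move=> sp sq; have i0 := Ordinal (simplex_dim_gt0 sp).
rewrite (bigD1 i0) //= ltr_pwDl ?divr_gt0 ?simplex_gt0 // sumr_ge0 // => i _.
by rewrite divr_ge0 // ltW // simplex_gt0.
Qed.
End simplex_facts.

Section gibbs.
Variables (R : realType) (n : nat).
Local Notation V := 'rV[R]_n.

Lemma f_densityE (lambda : R) (q p : V) : simplex p -> simplex q ->
  f_density lambda q p = Gamma lambda / Gamma (lambda / n%:R) ^+ n *
    expR (- (lambda * ln n%:R)) * (\prod_i q 0 i)^-1 * expR (- (lambda * cost p q)).
Proof.
move=> sp sq; have n0 := simplex_dim_gt0 sp.
have nR : 0 < n%:R :> R by rewrite ltr0n.
have S0 := sum_ratio_gt0 sp sq.
have r0 i : 0 < q 0 i / p 0 i by rewrite divr_gt0 ?simplex_gt0.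
rewrite /f_density -!mulrA; congr (_ * (_ * _)).
rewrite [RHS]mulrCA; congr (_ * _).
rewrite /powR [in LHS](gt_eqF S0).
under eq_bigr do rewrite gt_eqF //.
rewrite -expR_sum -!expRD -mulr_sumr; congr expR.
rewrite /cost lnM ?posrE ?invr_gt0 // lnV ?posrE //.
by field; rewrite gt_eqF.
Qed.

(** The factor of the density that depends on q alone has a product over the
    sample which no matching changes, so it cancels, together with the
    constants, in the normalization. *)
Lemma nu_sigma_gibbs (N : nat) (p q : nat -> V) (lambda : R) (E : 'S_N -> R) (k : R) :
    0 < lambda -> (0 < n)%N ->
    (forall i : 'I_N, simplex (p i)) -> (forall i : 'I_N, simplex (q i)) ->
    (forall s : 'S_N, \sum_(i < N) cost (p i) (q (s i)) = E s + k) ->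
  forall s, nu_sigma p q lambda s =
    expR (- (lambda * E s)) / \sum_t expR (- (lambda * E t)).
Proof.
move=> l0 n0 sp sq costE s.
have nR : 0 < n%:R :> R by rewrite ltr0n.
pose A : R := Gamma lambda / Gamma (lambda / n%:R) ^+ n * expR (- (lambda * ln n%:R)).
have A0 : 0 < A by rewrite !mulr_gt0 ?invr_gt0 ?exprn_gt0 ?Gamma_gt0 ?divr_gt0 ?expR_gt0.
pose B : R := \prod_(i < N) (\prod_j q i 0 j)^-1.
have B0 : 0 < B.
  by apply: prodr_gt0 => i _; rewrite invr_gt0 prodr_gt0 // => j _; rewrite simplex_gt0.
pose G : R := A ^+ N * B * expR (- (lambda * k)).
have G0 : 0 < G by rewrite !mulr_gt0 ?exprn_gt0 ?expR_gt0.
have w (t : 'S_N) : \prod_(i < N) f_density lambda (q (t i)) (p i) = G * expR (- (lambda * E t)).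
  under eq_bigr do rewrite f_densityE // -/A.
  rewrite big_split big_split /= prodr_const card_ord -expR_sum sumrN -mulr_sumr.
  rewrite costE (_ : \prod_(i < N) _ = B).
    by rewrite /G -[RHS]mulrA -expRD mulrDr opprD addrC.
  by rewrite /B [RHS](reindex_inj (@perm_inj _ t)).
rewrite /nu_sigma w; under eq_bigr do rewrite w.
by rewrite -mulr_sumr invfM mulrACA divff ?mul1r // gt_eqF.
Qed.
End gibbs.

(** * Transport cost from discrepancies at every level *)

Section multiscale.
Variable R : realType.

(** The squared distance of two points whose cells separate at level l + 1 is
    at most a constant times 4^-l = 4 * 4^-(l+1), and at most a constant times
    4^-L if they are in the same cell of level L.  With delta the indicator of
    separation, [multiscale] dominates both; being affine in delta, it can be
    averaged. *)
Definition multiscale (L : nat) (delta : nat -> R) : R :=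
  4^-1 ^+ L + \sum_(l < L) 4 * 4^-1 ^+ l.+1 * delta l.+1.

Lemma multiscale_le (L : nat) (same : nat -> bool) (D rho : R) : 0 <= D ->
  same 0%N -> (forall l, same l -> rho <= D * 4^-1 ^+ l) ->
  rho <= D * multiscale L (fun l => (~~ same l)%:R).
Proof.
move=> D0 s0 hs; elim: L => [|L IH].
  by rewrite /multiscale big_ord0 addr0; exact: hs.
have ge0 l : 0 <= (4^-1 : R) ^+ l by rewrite exprn_ge0 // invr_ge0.
have sum0 : 0 <= \sum_(l < L) 4 * (4^-1 : R) ^+ l.+1 * (~~ same l.+1)%:R.
  by apply: sumr_ge0 => l _; rewrite !mulr_ge0.
rewrite /multiscale big_ord_recr /=; have [s|_] := boolP (same L.+1).
  apply: le_trans (hs _ s) _; rewrite ler_wpM2l // mulr0 addr0 lerDl //.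
apply: le_trans IH _; rewrite ler_wpM2l // /multiscale mulr1 exprS.
have := ge0 L; lra.
Qed.

Lemma multiscale_mono (L : nat) (d1 d2 : nat -> R) :
  (forall l, (l <= L)%N -> d1 l <= d2 l) -> multiscale L d1 <= multiscale L d2.
Proof.
move=> h; rewrite lerD2l; apply: ler_sum => l _.
by rewrite ler_wpM2l ?mulr_ge0 ?exprn_ge0 ?invr_ge0 // h // ltn_ord.
Qed.

Lemma multiscale_average (I : finType) (w : I -> R) (L : nat) (b : I -> nat -> R) :
  \sum_i w i = 1 ->
  \sum_i w i * multiscale L (b i) = multiscale L (fun l => \sum_i w i * b i l).
Proof.
move=> w1; under eq_bigr do rewrite mulrDr.
rewrite big_split /= -mulr_suml w1 mul1r; congr (_ + _).
under eq_bigr do rewrite mulr_sumr; rewrite exchange_big /=; apply: eq_bigr => l _.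
by rewrite mulr_sumr; apply: eq_bigr => i _; ring.
Qed.
End multiscale.

Section matching_cost.
Variables (R : realType) (n N : nat).
Hypothesis N_gt0 : (0 < N)%N.
Local Notation V := 'rV[R]_n.

(** The matching is good at all levels at once, so that its cost can be summed
    level by level. *)
Lemma matching_cost_le (x y : 'I_N -> V) (L : nat) :
    (forall i, simplex (x i)) -> (forall i, simplex (y i)) ->
  exists s : 'S_N, N%:R^-1 * \sum_i l2norm (y (s i) - x i) ^+ 2 <=
    n%:R * multiscale L (fun l => \sum_k
      `|freq R (fun i => cell l (x i)) k - freq R (fun i => cell l (y i)) k|).
Proof.
move=> sx sy.
have [s hs] := exists_treelike_matching (@cell_nested R n) L x y.
exists s; pose same i l := cell l (x i) == cell l (y (s i)).
have N0 : 0 < N%:R :> R by rewrite ltr0n.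
apply: le_trans (_ : _ <= \sum_i N%:R^-1 * (n%:R * multiscale L (fun l => (~~ same i l)%:R))) _.
  rewrite mulr_sumr; apply: ler_sum => i _; rewrite ler_wpM2l ?invr_ge0 ?(ltW N0) //.
  apply: multiscale_le => //.
    by apply/eqP/cell_dyad => j; rewrite /dyad expn0 !minn0.
  move=> l /eqP e; rewrite l2norm_sqr.
  under eq_bigr do rewrite !mxE.
  by apply: cell_close => //; rewrite e.
under eq_bigr do rewrite mulrCA; rewrite -mulr_sumr ler_wpM2l //.
rewrite multiscale_average; last by rewrite sumr_const card_ord -[LHS]mulr_natl divff // gt_eqF.
apply: multiscale_mono => l lL.
rewrite -mulr_sumr; apply: le_trans (_ : _ <= N%:R^-1 *
   (#|[set i | cell l (x i) != cell l (y (s i))]%SET|)%:R) _.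
  rewrite ler_wpM2l ?invr_ge0 ?(ltW N0) // -sum1_card natr_sum [leRHS]big_mkcond /=.
  by apply: ler_sum => i _; rewrite inE /same; case: (_ != _).
have count (f : 'I_N -> {ffun 'I_n -> 'I_(2 ^ l).-1.+1}) k :
    freq R f k = N%:R^-1 * (#|[set i | f i == k]%SET|)%:R.
  rewrite /freq; congr (_ * _); rewrite -sum1_card natr_sum [RHS]big_mkcond /=.
  by apply: eq_bigr => i _; rewrite inE; case: (_ == _).
apply: le_trans (_ : _ <= N%:R^-1 * (\sum_(k : {ffun 'I_n -> 'I_(2 ^ l).-1.+1})
    (#|[set i | cell l (x i) == k]%SET| - #|[set i | cell l (y i) == k]%SET|)%N)%:R) _.
  by rewrite ler_wpM2l ?invr_ge0 ?(ltW N0) // ler_nat hs.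
rewrite natr_sum mulr_sumr; apply: ler_sum => k _.
rewrite !count -mulrBr normrM ger0_norm ?invr_ge0 ?(ltW N0) //.
rewrite ler_wpM2l ?invr_ge0 ?(ltW N0) //.
set a := #|_|; set b := #|_|; have [ab|ba] := leqP a b.
  by move: ab; rewrite -subn_eq0 => /eqP ->; exact: normr_ge0.
by rewrite natrB ?(ltnW ba) // ler_norm.
Qed.
End matching_cost.

Section pair_cells.
Variables (R : realType) (n : nat).
Local Notation V := 'rV[R]_n.

Definition pair_cell (l : nat) (z : V * V) := (cell l z.1, cell l z.2).

Definition simplex2 : set (V * V) := simplex `*` simplex.

Lemma measurable_simplex2 : measurable simplex2.
Proof. by apply: measurableX; exact: measurable_simplex. Qed.

Lemma card_pair_cells l :
  #|{: {ffun 'I_n -> 'I_(2 ^ l).-1.+1} * {ffun 'I_n -> 'I_(2 ^ l).-1.+1}}|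
  = (2 ^ (2 * n * l))%N.
Proof.
by rewrite card_prod !card_cells -expnD; congr (_ ^ _)%N; rewrite addnn -mul2n -mulnA (mulnC l).
Qed.

Lemma measurable_pair_cell l k : measurable (pair_cell l @^-1` [set k]).
Proof.
rewrite (_ : _ @^-1` _ = (cell l @^-1` [set k.1]) `*` (cell l @^-1` [set k.2])).
  by apply: measurableX; exact: measurable_cell.
by apply/seteqP; case: k => a b; split=> -[v w] /=; [case=> <- <-|case=> <- <-].
Qed.

Lemma pair_cell_nested l z w :
  pair_cell l.+1 z = pair_cell l.+1 w -> pair_cell l z = pair_cell l w.
Proof.
by case=> e1 e2; congr (_, _); exact: cell_nested.
Qed.

Lemma pair_cell0 z w : pair_cell 0 z = pair_cell 0 w.
Proof.
have c0 (u v : V) : cell 0 u = cell 0 v.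
  by apply/cell_dyad => j; rewrite /dyad expn0 !minn0.
by congr (_, _); exact: c0.
Qed.

Lemma pair_cell_close l z w : simplex2 z -> simplex2 w ->
  pair_cell l z = pair_cell l w -> dist_pair z w ^+ 2 <= 2 * n%:R * 4^-1 ^+ l.
Proof.
case=> z1 z2 [w1 w2] [e1 e2]; rewrite dist_pair_sqr.
by have := cell_close z1 w1 e1; have := cell_close z2 w2 e2; lra.
Qed.

Lemma pair_cell_coarser l L z w : (l <= L)%N ->
  pair_cell L z = pair_cell L w -> pair_cell l z = pair_cell l w.
Proof. exact: (nested_le pair_cell_nested). Qed.

Variables (N : nat) (N_gt0 : (0 < N)%N).

(** The law mu is replaced by its masses on the cells of level L, each carried
    by a representative y_F in the simplex; the cells that miss the simplex
    have no mass.  The plan g is the fractional coupling along the tree, and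
    k bounds the cost from z_i to any point of a cell F. *)
Lemma empirical_transport (z : 'I_N -> V * V) (mu : probability (V * V)%type R)
    (L : nat) : (forall i, simplex2 (z i)) -> mu simplex2 = 1%E ->
  exists g k, [/\ forall i F, 0 <= g i F,
    forall i, \sum_F g i F = N%:R^-1,
    forall F, \sum_i g i F = fine (mu (pair_cell L @^-1` [set F])),
    forall i F, 0 <= k i F :> R &
    (forall i w, simplex2 w -> dist_pair (z i) w ^+ 2 <= k i (pair_cell L w)) /\
    \sum_i \sum_F g i F * k i F <= 2 * n%:R * multiscale L (fun l => \sum_k
      `|freq R (fun i => pair_cell l (z i)) k - fine (mu (pair_cell l @^-1` [set k]))|)].
Proof.
move=> sz mu1; have N0 : 0 < N%:R :> R by rewrite ltr0n.
pose z0 := z (Ordinal N_gt0).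
pose y (F : {ffun 'I_n -> 'I_(2 ^ L).-1.+1} * {ffun 'I_n -> 'I_(2 ^ L).-1.+1}) : V * V :=
  if pselect (exists w, simplex2 w /\ pair_cell L w = F) is left h then projT1 (cid h) else z0.
have yP w : simplex2 w -> pair_cell L (y (pair_cell L w)) = pair_cell L w.
  move=> sw; rewrite /y; case: pselect => [h|[]]; last by exists w.
  by case: (cid h) => ? /= [].
have ys F : simplex2 (y F).
  by rewrite /y; case: pselect => [h|_]; [case: (cid h) => ? /= []|exact: sz].
pose b F := fine (mu (pair_cell L @^-1` [set F])).
have b0 F : 0 <= b F by rewrite fine_ge0.
have muF A : measurable A -> (fine (mu A))%:E = mu A.
  by move=> mA; rewrite fineK // fin_num_measure.
have mu0 A : measurable A -> A `&` simplex2 = set0 -> mu A = 0%E.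
  move=> mA As; have e : mu (~` simplex2) = 0%E.
    by rewrite probability_setC ?mu1 ?subee //; exact: measurable_simplex2.
  apply/eqP; rewrite eq_le measure_ge0 andbT -e le_measure ?inE //.
    by apply: measurableC; exact: measurable_simplex2.
  by move=> w Aw sw; have : (A `&` simplex2) w by []; rewrite As.
(* The cells of level L are the leaves of the tree; cells of level l are
   recovered as unions of leaves, up to sets that miss the simplex. *)
have coarse l k : (l <= L)%N ->
    fine (mu (pair_cell l @^-1` [set k])) = \sum_(F | pair_cell l (y F) == k) b F.
  move=> lL; apply: EFin_inj; rewrite muF; last exact: measurable_pair_cell.
  rewrite (measure_fibres mu (@measurable_pair_cell l k) (@measurable_pair_cell L)).
  rewrite -sumEFin [RHS]big_mkcond /=; apply: eq_bigr => F _.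
  have mI := measurableI _ _ (@measurable_pair_cell l k) (@measurable_pair_cell L F).
  have [F0|Fn0] := eqVneq ((pair_cell L @^-1` [set F]) `&` simplex2) set0.
    have F0' := mu0 _ (@measurable_pair_cell L F) F0.
    rewrite mu0 //; first by rewrite /b F0'; case: ifP.
    by rewrite -setIA F0 setI0.
  have /set0P [w [/= wF sw]] := Fn0.
  have yF : pair_cell L (y F) = F by rewrite -wF yP.
  have lF v : pair_cell L v = F -> pair_cell l v = pair_cell l (y F).
    by move=> vF; apply: pair_cell_coarser lL _; rewrite vF.
  case: ifPn => [/eqP <-|/eqP nk].
    rewrite /b muF; last exact: measurable_pair_cell.
    congr (mu _); apply/seteqP; split=> v /= => [[]//|vF]; split=> //; exact: lF.
  rewrite (_ : _ `&` _ = set0) ?measure0 //.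
  apply/seteqP; split=> v //= [vk vF]; apply: nk; by rewrite -vk; apply/esym/lF.
pose cx l i := pair_cell l (z i).
pose cy l F := pair_cell l (y F).
have sumb : \sum_F b F = 1.
  have := coarse 0%N (pair_cell 0 z0) (leq0n _).
  rewrite (_ : _ @^-1` _ = setT).
    rewrite probability_setT /= => ->; apply: eq_bigl => F.
    by rewrite (pair_cell0 _ z0) eqxx.
  by apply/seteqP; split=> // v _; exact: pair_cell0.
have sumN : \sum_(i < N) N%:R^-1 = 1 :> R.
  by rewrite sumr_const card_ord -[LHS]mulr_natl divff // gt_eqF.
have [|||||g [g0 ga gb gd]] := @exists_treelike_coupling R 'I_N _ _ cx cy
    (fun _ => N%:R^-1) b _ b0 _ (pair_cell 0 z0) _ _ _ L.
- by move=> _; rewrite invr_ge0 ltW.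
- by move=> l i F; exact: pair_cell_nested.
- by move=> i; exact: pair_cell0.
- by move=> F; exact: pair_cell0.
- by rewrite sumb.
have D0 : 0 <= 2 * n%:R :> R by rewrite mulr_ge0.
pose dis i F l : R := (pair_cell l (z i) != pair_cell l (y F))%:R.
exists g, (fun i F => 2 * n%:R * multiscale L (dis i F)).
split=> //.
  move=> i F; rewrite mulr_ge0 // addr_ge0 ?exprn_ge0 ?invr_ge0 // sumr_ge0 // => l _.
  by rewrite !mulr_ge0 // exprn_ge0 // invr_ge0.
split.
  move=> i w sw.
  have -> : multiscale L (dis i (pair_cell L w)) =
            multiscale L (fun l => (~~ (pair_cell l (z i) == pair_cell l w))%:R).
    apply/eqP; rewrite eq_le; apply/andP; split; apply: multiscale_mono => l lL;
    by rewrite /dis (pair_cell_coarser lL (yP w sw)).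
  apply: multiscale_le => //; first by apply/eqP; exact: pair_cell0.
  by move=> l /eqP e; apply: pair_cell_close.
under eq_bigr do (under eq_bigr do rewrite mulrCA; rewrite -mulr_sumr).
rewrite -mulr_sumr ler_wpM2l // pair_bigA /= multiscale_average; last first.
  by rewrite -(pair_bigA _ g) /=; under eq_bigr do rewrite ga.
apply: multiscale_mono => l lL.
rewrite -(pair_bigA _ (fun i F => g i F * dis i F l)) /=.
apply: le_trans (_ : _ <= \sum_i \sum_(F | cx l i != cy l F) g i F) _.
  apply: ler_sum => i _; rewrite [leRHS]big_mkcond /=; apply: ler_sum => F _.
  by rewrite /dis -/(cx l i) -/(cy l F); case: ifP => _; rewrite ?mulr1 ?mulr0.
apply: le_trans (gd l lL) _; apply: ler_sum => k _.
rewrite (coarse l k lL).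
suff -> : freq R (cx l) k = \sum_(i | cx l i == k) N%:R^-1 by [].
rewrite /freq mulr_sumr [RHS]big_mkcond /=; apply: eq_bigr => i _.
by case: (_ == _); rewrite ?mulr1 ?mulr0.
Qed.
End pair_cells.

(** * A deterministic bound for the particle coupling *)

Section particle_coupling.
Variables (R : realType) (n N : nat).
Local Notation V := 'rV[R]_n.
Hypothesis N_gt0 : (0 < N)%N.
Variables (p q qs : nat -> V) (lambda alpha alpha' : R).
Variables (Rstar : probability (V * V)%type R) (h : V -> R) (D : V -> V -> R).
Hypotheses (lambda_gt0 : 0 < lambda) (alpha_gt0 : 0 < alpha) (alpha'_gt0 : 0 < alpha').
Hypotheses (sp : forall i : 'I_N, simplex (p i)) (sq : forall i : 'I_N, simplex (q i)).
Hypothesis sqs : forall i : 'I_N, simplex (qs i).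
Hypothesis Rstar1 : Rstar (@simplex2 R n) = 1%E.
Hypothesis costE : forall (i : 'I_N) u, simplex u ->
  cost (p i) u = cost (p i) (qs i) + D u (qs i) + h u - h (qs i).
Hypothesis D_bounds : forall u v, simplex u -> simplex v ->
  alpha * l2norm (u - v) ^+ 2 <= D u v <= alpha' * l2norm (u - v) ^+ 2.

(** The Gibbs weight of a matching is governed by the divergences between the
    matched points q_(s i) and the images qs_i of the p_i. *)
Let energy (s : 'S_N) := \sum_(i < N) D (q (s i)) (qs i).
Let nu := @nu_sigma R n N p q lambda.

Let n_gt0 : (0 < n)%N. Proof. exact: simplex_dim_gt0 (sp (Ordinal N_gt0)). Qed.

Let NR : 0 < N%:R :> R. Proof. by rewrite ltr0n. Qed.

Let nuE s : nu s = expR (- (lambda * energy s)) / \sum_t expR (- (lambda * energy t)).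
Proof.
apply: (@nu_sigma_gibbs _ _ _ _ _ _ _ (\sum_(i < N) cost (p i) (qs i)
  + \sum_(i < N) h (q i) - \sum_(i < N) h (qs i))) => // t.
under eq_bigr do rewrite costE //.
rewrite sumrB !big_split /=.
rewrite [X in _ + _ + X - _](_ : _ = \sum_(i < N) h (q i)); last first.
  by rewrite [RHS](reindex_inj (@perm_inj _ t)).
by rewrite /energy; ring.
Qed.

Let partition_gt0 : 0 < \sum_t expR (- (lambda * energy t)).
Proof.
rewrite (bigD1 1%g) //=; apply: ltr_pwDl; first exact: expR_gt0.
by apply: sumr_ge0 => t _; exact: expR_ge0.
Qed.

Let nu_ge0 s : 0 <= nu s.
Proof. by rewrite nuE divr_ge0 ?expR_ge0 // ltW. Qed.

Let nu_sum : \sum_s nu s = 1.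
Proof. by under eq_bigr do rewrite nuE; rewrite -mulr_suml divff // gt_eqF. Qed.

Let mean_energy_le (s0 : 'S_N) :
  \sum_s nu s * (N%:R^-1 * energy s) <= N%:R^-1 * energy s0 + ln N%:R / lambda.
Proof.
have := gibbs_energy_le (fun s => lambda * energy s) s0.
under eq_bigr do rewrite -nuE.
rewrite card_Sn; move=> /le_trans /(_ (lerD (lexx _) (ln_fact_le R N))).
rewrite [X in X <= _ -> _](_ : _ = lambda * N%:R * \sum_s nu s * (N%:R^-1 * energy s)).
  rewrite [X in _ <= X -> _](_ : _ = lambda * N%:R * (N%:R^-1 * energy s0 + ln N%:R / lambda)).
    by rewrite ler_pM2l // mulr_gt0.
  by field; rewrite !gt_eqF.
rewrite mulr_sumr; apply: eq_bigr => s _.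
by field; rewrite gt_eqF.
Qed.

(** The coupling of M_N with R* sends (p_i, q_(s i)), with weight nu_s, where
    the coupling of the empirical measure sends (p_i, qs_i).  The squared
    distance is then at most twice the energy term |q_(s i) - qs_i|^2 plus
    twice the transport cost of the pair (p_i, qs_i). *)
Lemma W2_particle_coupling_le L :
  (W2 (@M_N R n N p q lambda) Rstar ^+ 2 <=
    (2 / alpha * (alpha' * (n%:R * multiscale L (fun l => \sum_k
        `|freq R (fun i : 'I_N => cell l (qs i)) k -
          freq R (fun i : 'I_N => cell l (q i)) k|)) + ln N%:R / lambda) +
     4 * n%:R * multiscale L (fun l => \sum_k
        `|freq R (fun i : 'I_N => pair_cell l (p i, qs i)) k -
          fine (Rstar (pair_cell l @^-1` [set k]))|))%:E)%E.
Proof.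
set m1 := multiscale L _; set m2 := multiscale L _.
have [s0 hs0] := matching_cost_le N_gt0 L sqs sq.
rewrite -/m1 in hs0.
have sz (i : 'I_N) : simplex2 (p i, qs i) by split; [exact: sp|exact: sqs].
have [gam [kap [gam0 gamN gamR kap0 [kapd kaps]]]] :=
  empirical_transport N_gt0 (z := fun i : 'I_N => (p i, qs i)) L sz Rstar1.
rewrite -/m2 in kaps.
pose x (t : 'S_N * 'I_N) : V * V := (p t.2, q (t.1 t.2)).
pose g (t : 'S_N * 'I_N) F := nu t.1 * gam t.2 F.
have g0 t F : 0 <= g t F by rewrite mulr_ge0.
have gR F : \sum_t g t F = fine (Rstar (pair_cell L @^-1` [set F])).
  rewrite -(pair_bigA _ (fun (s : 'S_N) (i : 'I_N) => nu s * gam i F)) /=.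
  under eq_bigr do rewrite -mulr_sumr gamR.
  by rewrite -mulr_suml nu_sum mul1r.
have [P [P1 P2 P3]] := semidiscrete_coupling x (@measurable_pair_cell R n L) g0 gR.
have cP : coupling (@M_N R n N p q lambda) Rstar P.
  split=> A mA; last exact: P2.
  rewrite /pushforward P1 //.
  under eq_bigr do rewrite /g -mulr_sumr gamN.
  rewrite -(pair_bigA _ (fun (s : 'S_N) (i : 'I_N) => (nu s / N%:R)%:E * \d_(p i, q (s i)) A)%E) /=.
  rewrite /M_N; apply: eq_bigr => s _.
  rewrite /M_sigma muleA -EFinM ge0_sume_distrr //.
apply: le_trans (W2_sqr_le cP) _.
pose a (t : 'S_N * 'I_N) := l2norm (q (t.1 t.2) - qs t.2) ^+ 2.
have a0 t : 0 <= a t by rewrite sqr_ge0.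
apply: le_trans (P3 (fun z => dist_pair z.1 z.2 ^+ 2) (@simplex2 R n)
  (fun t F => 2 * a t + 2 * kap t.2 F) _ _ _ _ _ _) _ => //.
- exact: measurable_dist_pair_sqr.
- by move=> z; rewrite sqr_ge0.
- exact: measurable_simplex2.
- by move=> t F; rewrite addr_ge0 // mulr_ge0 //.
- move=> [s i] w sw.
  apply: le_trans (_ : _ <= 2 * a (s, i) + 2 * dist_pair (p i, qs i) w ^+ 2) _; last first.
    by rewrite lerD2l ler_wpM2l // kapd.
  rewrite /a /= l2norm_sqr !dist_pair_sqr /= !mulrDr !mulr_sumr.
  have sq2 (I : finType) (u v w' : I -> R) : \sum_j (u j - w' j) ^+ 2 <=
      \sum_j 2 * (u j - v j) ^+ 2 + \sum_j 2 * (v j - w' j) ^+ 2.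
    rewrite -big_split /=; apply: ler_sum => j _.
    have := sqr_ge0 ((u j - v j) - (v j - w' j)); lra.
  have h1 := sq2 _ (fun j => q (s i) 0 j) (fun j => qs i 0 j) (fun j => w.2 0 j).
  have h2 : \sum_j (p i 0 j - w.1 0 j) ^+ 2 <= \sum_j 2 * (p i 0 j - w.1 0 j) ^+ 2.
    by apply: ler_sum => j _; have := sqr_ge0 (p i 0 j - w.1 0 j); lra.
  under [X in _ <= X + _]eq_bigr do rewrite !mxE.
  by move: h1 h2 => /=; lra.
rewrite lee_fin.
have -> : \sum_t \sum_F g t F * (2 * a t + 2 * kap t.2 F) =
    2 * (\sum_s nu s * (N%:R^-1 * \sum_i a (s, i))) +
    2 * \sum_i \sum_F gam i F * kap i F.
  under eq_bigr => t _ do under eq_bigr => F _ do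
    rewrite mulrDr (mulrCA _ 2) (mulrCA _ 2).
  under eq_bigr => t _ do rewrite big_split /= -!mulr_sumr -mulr_suml.
  rewrite big_split /= -!mulr_sumr; congr (_ * _ + _ * _).
    rewrite -(pair_bigA _ (fun (s : 'S_N) (i : 'I_N) => (\sum_F nu s * gam i F) * a (s, i))) /=.
    apply: eq_bigr => s _; rewrite !mulr_sumr; apply: eq_bigr => i _.
    by rewrite -mulr_sumr gamN -mulrA.
  transitivity (\sum_(s : 'S_N) \sum_(i < N) nu s * \sum_F gam i F * kap i F).
    rewrite (pair_bigA _ (fun (s : 'S_N) (i : 'I_N) =>
      nu s * \sum_F gam i F * kap i F)) /=.
    by apply: eq_bigr => t _; rewrite mulr_sumr; apply: eq_bigr => F _; rewrite /g mulrA.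
  transitivity ((\sum_s nu s) * \sum_(i < N) \sum_F gam i F * kap i F); last first.
    by rewrite nu_sum mul1r.
  by rewrite mulr_suml; apply: eq_bigr => s _; rewrite mulr_sumr.
have e1 : \sum_s nu s * (N%:R^-1 * \sum_i a (s, i)) <=
    alpha^-1 * (alpha' * (n%:R * m1) + ln N%:R / lambda).
  apply: le_trans (_ : _ <= \sum_s nu s * (alpha^-1 * (N%:R^-1 * energy s))) _.
    apply: ler_sum => s _; rewrite ler_wpM2l // mulrCA ler_wpM2l ?invr_ge0 ?(ltW NR) //.
    rewrite mulr_sumr; apply: ler_sum => i _.
    by rewrite ler_pdivlMl //; have /andP[] := D_bounds (sq (s i)) (sqs i).
  under eq_bigr do rewrite mulrCA.
  rewrite -mulr_sumr ler_wpM2l ?invr_ge0 ?(ltW alpha_gt0) //.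
  apply: le_trans (mean_energy_le s0) _; rewrite lerD2r.
  apply: le_trans (_ : _ <= N%:R^-1 * (alpha' * \sum_i l2norm (q (s0 i) - qs i) ^+ 2)) _.
    rewrite ler_wpM2l ?invr_ge0 ?(ltW NR) // mulr_sumr; apply: ler_sum => i _.
    by have /andP[] := D_bounds (sq (s0 i)) (sqs i).
  by rewrite mulrCA ler_wpM2l // ltW.
by move: e1 kaps; set X := _ + ln _ / _; set Y := \sum_s _; rewrite -[2 / alpha * X]mulrA; lra.
Qed.
End particle_coupling.

(** * Directional derivatives of exponentially concave functions *)

Section directional.
Variables (R : realType) (n : nat).
Local Notation V := 'rV[R]_n.
Implicit Types (r u v : V) (phi : V -> R).

Lemma is_derive_line phi r u (t : R) : derivable phi (t *: u + r) u ->
  is_derive t (1 : R) (fun h => phi (h *: u + r)) ('D_u phi (t *: u + r)).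
Proof.
have e : (fun h : R => h^-1 *: (((fun h => phi (h *: u + r)) \o shift t) (h *: (1 : R)) -
            phi (t *: u + r))) =
     (fun h : R => h^-1 *: ((phi \o shift (t *: u + r)) (h *: u) - phi (t *: u + r))).
  by apply/funext => h /=; rewrite [h *: 1]mulr1 scalerDl addrA.
by move=> d; apply: DeriveDef; rewrite /derivable /derive e.
Qed.

Lemma deriveZ_dir phi r (a : R) u : derivable phi r u -> derivable phi r (a *: u) ->
  'D_(a *: u) phi r = a * 'D_u phi r.
Proof.
move=> du dau.
have l1 := @is_derive_line phi r (a *: u) 0; rewrite scale0r add0r in l1.
have l2 := @is_derive_line phi r u (a * 0); rewrite mulr0 scale0r add0r in l2.
have la : is_derive (0 : R) (1 : R) (fun h : R => a * h) a.
  rewrite -[X in is_derive _ _ _ X]mulr1; apply: is_deriveZ.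
rewrite [RHS]mulrC.
have := @is_derive1_comp R (fun h => phi (h *: u + r)) (fun h : R => a * h) 0 _ a.
rewrite /= mulr0 => /(_ _ (l2 du) la) [_ <-].
have e : (fun h : R => phi (h *: (a *: u) + r)) = (fun h => phi ((a * h) *: u + r)).
  by apply/funext => h; rewrite scalerA (mulrC a).
by have [_ <-] := l1 dau; rewrite e.
Qed.

Lemma simplex_segment_near r u : simplex r -> tangent u ->
  exists2 e : R, 0 < e & forall t, `|t| < e -> simplex (t *: u + r).
Proof.
move=> sr tu; pose M := \sum_i `|u 0 i| + 1.
have M0 : 0 < M by rewrite ltr_pwDr // sumr_ge0.
have uM i : `|u 0 i| < M.
  rewrite /M (bigD1 i) //= -addrA ltrDl ltr_pwDr // sumr_ge0 //.
pose S := \sum_i ((r 0 i)^-1 + (1 - r 0 i)^-1) + 1.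
have r0 i : 0 < r 0 i /\ 0 < 1 - r 0 i.
  by case: sr => /(_ i) /andP[h1 h2] _; rewrite subr_gt0.
have inv0 i : 0 < (r 0 i)^-1 /\ 0 < (1 - r 0 i)^-1.
  by rewrite !invr_gt0; exact: r0.
have S0 : 0 < S.
  rewrite ltr_pwDr // sumr_ge0 // => i _; have [] := inv0 i; lra.
have rS i : S^-1 <= r 0 i /\ S^-1 <= 1 - r 0 i.
  have [h1 h2] := r0 i; have [h3 h4] := inv0 i.
  have h5 : (r 0 i)^-1 + (1 - r 0 i)^-1 <= S.
    rewrite /S (bigD1 i) //= -addrA lerDl addr_ge0 // sumr_ge0 // => j _.
    by have [] := inv0 j; lra.
  by split; rewrite -[leRHS]invrK lef_pV2 ?posrE //; lra.
exists (S^-1 / M); first by rewrite divr_gt0 ?invr_gt0.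
move=> t te; split; last first.
  under eq_bigr do rewrite !mxE.
  by rewrite big_split /= -mulr_sumr tu mulr0 add0r; case: sr.
move=> i; rewrite !mxE.
have : `|t * u 0 i| < S^-1.
  have [t0|t0] := eqVneq t 0; first by rewrite t0 mul0r normr0 invr_gt0.
  rewrite normrM; move: te; rewrite ltr_pdivlMr //; apply: le_lt_trans.
  by rewrite ler_wpM2l // ltW.
rewrite ltr_norml => /andP[h1 h2]; have [h3 h4] := rS i.
by apply/andP; split; lra.
Qed.

Lemma exp_concave_midpoint phi r1 r2 : exp_concave phi -> simplex r1 -> simplex r2 ->
  (expR (phi r1) + expR (phi r2)) / 2 <= expR (phi (2^-1 *: r1 + 2^-1 *: r2)).
Proof.
move=> ec s1 s2.
have h2 : unstable.onem (2^-1 : R) = 2^-1 by rewrite /unstable.onem; lra.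
have : - expR (phi (2^-1 *: r1 + 2^-1 *: r2)) <=
    2^-1 * - expR (phi r1) + 2^-1 * - expR (phi r2).
  have h0 : 0 <= 2^-1 :> R by lra.
  have h1 : 2^-1 <= 1 :> R by lra.
  pose t : {i01 R} := Itv01 h0 h1.
  have H := ec t r1 r2 (mem_set s1) (mem_set s2).
  by move: H; rewrite {1}/conv /= h2 convRE /= h2.
lra.
Qed.

(** Derivability along every line does not make the derivative additive in the
    direction.  Concavity does: for w = (u + v) / 2 the function
    exp phi(r + t w) - (exp phi(r + t u) + exp phi(r + t v)) / 2
    is nonnegative near 0 and vanishes at 0, so its derivative at 0 is 0. *)
Lemma deriveD_dir phi r u v : exp_concave phi -> simplex r ->
    (forall w s, tangent w -> simplex s -> derivable phi s w) ->
    tangent u -> tangent v ->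
  'D_(u + v) phi r = 'D_u phi r + 'D_v phi r.
Proof.
move=> ec sr dphi tu tv.
pose w : V := 2^-1 *: u + 2^-1 *: v.
have tw : tangent w.
  rewrite /tangent /w; under eq_bigr do rewrite !mxE.
  by rewrite big_split /= -!mulr_sumr tu tv !mulr0 addr0.
have [eu eu0 hu] := simplex_segment_near sr tu.
have [ev ev0 hv] := simplex_segment_near sr tv.
pose e := Num.min eu ev.
have e0 : 0 < e by rewrite lt_min eu0.
have near_seg t : t \in `]- e, e[ -> `|t| < eu /\ `|t| < ev.
  by rewrite in_itv /= -ltr_norml lt_min => /andP.
pose F x (t : R) := expR (phi (t *: x + r)).
have mid t : t *: w + r = 2^-1 *: (t *: u + r) + 2^-1 *: (t *: v + r).
  rewrite !scalerDr !scalerA addrACA -scalerDl (_ : 2^-1 + 2^-1 = 1); last by lra.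
  by rewrite scale1r !(mulrC t).
have sw t : t \in `]- e, e[ -> simplex (t *: w + r).
  move=> /near_seg [t1 t2]; have [h1 h2] := hu t t1; have [h3 h4] := hv t t2.
  have midE (x y : V) i : (2^-1 *: x + 2^-1 *: y) 0 i = 2^-1 * x 0 i + 2^-1 * y 0 i.
    by rewrite !mxE.
  rewrite mid; split; last first.
    under eq_bigr do rewrite midE.
    by rewrite big_split /= -!mulr_sumr h2 h4; lra.
  move=> i; have /andP[a1 a2] := h1 i; have /andP[b1 b2] := h3 i.
  rewrite midE.
  by apply/andP; split; lra.
have dF x t : tangent x -> simplex (t *: x + r) ->
    is_derive t (1 : R) (F x) (F x t * 'D_x phi (t *: x + r)).
  move=> tx st; have l := is_derive_line (dphi x _ tx st).
  exact: is_derive1_comp (is_derive_expR _) l.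
pose Kf (t : R) := F w t - 2^-1 * (F u t + F v t).
have dK t : t \in `]- e, e[ -> is_derive t (1 : R) Kf (F w t * 'D_w phi (t *: w + r) -
   2^-1 * (F u t * 'D_u phi (t *: u + r) + F v t * 'D_v phi (t *: v + r))).
  move=> te; have [t1 t2] := near_seg t te.
  apply: is_deriveB; first exact: dF (sw t te).
  by apply: is_deriveZ; apply: is_deriveD; [exact: dF (hu t t1)|exact: dF (hv t t2)].
have in0 : 0 \in `]- e, e[ by rewrite in_itv /= oppr_lt0 e0.
have F0 x : F x 0 = expR (phi r) by rewrite /F scale0r add0r.
have K0 : Kf 0 = 0 by rewrite /Kf !F0; lra.
have Kge t : t \in `]- e, e[ -> Kf 0 <= Kf t.
  move=> /near_seg [t1 t2]; rewrite K0 /Kf subr_ge0 -[leRHS]/(expR (phi (t *: w + r))) mid.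
  have := exp_concave_midpoint ec (hu t t1) (hv t t2); rewrite -/(F u t) -/(F v t).
  by lra.
have lee : - e <= e by lra.
have [_ d0] := derive1_at_min lee
  (fun t te => @ex_derive _ _ _ _ _ _ _ (dK t te)) in0 Kge.
have [_] := dK 0 in0; rewrite d0 !F0 !scale0r !add0r => d1.
have dw : 'D_w phi r = 2^-1 * ('D_u phi r + 'D_v phi r).
  have f0 := expR_gt0 (phi r).
  by apply: (mulfI (lt0r_neq0 f0)); lra.
have -> : u + v = 2 *: w.
  by rewrite /w scalerDr !scalerA divff // !scale1r.
rewrite deriveZ_dir ?dw; [lra|exact: dphi|apply: dphi => //].
rewrite /tangent; under eq_bigr do rewrite mxE.
by rewrite -mulr_sumr tw mulr0.
Qed.

End directional.

(** * The cost seen from a transported point *)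

Section cost_identity.
Variables (R : realType) (n : nat).
Local Notation V := 'rV[R]_n.
Variable phi : V -> R.
Hypothesis ec : exp_concave phi.
Hypothesis dphi : forall w s, tangent w -> simplex s -> derivable phi s w.

Lemma tangent_vertex (i : 'I_n) (v : V) : simplex v -> tangent (delta_mx 0 i - v).
Proof.
move=> [_ sv]; rewrite /tangent; under eq_bigr do rewrite !mxE.
rewrite sumrB sv (bigD1 i) //= !eqxx big1 ?addr0 ?subrr // => j.
by move=> /negbTE ->.
Qed.

Lemma tangentD (u v : V) : tangent u -> tangent v -> tangent (u + v).
Proof.
move=> tu tv; rewrite /tangent; under eq_bigr do rewrite mxE.
by rewrite big_split /= tu tv addr0.
Qed.

Lemma tangentZ (a : R) (v : V) : tangent v -> tangent (a *: v).
Proof.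
move=> tv; rewrite /tangent; under eq_bigr do rewrite mxE.
by rewrite -mulr_sumr tv mulr0.
Qed.

Lemma tangent0 : tangent (0 : V).
Proof. by rewrite /tangent big1 // => i _; rewrite mxE. Qed.

Lemma derive_dir0 (q : V) : simplex q -> 'D_(0 : V) phi q = 0.
Proof.
move=> sq; rewrite -(scale0r (0 : V)) deriveZ_dir ?mul0r //.
  by apply: dphi => //; exact: tangent0.
by apply: dphi => //; rewrite scale0r; exact: tangent0.
Qed.

Lemma derive_dir_sum (I : finType) (a : I -> R) (u : I -> V) (q : V) :
  simplex q -> (forall i, tangent (u i)) ->
  'D_(\sum_i a i *: u i) phi q = \sum_i a i * 'D_(u i) phi q.
Proof.
move=> sq tu.
suff [_ //] : tangent (\sum_i a i *: u i) /\
   'D_(\sum_i a i *: u i) phi q = \sum_i a i * 'D_(u i) phi q.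
elim: (index_enum I) => [|i s [IH1 IH2]].
  by rewrite !big_nil; split; [exact: tangent0|exact: derive_dir0].
have ti := tangentZ (a i) (tu i).
rewrite !big_cons; split; first exact: tangentD.
by rewrite deriveD_dir // IH2 deriveZ_dir //; apply: dphi.
Qed.

(** The directions e_i - q span the tangent space, and q' - q is their
    combination with weights q'_i. *)
Lemma portfolio_sum (q q' : V) : simplex q -> simplex q' ->
  \sum_i portfolio phi q 0 i / q 0 i * q' 0 i = 1 + 'D_(q' - q) phi q.
Proof.
move=> sq sq'.
have -> : q' - q = \sum_i q' 0 i *: (delta_mx 0 i - q).
  under eq_bigr do rewrite scalerBr.
  rewrite sumrB -scaler_suml; case: sq' => _ ->; rewrite scale1r; congr (_ - _).
  exact: row_sum_delta.
rewrite derive_dir_sum //; last by move=> i; exact: tangent_vertex.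
case: (sq') => _ <-; rewrite -big_split /=; apply: eq_bigr => i _.
by rewrite mxE; field; rewrite gt_eqF // simplex_gt0.
Qed.

(** The part of the cost identity that depends on the endpoint alone. *)
Definition entropy_potential (q : V) : R := phi q - n%:R^-1 * \sum_i ln (q 0 i).

(** The inverse of p is the image of the inverse of q under the map generated
    by the portfolio: q is the target of the source p.  As a relation it does
    not presuppose which of the two maps is given. *)
Definition transported (p q : V) : Prop :=
  [/\ simplex p, simplex q & sinv p = sop (sinv q) (portfolio phi q)].

(** In the group of the simplex a relation holds up to normalization; the
    normalization is the positive factor kappa. *)
Lemma transported_ratio (p q : V) : transported p q ->
  exists2 kappa : R, 0 < kappa & forall i, (p 0 i)^-1 = kappa * (portfolio phi q 0 i / q 0 i).
Proof.
case=> sp sq /rowP e.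
pose Sp := \sum_j (p 0 j)^-1; pose Sq := \sum_j (q 0 j)^-1.
pose Z := \sum_j sinv q 0 j * portfolio phi q 0 j.
have Sp0 : 0 < Sp.
  have i0 := Ordinal (simplex_dim_gt0 sp).
  rewrite /Sp (bigD1 i0) //=; apply: ltr_pwDl; first by rewrite invr_gt0 simplex_gt0.
  by apply: sumr_ge0 => j _; rewrite invr_ge0 ltW // simplex_gt0.
pose kappa := Sp / Sq / Z.
have kE i : (p 0 i)^-1 = kappa * (portfolio phi q 0 i / q 0 i).
  have := e i; rewrite [sinv p]/sinv [LHS]mxE [RHS]mxE -/Z [sinv q 0 i]mxE -/Sp -/Sq.
  move=> /(congr1 (fun x => x * Sp)); rewrite divfK ?gt_eqF // => ->.
  by rewrite /kappa; ring.
exists kappa => //.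
have S1 : \sum_i portfolio phi q 0 i / q 0 i * q 0 i = 1.
  by rewrite portfolio_sum // subrr derive_dir0 // addr0.
have <- : \sum_i q 0 i / p 0 i = kappa.
  rewrite -[RHS]mulr1 -S1 mulr_sumr; apply: eq_bigr => i _.
  by rewrite kE mulrCA; congr (_ * _); rewrite mulrC.
exact: sum_ratio_gt0.
Qed.

(** Since 1/p_i is proportional to pi_i(q)/q_i, the sum of the u_i/p_i is
    proportional to 1 + D_(u - q) phi(q) for every u in the simplex.  Its
    logarithm at u = q' and at u = q yields the L-divergence. *)
Lemma cost_transported (p q q' : V) : transported p q -> simplex q' ->
  cost p q' = cost p q + Ldiv phi q' q + entropy_potential q' - entropy_potential q.
Proof.
move=> tpq sq'; have [k k0 kE] := transported_ratio tpq.
case: tpq => sp sq _; have n0 := simplex_dim_gt0 sp.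
have nR : 0 < n%:R :> R by rewrite ltr0n.
have ratioE u : simplex u -> \sum_i u 0 i / p 0 i = k * (1 + 'D_(u - q) phi q).
  move=> su; rewrite -portfolio_sum // mulr_sumr; apply: eq_bigr => i _.
  by rewrite kE mulrCA; congr (_ * _); rewrite mulrC.
have d0 : 0 < 1 + 'D_(q' - q) phi q.
  by have := sum_ratio_gt0 sp sq'; rewrite ratioE // pmulr_rgt0.
have lnE u : simplex u -> \sum_i ln (u 0 i / p 0 i) = \sum_i ln (u 0 i) - \sum_i ln (p 0 i).
  move=> su; rewrite -sumrB; apply: eq_bigr => i _.
  by rewrite lnM ?posrE ?invr_gt0 ?simplex_gt0 // lnV ?posrE ?simplex_gt0.
rewrite /cost !ratioE // !lnE // subrr derive_dir0 // addr0 mulr1.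
rewrite mulrA lnM ?posrE ?mulr_gt0 ?invr_gt0 //.
by rewrite /Ldiv /entropy_potential; ring.
Qed.

Lemma portfolio_gt0 (p q : V) i : transported p q -> 0 < portfolio phi q 0 i.
Proof.
move=> tpq; have [k k0 kE] := transported_ratio tpq; case: tpq => sp sq _.
have : 0 < (p 0 i)^-1 by rewrite invr_gt0 simplex_gt0.
by rewrite kE pmulr_rgt0 // pmulr_lgt0 // invr_gt0 simplex_gt0.
Qed.

Lemma l2norm_simplexB_le (u v : V) : simplex u -> simplex v -> l2norm (u - v) ^+ 2 <= n%:R.
Proof.
move=> [su _] [sv _]; rewrite l2norm_sqr -[in leRHS](card_ord n) -sum1_card natr_sum.
apply: ler_sum => i _; rewrite !mxE.
have /andP[a b] := su i; have /andP[c d] := sv i.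
rewrite -real_normK ?num_real // exprn_ile1 ?normr_ge0 // ler_norml.
by apply/andP; split; lra.
Qed.

(** At a target q0 all the weights pi_i(q0) are positive, so that
    1 + D_(q - q0) phi(q0) stays between two positive constants.  As the
    divergence D[q : q0] is bounded as well, so is phi(q) - phi(q0). *)
Lemma phi_bounded (alpha alpha' : R) (p0 q0 : V) : 0 < alpha -> 0 < alpha' ->
    (forall q q' : V, simplex q -> simplex q' ->
       alpha * l2norm (q' - q) ^+ 2 <= Ldiv phi q' q <= alpha' * l2norm (q' - q) ^+ 2) ->
    transported p0 q0 ->
  exists C : R, forall q, simplex q -> `|phi q| <= C.
Proof.
move=> a0 a'0 hL t0; have [_ sq0 _] := t0.
pose w i := portfolio phi q0 0 i / q0 0 i.
have w0 i : 0 < w i by rewrite divr_gt0 ?(portfolio_gt0 _ t0) ?simplex_gt0.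
pose M := \sum_i w i; pose m := \sum_i (w i)^-1.
have wM i : w i <= M.
  by rewrite /M (bigD1 i) //= lerDl sumr_ge0 // => j _; exact: ltW.
have wm i : m^-1 <= w i.
  have h : (w i)^-1 <= m.
    by rewrite /m (bigD1 i) //= lerDl sumr_ge0 // => j _; rewrite invr_ge0 ltW.
  have m0 : 0 < m by apply: lt_le_trans h; rewrite invr_gt0.
  by rewrite -[leRHS]invrK lef_pV2 ?posrE ?invr_gt0.
have i0 := Ordinal (simplex_dim_gt0 sq0).
have m0 : 0 < m^-1.
  rewrite invr_gt0 /m (bigD1 i0) //=; apply: ltr_pwDl; first by rewrite invr_gt0.
  by apply: sumr_ge0 => j _; rewrite invr_ge0 ltW.
have M0 : 0 < M by apply: lt_le_trans (w0 i0) (wM i0).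
exists (`|phi q0| + `|ln M| + `|ln m^-1| + alpha' * n%:R) => q sq.
have dE := portfolio_sum sq0 sq.
set d := 1 + _ in dE.
have dM : d <= M.
  rewrite -dE -[leRHS]mulr1; case: (sq) => s01 <-; rewrite mulr_sumr.
  apply: ler_sum => i _; rewrite ler_wpM2r ?wM // ltW // simplex_gt0 //.
have dm : m^-1 <= d.
  rewrite -dE -[leLHS]mulr1; case: (sq) => s01 <-; rewrite mulr_sumr.
  apply: ler_sum => i _; rewrite ler_wpM2r ?wm // ltW // simplex_gt0 //.
have d0 : 0 < d by exact: lt_le_trans dm.
have lM : ln d <= ln M by rewrite ler_ln ?posrE.
have lm : ln m^-1 <= ln d by rewrite ler_ln ?posrE.
have /andP[L1 L2] := hL q0 q sq0 sq.
have nn := l2norm_simplexB_le sq sq0.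
have L1' : 0 <= Ldiv phi q q0 by apply: le_trans L1; rewrite mulr_ge0 ?sqr_ge0 // ltW.
have L2' : Ldiv phi q q0 <= alpha' * n%:R by apply: le_trans L2 _; rewrite ler_wpM2l // ltW.
move: L1' L2'; rewrite /Ldiv -/d => L1' L2'.
have h1 := ler_norm (phi q0).
have h3 := ler_norm (ln M); have h4 := normr_ge0 (ln M).
have h5 := normr_ge0 (ln m^-1); have h6 := ler_norm (- ln m^-1).
have h7 : 0 <= alpha' * n%:R by rewrite mulr_ge0 // ltW.
rewrite normrN in h6; have h8 := ler_norm (- phi q0); rewrite normrN in h8.
by rewrite ler_norml; apply/andP; split; lra.
Qed.
End cost_identity.

(** * Measurability of vector-valued maps and of the cost *)

Section measurable_vectors.
Context d (T : measurableType d) (R : realType) (n : nat).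
Local Notation V := 'rV[R]_n.

(** An open set of vectors is a countable union of boxes with rational
    corners.  Hence Borel measurability can be tested on coordinates. *)
Lemma measurable_fun_rV (D : set T) (f : T -> V) :
  (forall i, measurable_fun D (fun x => f x 0 i)) -> measurable_fun D f.
Proof.
move=> mf mD; apply: (measurability _ (erefl (@measurable _ V))) => // _ [U oU <-].
pose box (c : {ffun 'I_n -> rat * rat}) : set V :=
  [set v | forall i, v 0 i \in `]ratr (c i).1, ratr (c i).2[].
pose F c := if pselect (box c `<=` U) then D `&` f @^-1` box c else set0.
rewrite (_ : D `&` f @^-1` U = \bigcup_c F c).
  apply: countable_bigcupT_measurable; first exact: countableP.
  move=> c; rewrite /F; case: pselect => [a|a] /=; last exact: measurable0.
  rewrite (_ : _ `&` _ = D `&`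
      \bigcap_(i in [set: 'I_n]) (D `&` (fun x => f x 0 i) @^-1` `]ratr (c i).1, ratr (c i).2[%classic)).
    apply: measurableI => //; apply: fin_bigcap_measurable => // i _.
    by apply: mf => //; exact: measurable_itv.
  apply/seteqP; split=> x /= [Dx h]; split=> //; first by move=> i _; split=> //; exact: h.
  by move=> i; have [] := h i I.
apply/seteqP; split=> x /=; last first.
  by case=> c _; rewrite /F; case: pselect => //= cU [Dx bx]; split=> //; exact: cU.
case=> Dx; rewrite /preimage /= => Ux.
have [e /= e0 eU] : exists2 e : R, 0 < e & ball (f x) e `<=` U.
  by apply/nbhs_ballP; apply: open_nbhs_nbhs; split.
have lo i : exists q : rat, (ratr q : R) \in `](f x 0 i - e), (f x 0 i)[.
  by apply: rat_in_itvoo; rewrite gtrBl.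
have hi i : exists q : rat, (ratr q : R) \in `](f x 0 i), (f x 0 i + e)[.
  by apply: rat_in_itvoo; rewrite ltrDl.
exists [ffun i => (sval (cid (lo i)), sval (cid (hi i)))] => //.
rewrite /F; case: pselect => /= [_|[]].
  split=> // i; rewrite ffunE /=; case: (cid (lo i)) => a /= ha.
  case: (cid (hi i)) => b /= hb; move: ha hb.
  by rewrite !in_itv /= => /andP[h1 h2] /andP[h3 h4]; rewrite h2 h3.
move=> v hv; apply: eU; split=> // i j; rewrite (ord1 i).
have := hv j; rewrite ffunE /=; case: (cid (lo j)) => a /= ha.
case: (cid (hi j)) => b /= hb; move: ha hb.
rewrite !in_itv /= => /andP[h1 h2] /andP[h3 h4] /andP[h5 h6].
by rewrite /ball /= ltr_distl; apply/andP; split; lra.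
Qed.

(** Inversion is not continuous at 0; it is written as x (x^2)^-1, with the
    inverse of a nonnegative number given by a measurable power function. *)
Lemma measurable_inv (D : set T) (f : T -> R) :
  measurable_fun D f -> measurable_fun D (fun x => (f x)^-1).
Proof.
move=> mf; rewrite (_ : (fun x => _) = (fun x => f x * (f x ^+ 2) `^ (-1))); last first.
  apply/funext => x; rewrite powR_inv1 ?sqr_ge0 //.
  by have [->|f0] := eqVneq (f x) 0; [rewrite invr0 mul0r|field].
apply: measurable_funM => //.
apply: (measurableT_comp (measurable_powR (-1))); exact: measurable_funX.
Qed.
End measurable_vectors.

Section measurable_cost.
Variables (R : realType) (n : nat).
Local Notation V := 'rV[R]_n.

Lemma measurable_sinv : measurable_fun [set: V] (@sinv R n).
Proof.
apply: measurable_fun_rV => i; under eq_fun do rewrite mxE.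
apply: measurable_funM; first by apply: measurable_inv; exact: measurable_coord.
apply: measurable_inv; apply: measurable_sum => j.
by apply: measurable_inv; exact: measurable_coord.
Qed.

Lemma measurable_cost : measurable_fun [set: (V * V)%type] (fun z => cost z.1 z.2).
Proof.
have m1 i : measurable_fun [set: (V * V)%type] (fun z : V * V => z.1 0 i).
  by apply: (measurableT_comp (measurable_coord i)); exact: measurable_fst.
have m2 i : measurable_fun [set: (V * V)%type] (fun z : V * V => z.2 0 i).
  by apply: (measurableT_comp (measurable_coord i)); exact: measurable_snd.
have mr i : measurable_fun [set: (V * V)%type] (fun z : V * V => z.2 0 i / z.1 0 i).
  by apply: measurable_funM => //; exact: measurable_inv.
rewrite /cost; apply: measurable_funB.
  apply: (measurableT_comp (@measurable_ln R)); apply: measurable_funM => //.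
  exact: measurable_sum.
apply: measurable_funM => //; apply: measurable_sum => i.
exact: (measurableT_comp (@measurable_ln R)).
Qed.

Lemma sinv_simplex (p : V) : (2 <= n)%N -> simplex p -> simplex (sinv p).
Proof.
move=> n2 sp; have inv0 i : 0 < (p 0 i)^-1 by rewrite invr_gt0 simplex_gt0.
have n0 : (0 < n)%N by exact: leq_trans n2.
have S0 : 0 < \sum_j (p 0 j)^-1.
  rewrite (bigD1 (Ordinal n0)) //=; apply: ltr_pwDl => //.
  by apply: sumr_ge0 => j _; exact: ltW.
split; last first.
  under eq_bigr do rewrite mxE.
  by rewrite -mulr_suml divff // gt_eqF.
move=> i; rewrite mxE divr_gt0 //= ltr_pdivrMr // mul1r (bigD1 i) //= ltrDl.
have [j ji] : exists j : 'I_n, j != i.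
  have [e|] := eqVneq i (Ordinal n0); last by rewrite eq_sym; exists (Ordinal n0).
  by exists (Ordinal n2); rewrite e.
rewrite (bigD1 j) //=; apply: ltr_pwDl => //.
by apply: sumr_ge0 => k _; exact: ltW.
Qed.

Lemma sinvK (p : V) : simplex p -> sinv (sinv p) = p.
Proof.
move=> sp; have [_ s1] := sp.
have inv0 i : 0 < (p 0 i)^-1 by rewrite invr_gt0 simplex_gt0.
have n0 := simplex_dim_gt0 sp.
have S0 : 0 < \sum_j (p 0 j)^-1.
  rewrite (bigD1 (Ordinal n0)) //=; apply: ltr_pwDl => //.
  by apply: sumr_ge0 => j _; exact: ltW.
have e i : (sinv p 0 i)^-1 = p 0 i * \sum_j (p 0 j)^-1.
  by rewrite mxE invfM !invrK.
apply/rowP => i; rewrite [LHS]mxE; under eq_bigr do rewrite e.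
by rewrite e -mulr_suml s1 mul1r mulfK // gt_eqF.
Qed.
End measurable_cost.

(** * Integrals under image laws and almost sure statements *)

Section laws.
Context d1 (X : measurableType d1) d2 (Y : measurableType d2) (R : realType).
Variables (mu : probability X R) (nu : probability Y R) (Z : X -> Y).
Hypothesis mZ : measurable_fun [set: X] Z.
Hypothesis lawZ : forall A, measurable A -> nu A = mu (Z @^-1` A).

Let eq_law f : (\int[nu]_y f y = \int[image_measure mu mZ]_y f y)%E.
Proof. by apply: eq_measure_integral => A mA _; exact: lawZ. Qed.

Lemma ge0_integral_law (f : Y -> R) : measurable_fun [set: Y] f -> (forall y, 0 <= f y) ->
  (\int[nu]_y (f y)%:E = \int[mu]_x (f (Z x))%:E)%E.
Proof.
move=> mf f0; rewrite eq_law ge0_integral_pushforward //.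
- exact/measurable_EFinP.
- by move=> y _; rewrite lee_fin.
Qed.

Lemma integrable_law (f : Y -> R) : (forall y, 0 <= f y) ->
  nu.-integrable [set: Y] (EFin \o f) -> mu.-integrable [set: X] (EFin \o (f \o Z)).
Proof.
move=> f0 /integrableP [/measurable_EFinP mf fi]; apply/integrableP; split.
  by apply/measurable_EFinP; exact: measurableT_comp.
have absE d (W : measurableType d) (m : {measure set W -> \bar R}) (g : W -> R) :
    (forall x, 0 <= g x) -> (\int[m]_x `|(EFin \o g) x| = \int[m]_x (g x)%:E)%E.
  by move=> g0; apply: eq_integral => x _; rewrite gee0_abs // lee_fin.
rewrite absE; last by move=> x; exact: f0.
by rewrite absE // ge0_integral_law in fi.
Qed.

Lemma integral_law (f : Y -> R) : measurable_fun [set: Y] f ->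
  mu.-integrable [set: X] (EFin \o (f \o Z)) ->
  (\int[nu]_y (f y)%:E = \int[mu]_x (f (Z x))%:E)%E.
Proof.
move=> mf fi; rewrite eq_law integral_pushforward //; exact/measurable_EFinP.
Qed.
End laws.

Section almost_sure.
Context d (X : measurableType d) (R : realType) (P : probability X R).

Lemma prob1_ae (A : set X) : measurable A -> P A = 1%E -> {ae P, forall x, A x}.
Proof.
move=> mA PA; exists (~` A); split; first exact: measurableC.
  by rewrite probability_setC // PA subee.
by move=> x.
Qed.

Lemma ae_prob1 (A : set X) : measurable A -> {ae P, forall x, A x} -> P A = 1%E.
Proof.
move=> mA h; have PA : P (~` A) = 0%E.
  by apply: measure_negligible => //; exact: measurableC.
by rewrite -(setCK A) probability_setC ?PA ?sube0 //; exact: measurableC.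
Qed.

Lemma prob_setI1 (A S : set X) : measurable A -> measurable S -> P S = 1%E ->
  P (A `&` S) = P A.
Proof.
move=> mA mS PS; rewrite [RHS](measureDI P mA mS) [X in (X + _)%E](_ : _ = 0%E) ?add0e //.
apply/eqP; rewrite eq_le measure_ge0 andbT.
have <- : P (~` S) = 0%E by rewrite probability_setC // PS subee.
by apply: le_measure; rewrite ?inE; [exact: measurableD|exact: measurableC|move=> x []].
Qed.

Lemma ae_eq0_of_integral_le0 (f : X -> R) :
  P.-integrable [set: X] (EFin \o f) -> {ae P, forall x, 0 <= f x} ->
  (\int[P]_x (f x)%:E <= 0)%E -> {ae P, forall x, f x = 0}.
Proof.
move=> fi f0 f1; have /integrableP [mf _] := fi.
have e : (\int[P]_x `|(f x)%:E| = \int[P]_x (f x)%:E)%E.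
  apply: ae_eq_integral => //; first exact: measurableT_comp.
  by move: f0; apply: filterS => x fx _; rewrite gee0_abs // lee_fin.
have /(ae_eq_integral_abs _ measurableT mf) : (\int[P]_x `|(f x)%:E| = 0)%E.
  by apply/eqP; rewrite eq_le integral_ge0 // andbT e.
by apply: filterS => x /(_ I) [].
Qed.
End almost_sure.

(** * Integrable bounds for the cost *)

Section log_bound.
Variables (R : realType) (n : nat).
Local Notation V := 'rV[R]_n.
Local Notation S := (@simplex R n).

(** Under the laws at hand this function is integrable, and it dominates the
    cost and the potential: every function below is integrable for this
    reason. *)
Definition log_mass : V -> R := (fun p => \sum_i `|ln (p 0 i)|) \_ S.

Lemma log_massE p : S p -> log_mass p = \sum_i `|ln (p 0 i)|.
Proof. by move=> sp; rewrite /log_mass patchE mem_set. Qed.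

Lemma log_mass_ge0 p : 0 <= log_mass p.
Proof.
rewrite /log_mass patchE; case: ifP => _; last exact: lexx.
by apply: sumr_ge0.
Qed.

Lemma measurable_log_coord (i : 'I_n) : measurable_fun [set: V] (fun p : V => `|ln (p 0 i)|).
Proof.
apply: (measurableT_comp (@normr_measurable R setT)).
by apply: (measurableT_comp (@measurable_ln R)); exact: measurable_coord.
Qed.

Lemma measurable_log_mass : measurable_fun [set: V] log_mass.
Proof.
apply: (iffLR (measurable_restrictT _ (@measurable_simplex R n))).
by apply: measurable_funTS; apply: measurable_sum => i; exact: measurable_log_coord.
Qed.

Lemma integrable_log_mass (P : probability V R) :
  (\sum_(i < n) \int[P]_(p in S) `|ln (p 0%R i)|%:E < +oo)%E ->
  P.-integrable [set: V] (EFin \o log_mass).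
Proof.
move=> hP; apply/integrableP; split; first by apply/measurable_EFinP; exact: measurable_log_mass.
rewrite (_ : (\int[P]_x _)%E = (\sum_(i < n) \int[P]_(p in S) `|ln (p 0%R i)|%:E)%E) //.
have mS := @measurable_simplex R n.
rewrite -ge0_integral_sum //; first last.
- by move=> i; apply/measurable_EFinP/measurable_funTS; exact: measurable_log_coord.
rewrite [RHS]integral_mkcond; apply: eq_integral => x _.
rewrite gee0_abs ?lee_fin ?log_mass_ge0 // patchE /= /log_mass patchE.
by case: ifP => // _; rewrite sumEFin.
Qed.

Lemma simplex_lt1 p i : S p -> p 0 i < 1.
Proof. by case=> /(_ i) /andP[]. Qed.

(** On the simplex q_i / p_i <= 1 / p_i, and the sum of the q_i / p_i is at
    least 1. *)
Lemma cost_abs_le p q : S p -> S q ->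
  `|cost p q| <= ln n%:R + 2 * log_mass p + log_mass q.
Proof.
move=> sp sq; rewrite !log_massE //.
have n0 := simplex_dim_gt0 sp.
have nR : 0 < n%:R :> R by rewrite ltr0n.
have n1 : 1 <= n%:R :> R by rewrite ler1n.
pose a := \sum_i `|ln (p 0 i)|; pose b := \sum_i `|ln (q 0 i)|.
have p0 i : 0 < p 0 i by exact: simplex_gt0.
have q0 i : 0 < q 0 i by exact: simplex_gt0.
have a0 : 0 <= a by apply: sumr_ge0.
have b0 : 0 <= b by apply: sumr_ge0.
have S0 := sum_ratio_gt0 sp sq.
have lo : 1 <= \sum_i q 0 i / p 0 i.
  case: (sq) => _ <-; apply: ler_sum => i _.
  by rewrite ler_pdivlMr // ler_piMr ?(ltW (q0 i)) // ltW // simplex_lt1.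
have hi : n%:R^-1 * \sum_i q 0 i / p 0 i <= expR a.
  rewrite ler_pdivrMl // mulr_natl -[in leRHS](card_ord n) -sumr_const.
  apply: ler_sum => i _; rewrite ler_pdivrMr //.
  apply: le_trans (ltW (simplex_lt1 i sq)) _.
  rewrite -ler_pdivrMr // mul1r -[X in X^-1](lnK (p0 i)) -expRN ler_expR.
  apply: le_trans (ler_norm _) _; rewrite normrN /a (bigD1 i) //= lerDl.
  by apply: sumr_ge0.
have l1 : `|ln (n%:R^-1 * \sum_i q 0 i / p 0 i)| <= ln n%:R + a.
  have t0 : 0 < n%:R^-1 * \sum_i q 0 i / p 0 i by rewrite mulr_gt0 ?invr_gt0.
  have lnn : 0 <= ln n%:R :> R by rewrite ln_ge0.
  have u : ln (n%:R^-1 * \sum_i q 0 i / p 0 i) <= a.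
    by rewrite -[leRHS]expRK ler_ln ?posrE ?expR_gt0.
  have v : - ln n%:R <= ln (n%:R^-1 * \sum_i q 0 i / p 0 i).
    by rewrite lnM ?posrE ?invr_gt0 // lnV ?posrE // lerDl ln_ge0.
  by rewrite ler_norml; apply/andP; split; lra.
have l2 : `|n%:R^-1 * \sum_i ln (q 0 i / p 0 i)| <= a + b.
  rewrite normrM ger0_norm ?invr_ge0 ?(ltW nR) // ler_pdivrMl //.
  apply: le_trans (_ : _ <= a + b) _; last by rewrite ler_peMl // addr_ge0.
  apply: le_trans (ler_norm_sum _ _ _) _; rewrite /a /b -big_split /=.
  apply: ler_sum => i _; rewrite lnM ?posrE ?invr_gt0 // lnV ?posrE // addrC.
  by apply: le_trans (ler_normD _ _) _; rewrite normrN.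
apply: le_trans (ler_normB _ _) _; rewrite -/a -/b; lra.
Qed.

Lemma entropy_potential_abs_le (phi : V -> R) C q : S q -> `|phi q| <= C ->
  `|entropy_potential phi q| <= C + log_mass q.
Proof.
move=> sq hC; rewrite log_massE //; have n0 := simplex_dim_gt0 sq.
have nR : 0 < n%:R :> R by rewrite ltr0n.
have n1 : 1 <= n%:R :> R by rewrite ler1n.
apply: le_trans (ler_normB _ _) _; apply: lerD => //.
rewrite normrM ger0_norm ?invr_ge0 ?(ltW nR) // ler_pdivrMl //.
apply: le_trans (ler_norm_sum _ _ _) _.
by rewrite ler_peMl // sumr_ge0.
Qed.

Lemma measurable_entropy_potential (phi : V -> R) : {within S, continuous phi} ->
  measurable_fun S (entropy_potential phi).
Proof.
move=> cphi; apply: measurable_funB.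
  exact: within_continuous_measurable (@measurable_simplex R n) cphi.
apply: measurable_funTS; apply: measurable_funM => //; apply: measurable_sum => i.
by apply: (measurableT_comp (@measurable_ln R)); exact: measurable_coord.
Qed.

Lemma measurable_eq_rV (f g : V -> V) : measurable_fun [set: V] f ->
  measurable_fun [set: V] g -> measurable [set p | f p = g p].
Proof.
move=> mf mg.
rewrite (_ : [set _ | _] = \bigcap_(i in [set: 'I_n])
    ((fun p => f p 0 i - g p 0 i) @^-1` [set 0])).
  apply: fin_bigcap_measurable => // i _.
  have m : measurable_fun [set: V] (fun p => f p 0 i - g p 0 i).
    by apply: measurable_funB; apply: (measurableT_comp (measurable_coord i)).
  by rewrite -[X in measurable X]setTI; apply: m.
apply/seteqP; split=> p /= h; first by move=> i _ /=; rewrite h subrr.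
by apply/rowP => i; apply/eqP; rewrite -subr_eq0; apply/eqP; exact: h.
Qed.
End log_bound.

(** * Identification of the optimal Monge coupling *)

Section identification.
Variables (R : realType) (n : nat).
Hypothesis n_ge2 : (2 <= n)%N.
Local Notation V := 'rV[R]_n.
Local Notation S := (@simplex R n).
Variables (P0 P1 : probability V R) (phi : V -> R).
Hypotheses (P0_La : class_La P0) (P1_La : class_La P1).
Hypothesis phi_concave : exp_concave phi.
Hypothesis phi_optimal : optimal_map (pushforward P1 sinv) (pushforward P0 sinv)
  (fun s => sop s (portfolio phi (sinv s))).
Hypothesis phi_C2 : C2_simplex phi.
Variables (alpha alpha' : R).
Hypotheses (alpha_gt0 : 0 < alpha) (alpha'_gt0 : 0 < alpha').
Hypothesis Ldiv_bounds : forall q q' : V, simplex q -> simplex q' ->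
  alpha * l2norm (q' - q) ^+ 2 <= Ldiv phi q' q <= alpha' * l2norm (q' - q) ^+ 2.

Let mS := @measurable_simplex R n.
Let P0S : P0 S = 1%E. Proof. by case: P0_La. Qed.
Let P1S : P1 S = 1%E. Proof. by case: P1_La. Qed.

Let dphi w s : tangent w -> simplex s -> derivable phi s w.
Proof. by case: phi_C2 => _ h tw ss; have [d _ _] := h w tw; exact: d. Qed.

(** The inverse, in the group of the simplex, of the source of the target q.
    All maps are extended by 0 outside the simplex so as to be measurable on
    the whole space. *)
Let tq : V -> V := (fun q => sop (sinv q) (portfolio phi (sinv (sinv q)))) \_ S.

Let tqE q : S q -> tq q = sop (sinv q) (portfolio phi q).
Proof. by move=> sq; rewrite /tq patchE mem_set // sinvK. Qed.

Let measurable_tq : measurable_fun [set: V] tq.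
Proof.
have [P [mT _] _] := phi_optimal.
apply: (iffLR (measurable_restrictT _ mS)).
apply: (measurable_comp mS _ mT); last exact: measurable_funTS (@measurable_sinv R n).
by move=> _ [q sq <-]; exact: sinv_simplex.
Qed.

Let law_tq (B : set V) : measurable B -> P0 (sinv @^-1` B) = P1 (tq @^-1` B).
Proof.
move=> mB; have [P [mT hP] [[_ c2] _]] := phi_optimal.
have mtB : measurable (tq @^-1` B) by rewrite -[X in measurable X]setTI; exact: measurable_tq.
have -> : P0 (sinv @^-1` B) = pushforward P snd B by rewrite c2.
have mB' : measurable ((snd : V * V -> V) @^-1` B).
  by rewrite -[X in measurable X]setTI; exact: measurable_snd.
have mSB : measurable (S `&` [set s | B (sop s (portfolio phi (sinv s)))]) by exact: mT.
rewrite /pushforward hP // /pushforward.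
rewrite -[LHS](prob_setI1 _ mS P1S); last first.
  by rewrite -[X in measurable X]setTI; exact: measurable_sinv.
rewrite -[RHS](prob_setI1 _ mS P1S) //; congr (P1 _).
apply/seteqP; split=> q /= [h sq]; split=> //.
  by case: h => _; rewrite tqE // sinvK.
by split; [exact: sinv_simplex|move: h; rewrite tqE // sinvK].
Qed.

(** The source of the target q.  Pulled back to P1, the law P0 of the sources
    makes the two couplings functions of the single variable q. *)
Let ps q := sinv (tq q).

Let measurable_ps : measurable_fun [set: V] ps.
Proof. by apply: (measurableT_comp (@measurable_sinv R n)); exact: measurable_tq. Qed.

Let law_ps (A : set V) : measurable A -> P0 A = P1 (ps @^-1` A).
Proof.
move=> mA; have mA' : measurable (sinv @^-1` A).
  by rewrite -[X in measurable X]setTI; exact: measurable_sinv.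
have mA2 : measurable (sinv @^-1` (sinv @^-1` A) : set V).
  by rewrite -[X in measurable X]setTI; exact: measurable_sinv.
rewrite -[RHS](law_tq mA') -[LHS](prob_setI1 _ mS P0S) // -[RHS](prob_setI1 _ mS P0S) //.
by congr (P0 _); apply/seteqP; split=> p /= [h sp]; split=> //; move: h; rewrite /= sinvK.
Qed.

Let tq_simplex : P1 (tq @^-1` S) = 1%E.
Proof.
have mS' : measurable (sinv @^-1` S : set V).
  by rewrite -[X in measurable X]setTI; exact: measurable_sinv.
rewrite -law_tq //; apply/eqP; rewrite eq_le probability_le1 //= -[leLHS]P0S.
rewrite le_measure ?inE // => p sp; exact: sinv_simplex.
Qed.

Let transported_ps q : S q -> S (tq q) -> transported phi (ps q) q.
Proof.
move=> sq st; split=> //; first exact: sinv_simplex.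
by rewrite /ps sinvK // tqE.
Qed.

Let bounded_phi : exists C : R, forall q, S q -> `|phi q| <= C.
Proof.
have mt : measurable (tq @^-1` S) by rewrite -[X in measurable X]setTI; exact: measurable_tq.
have h : P1 (tq @^-1` S `&` S) = 1%E by rewrite prob_setI1 // tq_simplex.
have [q0 [st sq]] : (tq @^-1` S `&` S) !=set0.
  apply/set0P/negP => /eqP e; move: h; rewrite e measure0 => /eqP.
  by rewrite eq_sym onee_eq0.
have [C hC] := phi_bounded phi_concave (@dphi) alpha_gt0 alpha'_gt0 Ldiv_bounds (transported_ps sq st). by exists C.
Qed.

Variables (Rstar : probability (V * V)%type R).
Hypothesis Rstar_optimal : optimal_coupling P0 P1 Rstar.
Variable T : V -> V.
Hypothesis Rstar_monge : monge_coupling P0 T Rstar.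

Let T' : V -> V := T \_ S.

Let measurable_T' : measurable_fun [set: V] T'.
Proof.
by apply: (iffLR (measurable_restrictT _ mS)); case: Rstar_monge.
Qed.

Let measurable_graph : measurable_fun [set: V] (fun p => (p, T' p)).
Proof. by apply: measurable_fun_pair => //; exact: measurable_T'. Qed.

Let law_Rstar A : measurable A -> Rstar A = P0 [set p | A (p, T' p)].
Proof.
move=> mA; case: Rstar_monge => mT -> //.
rewrite -[RHS](prob_setI1 _ mS P0S); last first.
  by rewrite -[X in measurable X]setTI; apply: measurable_graph.
have T'E p : S p -> T' p = T p by move=> sp; rewrite /T' patchE mem_set.
congr (P0 _); apply/seteqP; split=> p /=.
  by case=> sp h; split=> //; rewrite T'E.
by case=> h sp; split=> //; rewrite T'E in h.
Qed.

Let law_T' B : measurable B -> P1 B = P0 (T' @^-1` B).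
Proof.
move=> mB; case: Rstar_optimal => [[_ c2] _]; rewrite -c2 // /pushforward.
rewrite law_Rstar //.
by rewrite -[X in measurable X]setTI; exact: measurable_snd.
Qed.

(** [U] has the law R*, and [W] the law of a competitor. *)
Let U q : V * V := (ps q, T' (ps q)).
Let W q : V * V := (ps q, q).

Let measurable_T'ps : measurable_fun [set: V] (T' \o ps).
Proof. by apply: measurableT_comp; [exact: measurable_T'|exact: measurable_ps]. Qed.

Let measurable_U : measurable_fun [set: V] U.
Proof. by apply: measurable_fun_pair; [exact: measurable_ps|exact: measurable_T'ps]. Qed.

Let measurable_W : measurable_fun [set: V] W.
Proof. by apply: measurable_fun_pair; [exact: measurable_ps|]. Qed.

Let law_U A : measurable A -> Rstar A = P1 (U @^-1` A).
Proof.
move=> mA; rewrite law_Rstar // law_ps //.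
by rewrite -[X in measurable X]setTI; apply: measurable_graph.
Qed.

Let law_T'ps B : measurable B -> P1 B = P1 ((T' \o ps) @^-1` B).
Proof.
move=> mB; rewrite [LHS](law_T' mB) law_ps //.
by rewrite -[X in measurable X]setTI; exact: measurable_T'.
Qed.

Let image_W_mass : image_measure P1 measurable_W setT = 1%E.
Proof. exact: (@probability_setT _ _ _ P1). Qed.

Let R' : probability (V * V)%type R := mass_one image_W_mass.

Let coupling_R' : coupling P0 P1 R'.
Proof. by split=> A mA //; rewrite [RHS]law_ps. Qed.

Let S2 := @simplex2 R n.
Let costS : V * V -> R := (fun z => cost z.1 z.2) \_ S2.
Let potS : V -> R := (entropy_potential phi) \_ S.

Let costSE p q : S p -> S q -> costS (p, q) = cost p q.
Proof. by move=> sp sq; rewrite /costS patchE mem_set. Qed.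

Let measurable_costS : measurable_fun [set: (V * V)%type] costS.
Proof.
apply: (iffLR (measurable_restrictT _ (@measurable_simplex2 R n))).
exact: measurable_funTS (@measurable_cost R n).
Qed.

Let measurable_potS : measurable_fun [set: V] potS.
Proof.
apply: (iffLR (measurable_restrictT _ mS)).
by apply: measurable_entropy_potential; case: phi_C2.
Qed.

Let costS_abs_le z : `|costS z| <= ln n%:R + 2 * log_mass z.1 + log_mass z.2.
Proof.
rewrite /costS patchE; case: ifPn => [/set_mem [s1 s2]|_]; first exact: cost_abs_le.
rewrite normr0 !addr_ge0 ?mulr_ge0 ?log_mass_ge0 //.
by rewrite ln_ge0 // ler1n (leq_trans _ n_ge2).
Qed.

Let int_log0 : P1.-integrable [set: V] (EFin \o (@log_mass R n \o ps)).
Proof.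
apply: (integrable_law measurable_ps (@law_ps)); first exact: log_mass_ge0.
by apply: integrable_log_mass; case: P0_La.
Qed.

Let int_log1 : P1.-integrable [set: V] (EFin \o @log_mass R n).
Proof. by apply: integrable_log_mass; case: P1_La. Qed.

Let int_logT : P1.-integrable [set: V] (EFin \o (@log_mass R n \o (T' \o ps))).
Proof. by apply: (integrable_law measurable_T'ps (@law_T'ps)); [exact: log_mass_ge0|]. Qed.

Let int_dominated (f : V -> R) (c : R) (g : V -> R) : measurable_fun [set: V] f ->
  (forall q, 0 <= g q) -> P1.-integrable [set: V] (EFin \o g) ->
  (forall q, `|f q| <= c + g q) -> P1.-integrable [set: V] (EFin \o f).
Proof.
move=> mf g0 ig fg.
have ic : P1.-integrable [set: V] (fun q => ((EFin \o cst c) q + (EFin \o g) q)%E).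
  by apply: integrableD => //; exact: finite_measure_integrable_cst.
apply: le_integrable ic => //; first exact/measurable_EFinP.
move=> q _ /=; rewrite lee_fin; apply: le_trans (fg q) _; exact: ler_norm.
Qed.

Let int_cost (Z : V -> V) : measurable_fun [set: V] Z ->
  P1.-integrable [set: V] (EFin \o (@log_mass R n \o Z)) ->
  P1.-integrable [set: V] (EFin \o (fun q => costS (ps q, Z q))).
Proof.
move=> mZ iZ.
pose g q := 2 * log_mass (ps q) + log_mass (Z q).
apply: (@int_dominated _ (ln n%:R) g).
- apply: (measurableT_comp measurable_costS).
  by apply: measurable_fun_pair; [exact: measurable_ps|].
- by move=> q; rewrite addr_ge0 ?mulr_ge0 ?log_mass_ge0.
- have i2 : P1.-integrable [set: V] (fun q => 2%:E * (EFin \o (@log_mass R n \o ps)) q)%E.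
    exact: integrableZl.
  rewrite (_ : EFin \o g = (fun q => 2%:E * (EFin \o (@log_mass R n \o ps)) q)
    \+ (EFin \o (@log_mass R n \o Z)))%E //.
  exact: (integrableD measurableT i2 iZ).
- by move=> q; rewrite addrA; exact: costS_abs_le.
Qed.

Let int_pot : P1.-integrable [set: V] (EFin \o potS).
Proof.
have [C hC] := bounded_phi; apply: (@int_dominated _ `|C| (@log_mass R n)) => //.
  exact: log_mass_ge0.
move=> q; rewrite /potS patchE; case: ifPn => [/set_mem sq|_].
  apply: le_trans (entropy_potential_abs_le sq (hC q sq)) _.
  by rewrite lerD2r ler_norm.
by rewrite normr0 addr_ge0 ?log_mass_ge0.
Qed.

Let int_potT : P1.-integrable [set: V] (EFin \o (potS \o (T' \o ps))).
Proof.
have [C hC] := bounded_phi; apply: (@int_dominated _ `|C| (@log_mass R n \o (T' \o ps))) => //.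
- by apply: measurableT_comp.
- by move=> q; exact: log_mass_ge0.
move=> q; rewrite /potS /= patchE; case: ifPn => [/set_mem sq|_].
  apply: le_trans (entropy_potential_abs_le sq (hC _ sq)) _.
  by rewrite lerD2r ler_norm.
by rewrite normr0 addr_ge0 ?log_mass_ge0.
Qed.

(** By the cost identity with base point q, the difference of the two costs,
    corrected by the potential, is the L-divergence D[T'(ps q) : q].  The
    potentials have equal integrals since T'(ps q) and q have the same law. *)
Let gap q := costS (U q) - costS (W q) - potS (T' (ps q)) + potS q.

Let int_U : P1.-integrable [set: V] (EFin \o (costS \o U)).
Proof. exact: int_cost measurable_T'ps int_logT. Qed.

Let int_W : P1.-integrable [set: V] (EFin \o (costS \o W)).
Proof. exact: (int_cost (@measurable_id _ _ _) int_log1). Qed.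

Let int_gap : P1.-integrable [set: V] (EFin \o gap).
Proof.
rewrite (_ : EFin \o gap = (fun q => ((EFin \o (costS \o U)) q -
   (EFin \o (costS \o W)) q - (EFin \o (potS \o (T' \o ps))) q + (EFin \o potS) q)%E)) //.
by apply: integrableD => //; apply: integrableB => //; exact: integrableB.
Qed.

Let integral_restrict (Q : probability (V * V)%type R) :
  (\int[Q]_(z in S `*` S) (cost z.1 z.2)%:E = \int[Q]_z (costS z)%:E)%E.
Proof.
rewrite integral_mkcond; apply: eq_integral => z _.
by rewrite /costS !patchE; case: ifP.
Qed.

Let integral_gap_le0 : (\int[P1]_q (gap q)%:E <= 0)%E.
Proof.
have := Rstar_optimal.2 _ coupling_R'.
rewrite !integral_restrict (integral_law measurable_U (@law_U)) //.
have law_W A : measurable A -> R' A = P1 (W @^-1` A) by [].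
rewrite (integral_law measurable_W law_W) // => le_UW.
have pot_eq := integral_law measurable_T'ps (@law_T'ps) measurable_potS int_potT.
pose f1 q := costS (U q) - costS (W q).
pose f2 q := f1 q - potS (T' (ps q)).
have if1 : P1.-integrable [set: V] (EFin \o f1) by exact: (integrableB measurableT int_U int_W).
have if2 : P1.-integrable [set: V] (EFin \o f2) by exact: (integrableB measurableT if1 int_potT).
have e1 := integralB_EFin measurableT int_U int_W.
have e2 := integralB_EFin measurableT if1 int_potT.
have e3 := integralD_EFin measurableT if2 int_pot.
have -> : (\int[P1]_q (gap q)%:E = \int[P1]_q (costS (U q))%:E -
    \int[P1]_q (costS (W q))%:E - \int[P1]_q (potS (T' (ps q)))%:E +
    \int[P1]_q (potS q)%:E)%E.
  rewrite (_ : (\int[P1]_q (gap q)%:E)%E =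
    (\int[P1]_q ((EFin \o f2) q + (EFin \o potS) q))%E) // e3.
  rewrite (_ : (\int[P1]_q (EFin \o f2) q)%E =
    (\int[P1]_q ((f1 q)%:E - (potS (T' (ps q)))%:E))%E) // e2.
  by rewrite (_ : (\int[P1]_q (f1 q)%:E)%E =
    (\int[P1]_q ((costS (U q))%:E - (costS (W q))%:E))%E) // e1.
have fU := integrable_fin_num measurableT int_U.
have fW := integrable_fin_num measurableT int_W.
have fp := integrable_fin_num measurableT int_pot.
rewrite -pot_eq /= subeK //.
by rewrite leeBlDr // add0e.
Qed.

Let good : set V := [set q | [/\ S q, S (tq q) & S (T' (ps q))]].

Let ae_good : {ae P1, forall q, good q}.
Proof.
have mt : measurable (tq @^-1` S) by rewrite -[X in measurable X]setTI; exact: measurable_tq.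
have mT : measurable ((T' \o ps) @^-1` S).
  by rewrite -[X in measurable X]setTI; exact: measurable_T'ps.
have h1 := prob1_ae mS P1S; have h2 := prob1_ae mt tq_simplex.
have h3 : {ae P1, forall q, ((T' \o ps) @^-1` S) q}.
  by apply: prob1_ae => //; rewrite -law_T'ps.
by move: h1 h2 h3; apply: filterS3 => q a b c.
Qed.

Let gap_ge q : good q -> alpha * l2norm (T' (ps q) - q) ^+ 2 <= gap q.
Proof.
move=> [sq st sT]; have tr := transported_ps sq st; have [sp _ _] := tr.
rewrite /gap /U /W !costSE // /potS !patchE !mem_set //.
rewrite (cost_transported phi_concave (@dphi) tr sT).
have /andP[h _] := Ldiv_bounds sq sT; apply: le_trans h _; lra.
Qed.

(** A nonnegative gap whose integral is at most 0 vanishes almost surely, and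
    the lower bound on the L-divergence turns this into an equality of
    points. *)
Let ae_T'ps : {ae P1, forall q, good q /\ T' (ps q) = q}.
Proof.
have g0 : {ae P1, forall q, 0 <= gap q}.
  apply: (filterS _ ae_good) => q gq; apply: le_trans (gap_ge gq).
  by rewrite mulr_ge0 ?sqr_ge0 // ltW.
have := ae_eq0_of_integral_le0 int_gap g0 integral_gap_le0.
move: ae_good; apply: filterS2 => q gq zq; split=> //.
have := gap_ge gq; rewrite zq pmulr_rle0 // l2norm_sqr => le0.
apply/rowP => i; apply/eqP; rewrite -subr_eq0 -sqrf_eq0 eq_le sqr_ge0 andbT.
apply: le_trans le0; rewrite (bigD1 i) //= !mxE lerDl.
by apply: sumr_ge0 => j _; exact: sqr_ge0.
Qed.

(** The set where the map of R* inverts the given optimal map is described by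
    an equation between measurable maps, which gives it full measure as soon as
    it contains almost every ps q. *)
Lemma monge_transported : exists (F : V -> V) (A : set V),
  [/\ measurable_fun [set: V] F, measurable A, P0 A = 1%E,
      forall p, A p -> transported phi p (F p)
    & forall B, measurable B -> Rstar B = P0 [set p | B (p, F p)]].
Proof.
pose A := S `&` (T' @^-1` S) `&` [set p | sinv p = (tq \o T') p].
have mA : measurable A.
  apply: measurableI; first apply: measurableI => //.
    by rewrite -[X in measurable X]setTI; exact: measurable_T'.
  apply: measurable_eq_rV; first exact: measurable_sinv.
  by apply: measurableT_comp; [exact: measurable_tq|exact: measurable_T'].
exists T', A; split=> //.
- rewrite law_ps //; apply: ae_prob1.
    by rewrite -[X in measurable X]setTI; exact: measurable_ps.
  apply: (filterS _ ae_T'ps) => q [[sq st sT] e].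
  split; first split => //=; first exact: sinv_simplex.
  by rewrite /= e /ps sinvK.
- by move=> p [[sp sT] /= e]; split=> //; rewrite e tqE.
Qed.
End identification.

(** * Convergence of the particle coupling *)

Section families_of_variables.
Context d (Om : measurableType d) d' (T : measurableType d') (R : realType).
Variable PP : probability Om R.

Lemma mutually_independent_comp (I J : choiceType) (Z : J -> {RV PP >-> T})
    (f : I -> J) (g : J -> option I) : pcancel f g ->
  mutually_independent Z -> mutually_independent (fun i => Z (f i)).
Proof.
move=> fK indZ s A us mA.
pose A' k := if g k is Some i then A i else setT.
have A'E i : A' (f i) = A i by rewrite /A' fK.
have us' : uniq (map f s) by rewrite map_inj_uniq //; exact: pcan_inj fK.
have mA' k : measurable (A' k) by rewrite /A'; case: (g k).
have := indZ _ _ us' mA'; rewrite big_map; under eq_bigr do rewrite A'E.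
move=> <-; congr (PP _).
apply/seteqP; split=> w h k /= ks.
  by case/mapP: ks => i si ->; rewrite A'E; exact: h.
by rewrite -A'E; apply: h; apply/mapP; exists k.
Qed.

Lemma ae_forall_nat (Q : nat -> set Om) :
  (forall k, {ae PP, forall w, Q k w}) -> {ae PP, forall w, forall k, Q k w}.
Proof.
move=> h; have := @negligible_bigcup _ _ _ PP (fun k => ~` Q k) h.
by apply: negligibleS => w /= /existsNP [k nk]; exists k.
Qed.

Lemma ae_law (Z : {RV PP >-> T}) (mu : probability T R) (A : set T) : has_law Z mu ->
  measurable A -> mu A = 1%E -> {ae PP, forall w, A (Z w)}.
Proof.
move=> lZ mA muA; apply: (@prob1_ae _ _ _ PP (Z @^-1` A)).
  by rewrite -[X in measurable X]setTI; exact: measurable_funPT.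
by have := lZ A mA; rewrite muA.
Qed.
End families_of_variables.

Theorem theorem3 (R : realType) (n : nat) (n_ge2 : (2 <= n)%N)
    (P0 P1 : probability 'rV[R]_n R)
    (P0_La : class_La P0) (P1_La : class_La P1)
    (phi : 'rV[R]_n -> R)
    (phi_concave : exp_concave phi)
    (phi_optimal : optimal_map (pushforward P1 sinv) (pushforward P0 sinv)
       (fun s => sop s (portfolio phi (sinv s))))
    (phi_C2 : C2_simplex phi)
    (alpha alpha' : R) (alpha_gt0 : 0 < alpha) (alpha'_gt0 : 0 < alpha')
    (Ldiv_bounds : forall q q' : 'rV[R]_n, simplex q -> simplex q' ->
       alpha * l2norm (q' - q) ^+ 2 <= Ldiv phi q' q
         <= alpha' * l2norm (q' - q) ^+ 2)
    (Rstar : probability ('rV[R]_n * 'rV[R]_n)%type R)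
    (Rstar_optimal : optimal_coupling P0 P1 Rstar)
    (Rstar_monge : exists T, monge_coupling P0 T Rstar)
    (d : measure_display) (Om : measurableType d) (PP : probability Om R)
    (p q : nat -> {RV PP >-> 'rV[R]_n})
    (p_law : forall k, has_law (p k) P0)
    (q_law : forall k, has_law (q k) P1)
    (pq_indep : mutually_independent (join_families p q)) :
  let lambda (N : nat) : R := 4 / alpha * N%:R `^ (2 / n%:R) in
  {ae PP, forall w, exists C : R, \forall N \near \oo,
    (W2 (@M_N R n N (p ^~ w) (q ^~ w) (lambda N)) Rstar ^+ 2
      <= (C * (N%:R `^ (- n%:R^-1) * ln N%:R))%:E)%E}.
Proof.
move=> lambda; have [T Tmonge] := Rstar_monge.
have [F [A [mF mA P0A trA RstarE]]] := monge_transported n_ge2 P0_La P1_La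
  phi_concave phi_optimal phi_C2 alpha_gt0 alpha'_gt0 Ldiv_bounds Rstar_optimal Tmonge.
have dphi w s : tangent w -> simplex s -> derivable phi s w.
  by case: phi_C2 => _ h tw ss; have [dd _ _] := h w tw; exact: dd.
have nR : 0 < n%:R :> R by rewrite ltr0n (leq_trans _ n_ge2).
have P1E B : measurable B -> P1 B = P0 (F @^-1` B).
  move=> mB; case: (Rstar_optimal) => [[_ c2] _]; rewrite -c2 // /pushforward RstarE //.
  by rewrite -[X in measurable X]setTI; exact: measurable_snd.
have mgraph : measurable_fun [set: 'rV[R]_n] (fun v => (v, F v)).
  exact: measurable_fun_pair.
have Rstar1 : Rstar (@simplex2 R n) = 1%E.
  have mS2 := @measurable_simplex2 R n.
  apply/eqP; rewrite eq_le probability_le1 //= RstarE // -[leLHS]P0A.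
  apply: le_measure; rewrite ?inE //.
    by rewrite -[X in measurable X]setTI; exact: mgraph.
  by move=> v /trA [].
pose pc l v := pair_cell l (v, F v).
have mpc l k : measurable (pc l @^-1` [set k]).
  rewrite -[X in measurable X]setTI.
  exact: (mgraph measurableT _ (@measurable_pair_cell R n l k)).
have mfc l k : measurable ((fun v => cell l (F v)) @^-1` [set k]).
  by rewrite -[X in measurable X]setTI; exact: (mF measurableT _ (@measurable_cell R n l k)).
(* a common radius for the cells of points and those of pairs *)
pose rad (N l : nat) : R := Num.sqrt (32 / N%:R * ((2 ^ (2 * n * l))%:R + 3 * ln N%:R)).
pose devA N w l := \sum_k `|freq R (fun i : 'I_N => pc l (p i w)) k -
  fine (P0 (pc l @^-1` [set k]))|.
pose devB N w l := \sum_k `|freq R (fun i : 'I_N => cell l (F (p i w))) k -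
  fine (P0 ((fun v => cell l (F v)) @^-1` [set k]))|.
pose devC N w l := \sum_k `|freq R (fun i : 'I_N => cell l (q i w)) k -
  fine (P1 (cell l @^-1` [set k]))|.
have radS N l (m : nat) : (0 < N)%N -> (m <= 2 ^ (2 * n * l))%N ->
    Num.sqrt (32 / N%:R * (m%:R + 3 * ln N%:R)) <= rad N l.
  move=> N0 hm; have N1 : 1 <= N%:R :> R by rewrite ler1n.
  rewrite ler_sqrt; last first.
    by rewrite mulr_ge0 ?divr_ge0 // addr_ge0 // mulr_ge0 // ln_ge0.
  by rewrite ler_wpM2l ?divr_ge0 // lerD2r ler_nat.
have ln2 l : (2 ^ (l * n) <= 2 ^ (2 * n * l))%N.
  by rewrite leq_exp2l // mulnC leq_mul2r orbC mul2n -addnn leq_addr.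
have indp : mutually_independent p.
  pose g (k : nat + nat) := if k is inl i then Some i else None.
  exact: (mutually_independent_comp (g := g) (f := inl)) pq_indep.
have indq : mutually_independent q.
  pose g (k : nat + nat) := if k is inr i then Some i else None.
  exact: (mutually_independent_comp (g := g) (f := inr)) pq_indep.
have tvA : {ae PP, forall w, \forall N \near \oo, forall l, (l <= N)%N -> (0 < N)%N ->
    devA N w l <= rad N l}.
  apply: filterS (empirical_tv_ae p_law indp mpc) => w; apply: filterS => N h l lN N0.
  by apply: le_trans (h l lN) _; apply: radS => //; rewrite card_pair_cells.
have tvB : {ae PP, forall w, \forall N \near \oo, forall l, (l <= N)%N -> (0 < N)%N ->
    devB N w l <= rad N l}.
  apply: filterS (empirical_tv_ae p_law indp mfc) => w; apply: filterS => N h l lN N0.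
  by apply: le_trans (h l lN) _; apply: radS => //; rewrite card_cells.
have tvC : {ae PP, forall w, \forall N \near \oo, forall l, (l <= N)%N -> (0 < N)%N ->
    devC N w l <= rad N l}.
  apply: filterS (empirical_tv_ae q_law indq (@measurable_cell R n)) => w.
  apply: filterS => N h l lN N0.
  by apply: le_trans (h l lN) _; apply: radS => //; rewrite card_cells.
have aeA : {ae PP, forall w, forall k, A (p k w)}.
  by apply: ae_forall_nat => k; exact: ae_law (p_law k) mA P0A.
have aeS : {ae PP, forall w, forall k, simplex (q k w)}.
  have P1S : P1 simplex = 1%E by case: P1_La.
  by apply: ae_forall_nat => k; exact: ae_law (q_law k) (@measurable_simplex R n) P1S.
have aeAS : {ae PP, forall w, (forall k, A (p k w)) /\ (forall k, simplex (q k w))}.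
  by move: aeA aeS; apply: filterS2.
have ae_all : {ae PP, forall w, ((forall k, A (p k w)) /\ (forall k, simplex (q k w))) /\
    (\forall N \near \oo, forall l, (l <= N)%N -> (0 < N)%N ->
      [/\ devA N w l <= rad N l, devB N w l <= rad N l & devC N w l <= rad N l])}.
  have tvAB : {ae PP, forall w, \forall N \near \oo, forall l, (l <= N)%N -> (0 < N)%N ->
      devA N w l <= rad N l /\ devB N w l <= rad N l}.
    move: tvA tvB; apply: filterS2 => w; apply: filterS2 => N h1 h2 l lN N0.
    by split; [exact: h1|exact: h2].
  move: aeAS tvAB tvC; apply: filterS3 => w h; move=> h1 h2; split=> //.
  move: h1 h2; apply: filterS2 => N h1 h2 l lN N0.
  by have [a b] := h1 l lN N0; split=> //; exact: h2.
move: ae_all; apply: filterS => w [[pA qS] tv].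
(* 228 = 4 + 112 * 2 and 116 = 4 + 112: two samples deviate from each other by
   at most twice the radius, a sample deviates from its law by the radius *)
pose C : R := 2 / alpha * (alpha' * (n%:R * 228) + alpha / 4) + 4 * n%:R * 116.
exists C; near=> N.
have N4 : (4 <= N)%N by near: N; exact: nbhs_infty_ge.
have N0 : (0 < N)%N by exact: leq_trans N4.
have dev l : (l <= N)%N ->
    [/\ devA N w l <= rad N l, devB N w l <= rad N l & devC N w l <= rad N l].
  move=> lN; have : forall l, (l <= N)%N -> (0 < N)%N ->
    [/\ devA N w l <= rad N l, devB N w l <= rad N l & devC N w l <= rad N l].
    by near: N; exact: tv.
  by apply.
have NR : 0 < N%:R :> R by rewrite ltr0n.
have N1 : 1 <= N%:R :> R by rewrite ler1n.
have lnN : 0 <= ln N%:R :> R by rewrite ln_ge0.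
have lam0 : 0 < lambda N by rewrite /lambda mulr_gt0 ?divr_gt0 ?powR_gt0.
pose qs i := F (p i w).
have tr (i : 'I_N) : transported phi (p i w) (qs i) by apply: trA; exact: pA.
pose L := trunc_log (2 ^ (2 * n)) N.
pose d1 l := \sum_k `|freq R (fun i : 'I_N => cell l (qs i)) k -
          freq R (fun i : 'I_N => cell l (q i w)) k|.
pose d2 l := \sum_k `|freq R (fun i : 'I_N => pair_cell l (p i w, qs i)) k -
          fine (Rstar (pair_cell l @^-1` [set k]))|.
have d2E l : d2 l = devA N w l.
  apply: eq_bigr => k _; rewrite RstarE //; exact: measurable_pair_cell.
(* both samples are compared with their common law *)
have d1le l : d1 l <= devB N w l + devC N w l.
  rewrite /d1 /devB /devC -big_split /=; apply: ler_sum => k _.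
  rewrite P1E; last exact: measurable_cell.
  set a := freq _ _ k; set b := fine _; set c := freq _ _ k.
  by rewrite (_ : a - c = (a - b) - (c - b)); [exact: ler_normB|ring].
set y := N%:R `^ _ * ln _.
have B2 : (0 : R) <= 2 by [].
have B1 : (0 : R) <= 1 by [].
have h1 l : (l <= N)%N -> d1 l <= 2 * rad N l.
  by move=> lN; have [_ b c] := dev l lN; apply: le_trans (d1le l) _; lra.
have h2 l : (l <= N)%N -> d2 l <= 1 * rad N l.
  by move=> lN; have [a _ _] := dev l lN; rewrite mul1r d2E.
have [_ m1] := dyadic_rate n_ge2 N4 B2 h1.
have [_ m2] := dyadic_rate n_ge2 N4 B1 h2.
have lnlam : ln N%:R / lambda N <= alpha / 4 * y.
  have -> : ln N%:R / lambda N = alpha / 4 * (N%:R `^ (- (2 / n%:R)) * ln N%:R).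
    have powN0 : N%:R `^ (2 / n%:R) != 0 :> R by rewrite gt_eqF ?powR_gt0.
    by rewrite /lambda powRN; field; rewrite powN0 gt_eqF.
  rewrite ler_pM2l ?divr_gt0 // ler_wpM2r // ler_powR // lerN2.
  by rewrite -[leLHS]mul1r ler_pM2r ?invr_gt0 // ler1n.
have D_bounds (u v : 'rV[R]_n) : simplex u -> simplex v ->
    alpha * l2norm (u - v) ^+ 2 <= Ldiv phi u v <= alpha' * l2norm (u - v) ^+ 2.
  by move=> su sv; exact: Ldiv_bounds.
have sp (i : 'I_N) : simplex (p i w) by case: (tr i).
have sqs (i : 'I_N) : simplex (qs i) by case: (tr i).
have costE (i : 'I_N) (u : 'rV[R]_n) : simplex u -> cost (p i w) u =
    cost (p i w) (qs i) + Ldiv phi u (qs i) + entropy_potential phi u -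
    entropy_potential phi (qs i).
  by move=> su; exact: (cost_transported phi_concave dphi (tr i) su).
have sq (i : 'I_N) : simplex (q i w) by exact: qS.
apply: le_trans (W2_particle_coupling_le N0 lam0 alpha_gt0 alpha'_gt0 sp sq sqs
  Rstar1 costE D_bounds L) _.
rewrite lee_fin -/y /C.
have -> : (2 / alpha * (alpha' * (n%:R * 228) + alpha / 4) + 4 * n%:R * 116) * y =
    2 / alpha * (alpha' * (n%:R * (228 * y)) + alpha / 4 * y) + 4 * n%:R * (116 * y).
  by ring.
have m1' : multiscale L d1 <= 228 * y.
  by apply: le_trans m1 _; rewrite -/y; lra.
have m2' : multiscale L d2 <= 116 * y.
  by apply: le_trans m2 _; rewrite -/y; lra.
apply: lerD; last by rewrite ler_pM2l ?mulr_gt0.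
rewrite ler_pM2l ?divr_gt0 // lerD //.
by rewrite ler_pM2l // ler_pM2l.
Unshelve. all: by end_near.
Qed.
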